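(* Suppose that $a\in\left(\frac14,\frac12\right)$, $b\in\left(\frac13,\frac12\right)$ and $a+2b>\frac43$. Then there is a constant $C$ such that for any $g,h\in X_{b,1}$, $$\|\partial_x(g\bar h)\|_{Y_{-a,1}}\le C\|g\|_{X_{b,1}}\|h\|_{X_{b,1}}$$ and $$\|\partial_x(g\bar h)\|_{Y_{-a,1,-3/8}}\le C\|g\|_{X_{b,1}}\|h\|_{X_{b,1}}.$$
   Context: For functions (distributions) on $\mathbb{R}_x\times\mathbb{R}_t$ with space-time Fourier transform $\hat f(\xi,\tau)$, the Bourgain norms are $\|f\|_{X_{b,s}}=\left(\int_{\mathbb{R}^2}(1+|\xi|)^{2s}(1+|\tau+\xi^2|)^{2b}|\hat f|^2\,d\xi d\tau\right)^{1/2}$, $\|g\|_{Y_{b,s}}=\left(\int_{\mathbb{R}^2}(1+|\xi|)^{2s}(1+|\tau-\xi^3|)^{2b}|\hat g|^2\,d\xi d\tau\right)^{1/2}$, $\|g\|_{Y_{b,s,-3/8}}=\left(\int_{\mathbb{R}^2}|\xi|^{-3/4}(1+|\xi|)^{2s}(1+|\tau-\xi^3|)^{2b}|\hat g|^2\,d\xi d\tau\right)^{1/2}$. $\bar h$ is the complex conjugate of $h$. *)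

(* Defs.v *)
From mathcomp Require Import all_boot all_order all_algebra.
From mathcomp Require Import complex.
From mathcomp Require Import all_classical all_reals all_analysis.

Set Implicit Arguments.
Unset Strict Implicit.
Unset Printing Implicit Defensive.
Import Order.TTheory GRing.Theory Num.Theory.
Import numFieldNormedType.Exports.
Import Normc.

Local Open Scope classical_set_scope.
Local Open Scope ring_scope.
Local Open Scope complex_scope.

Section BourgainSpaces.
Context {R : realType}.

(* Points are pairs (x, t), resp. (xi, tau) on the Fourier side. *)
Definition plane_measure :
    {measure set (measurableTypeR R * measurableTypeR R) -> \bar R} :=
  (lebesgue_measure \x lebesgue_measure)%E.

Definition cmeasurable (f : R * R -> R[i]) : Prop :=
  measurable_fun [set: R * R] (fun p => complex.Re (f p)) /\
  measurable_fun [set: R * R] (fun p => complex.Im (f p)).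

Definition cintegrable (f : R * R -> R[i]) : Prop :=
  plane_measure.-integrable [set: R * R] (fun p => (complex.Re (f p))%:E) /\
  plane_measure.-integrable [set: R * R] (fun p => (complex.Im (f p))%:E).

Definition cintegral (f : R * R -> R[i]) : R[i] :=
  Rintegral plane_measure [set: R * R] (fun p => complex.Re (f p)) +i*
  Rintegral plane_measure [set: R * R] (fun p => complex.Im (f p)).

Definition square_integrable (f : R * R -> R[i]) : Prop :=
  cmeasurable f /\
  (\int[plane_measure]_(p in [set: R * R]) ((normc (f p)) ^+ 2)%:E < +oo)%E.

(* The restriction of f to the line through p parallel to the first axis
   ([true]) or to the second axis ([false]). *)
Definition slice (i : bool) (f : R * R -> R[i]) (p : R * R) (y : R) : R[i] :=
  if i then f (y, p.2) else f (p.1, y).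

Definition coordinate (i : bool) (p : R * R) : R := if i then p.1 else p.2.

Definition partial_derivable (i : bool) (f : R * R -> R[i]) : Prop :=
  forall p, derivable (fun y => complex.Re (slice i f p y)) (coordinate i p) 1 /\
            derivable (fun y => complex.Im (slice i f p y)) (coordinate i p) 1.

Definition partial (i : bool) (f : R * R -> R[i]) (p : R * R) : R[i] :=
  derive1 (fun y => complex.Re (slice i f p y)) (coordinate i p) +i*
  derive1 (fun y => complex.Im (slice i f p y)) (coordinate i p).

Definition iter_partial (w : seq bool) (f : R * R -> R[i]) : R * R -> R[i] :=
  foldr partial f w.

(* All iterated partial derivatives exist everywhere; together with the decay
   required below they are then bounded, hence also continuous. *)
Definition smooth (f : R * R -> R[i]) : Prop :=
  forall w i, partial_derivable i (iter_partial w f).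

Definition schwartz (f : R * R -> R[i]) : Prop :=
  smooth f /\
  forall w m n, exists M : R, forall p,
    `|p.1| ^+ m * `|p.2| ^+ n * normc (iter_partial w f p) <= M.

(* Tempered distributions, of which only the values on Schwartz functions
   matter. *)
Definition distrib := (R * R -> R[i]) -> R[i].

Definition distr_of (f : R * R -> R[i]) : distrib :=
  fun phi => cintegral (fun p => f p * phi p).

Definition distr_dx (T : distrib) : distrib :=
  fun phi => - T (partial true phi).

Definition fourier_transform (phi : R * R -> R[i]) : R * R -> R[i] :=
  fun z => cintegral (fun p =>
    phi p * (cos (p.1 * z.1 + p.2 * z.2) -i* sin (p.1 * z.1 + p.2 * z.2))).

Definition distr_fourier (T : distrib) : distrib :=
  fun phi => T (fourier_transform phi).

Definition represented_by (T : distrib) (F : R * R -> R[i]) : Prop :=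
  cmeasurable F /\
  forall phi, schwartz phi ->
    cintegrable (fun p => F p * phi p) /\ T phi = distr_of F phi.

Definition weighted_norm (w : R * R -> R) (F : R * R -> R[i]) : \bar R :=
  ((\int[plane_measure]_(z in [set: R * R])
      (w z * (normc (F z)) ^+ 2)%:E) `^ (2^-1))%E.

(* The function representing the Fourier transform of T is unique up to a null
   set, so the infimum is its weighted norm; it is the infimum of the empty set,
   that is +oo, when the Fourier transform of T is not a function. *)
Definition fourier_norm (w : R * R -> R) (T : distrib) : \bar R :=
  ereal_inf [set weighted_norm w F |
             F in [set F | represented_by (distr_fourier T) F]].

Definition X_norm (b s : R) : distrib -> \bar R :=
  fourier_norm (fun z =>
    (1 + `|z.1|) `^ (2 * s) * (1 + `|z.2 + z.1 ^+ 2|) `^ (2 * b)).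

Definition Y_norm (b s : R) : distrib -> \bar R :=
  fourier_norm (fun z =>
    (1 + `|z.1|) `^ (2 * s) * (1 + `|z.2 - z.1 ^+ 3|) `^ (2 * b)).

(* The norm of Y_{b,s,-3/8}. The library has 0 `^ r = 0 for r <> 0, so that
   the weight is 0 instead of +oo on the null set z.1 = 0. *)
Definition Y_low_norm (b s : R) : distrib -> \bar R :=
  fourier_norm (fun z =>
    `|z.1| `^ (- (3 / 4)) *
    (1 + `|z.1|) `^ (2 * s) * (1 + `|z.2 - z.1 ^+ 3|) `^ (2 * b)).

(* The elements of X_{b,s} for b, s >= 0. The weight is then at least 1, so
   by Plancherel's theorem every tempered distribution of finite X_{b,s} norm is
   a square integrable function. *)
Definition in_X (b s : R) (f : R * R -> R[i]) : Prop :=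
  square_integrable f /\ (X_norm b s (distr_of f) < +oo)%E.

End BourgainSpaces.

(* Main.v *)
Require Import Defs.
From HB Require Import structures.
From mathcomp Require Import all_boot all_order all_algebra.
From mathcomp Require Import complex.
From mathcomp Require Import all_classical all_reals all_analysis.
From mathcomp Require Import measurable_realfun.
From mathcomp Require Import ring lra.

(* Let G and H be the Fourier transforms of g and h. The Fourier transform of
   d_x (g * conj h) at z = (xi, tau) is i xi times the correlation
   B z = int g (conj h) exp(-i p.z) dp, and

     |B z| <= (2 pi)^-2 int |G w| |H (w - z)| dw.

   This bound follows from the weak definition of the Fourier transform by testing
   it with Gaussian wave packets: they represent the average of g over the scale t
   by G, and t tends to 0 by the continuity of translations in L^2.

   Since |xi|^2 and |xi|^(-3/4) |xi|^2 are both at most 1 + xi^2, the two norms can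
   be treated together. By Cauchy-Schwarz in w it is enough to bound, uniformly in z,

     (1 + xi^2) (1 + |xi|)^2 (1 + |tau - xi^3|)^(-2a) int dw / (W w W (w - z)),

   W being the weight of X_{b,1}. Integrating out the second coordinate of w leaves an
   integral in one variable x of (1 + |D|)^(-2/3), up to the weights in x, where
   D = tau +- xi^2 + 2 xi x; here b > 5/12 is used, which follows from a < 1/2 and
   a + 2b > 4/3. For large xi the resonance identity
   xi^3 = (xi^3 - tau) + D -+ xi^2 - 2 xi x makes one of |tau - xi^3|, |D| and |xi x|
   comparable with |xi|^3, which pays for xi^2. *)

Set Implicit Arguments.
Unset Strict Implicit.
Unset Printing Implicit Defensive.
Import Order.TTheory GRing.Theory Num.Theory.
Import numFieldNormedType.Exports.
Import Normc.

Local Open Scope classical_set_scope.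
Local Open Scope ring_scope.
Local Open Scope complex_scope.

(** The exponents fit together as follows. Where |D| is at least of order |xi|^3, its weight alone
    pays for xi^2, and (|xi|^3)^(-2/3) does so exactly. Two time weights of exponent 2b leave decay
    2/3 in D times a remainder of exponent 4b - 2/3, which exceeds 1 exactly when b > 5/12. Where
    |tau - xi^3| is large, a >= 1/4 reduces xi^2 to |xi|^(1/2), and this is balanced against the
    Jacobian 1/|2 xi| of x -> D.

    The norms are infima over the functions that represent a Fourier transform. The estimate is
    proved for every pair of representatives and the infimum is taken afterwards, so uniqueness of
    the representative never enters.

    The Fourier transform maps a Gaussian packet to a Gaussian packet of reciprocal width. Testing
    with packets therefore yields Gaussian averages of g and of H as absolutely convergent
    integrals, without Plancherel or inversion for g and h themselves. The Gaussian has mass 2 pi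
    and is not normalised: each of the two tests contributes a factor (2 pi)^-1, and the masses on
    the two sides cancel. *)

Section product_sigma_finite.
Local Open Scope ereal_scope.
Context d1 d2 (T1 : measurableType d1) (T2 : measurableType d2) (R : realType).
Variables (m1 : {sigma_finite_measure set T1 -> \bar R})
  (m2 : {sigma_finite_measure set T2 -> \bar R}).

Lemma product_sigma_finite : sigma_finite [set: T1 * T2] (m1 \x m2).
Proof.
have /sigma_finiteP[F [FT ndF Ffin]] := sigma_finiteT m1.
have /sigma_finiteP[G [GT ndG Gfin]] := sigma_finiteT m2.
exists (fun n => F n `*` G n).
  apply/seteqP; split => // -[x y] _.
  have [i _ Fx] : (\bigcup_i F i) x by rewrite -FT.
  have [j _ Gy] : (\bigcup_i G i) y by rewrite -GT.
  exists (maxn i j) => //; split => /=.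
    have /subsetPset : (F i <= F (maxn i j))%O by apply: ndF; exact: leq_maxl.
    by apply.
  have /subsetPset : (G j <= G (maxn i j))%O by apply: ndG; exact: leq_maxr.
  by apply.
move=> n; have [mF Fn] := Ffin n; have [mG Gn] := Gfin n.
split; first exact: measurableX.
rewrite [ltLHS](product_measure1E _ _ mF mG).
by rewrite lte_mul_pinfty// ge0_fin_numE.
Qed.

End product_sigma_finite.

(** * Affine changes of variable *)

Section affine.
Context {R : realType}.
Notation RR := (measurableTypeR R).
Local Notation leb := (@lebesgue_measure R).

(** The same product as [plane_measure], named so that it can carry a sigma-finite structure:
    Tonelli is applied below to pairs of points of the plane. *)
Definition plane : set (RR * RR)%type -> \bar R := (leb \x leb)%E.
HB.instance Definition _ := Measure.on plane.
HB.instance Definition _ :=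
  @Measure_isSigmaFinite.Build _ _ _ plane (product_sigma_finite leb leb).
Lemma measurable_affine (a b : R) :
  measurable_fun [set: RR] ((fun x : R => a * x + b) : RR -> RR).
Proof.
apply: measurable_funD => //; apply: measurable_funM => //.
Qed.

(** Lebesgue measure is determined by its values on half-open intervals, and A -> |a| leb (phi^-1 A)
    has the same values there. Integration against this scaled pushforward is the substitution
    rule. *)
Lemma ge0_integral_affine (a b : R) (f : R -> \bar R) : a != 0 ->
  measurable_fun [set: RR] f -> (forall x, 0 <= f x)%E ->
  (\int[leb]_x f (a * x + b)%R = (`|a|^-1)%:E * \int[leb]_x f x)%E.
Proof.
move=> a0 mf f0.
pose phi : RR -> RR := (fun x : R => a * x + b).
have mphi : measurable_fun [set: RR] phi by exact: measurable_affine.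
pose k : {nonneg R} := NngNum (normr_ge0 a).
pose m : {measure set RR -> \bar R} :=
  measure_function_pushforward__canonical__measure_function_Measure leb mphi.
pose nu := mscale k m.
have leb_nu A : measurable A -> leb A = nu A.
  move=> mA; apply: lebesgue_measure_unique mA.
  move=> _ [[x y] _ <-] /=.
  rewrite /nu /mscale/= /pushforward.
  have [xy|yx] := ltP x y; last first.
    rewrite set_itv_ge ?bnd_simp -?leNgt// preimage_set0 !measure0.
    by rewrite mule0.
  rewrite lebesgue_measure_itv/= lte_fin xy.
  have [a_gt0|a_le0] := ltP 0 a.
    have -> : phi @^-1` `]x, y]%classic = `](x - b) / a, (y - b) / a]%classic.
      apply/seteqP; split => z /=; rewrite !in_itv/= /phi ltr_pdivrMr//
        ler_pdivlMr// ltrBlDr lerBrDr mulrC//.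
    rewrite lebesgue_measure_itv/= lte_fin ltr_pM2r ?invr_gt0// ltrD2r xy.
    rewrite -!EFinB -EFinM; congr (_%:E).
    by rewrite gtr0_norm//; field.
  (* A negative slope makes the preimage half-open at the other end; its length is unaffected. *)
  have a_lt0 : a < 0 by rewrite lt_neqAle a0.
  have -> : phi @^-1` `]x, y]%classic = `[(y - b) / a, (x - b) / a[%classic.
    apply/seteqP; split => z /=; rewrite !in_itv/= /phi ler_ndivrMr//
      ltr_ndivlMr// ltrBlDr lerBrDr mulrC => /andP[-> ->] //.
  rewrite lebesgue_measure_itv/= lte_fin ltr_nM2r ?invr_lt0// ltrD2r xy.
  rewrite -!EFinB -EFinM; congr (_%:E).
  by rewrite ltr0_norm//; field.
have -> : (\int[leb]_x f x = \int[nu]_x f x)%E.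
  by apply: eq_measure_integral => A mA _; exact: leb_nu.
rewrite ge0_integral_mscale// ge0_integral_pushforward//=.
rewrite preimage_setT muleA -EFinM mulVf ?normr_eq0// mul1e.
by apply: eq_integral.
Qed.

End affine.

(** * Power weights *)

Section power_weight.
Context {R : realType}.
Notation RR := (measurableTypeR R).
Local Notation leb := (@lebesgue_measure R).

Lemma is_derive_add (f g : R -> R) (x a b : R) :
  is_derive x 1 f a -> is_derive x 1 g b ->
  is_derive x 1 (fun y => f y + g y) (a + b).
Proof. exact: is_deriveD. Qed.

Lemma is_derive_mul (f g : R -> R) (x a b : R) :
  is_derive x 1 f a -> is_derive x 1 g b ->
  is_derive x 1 (fun y => f y * g y) (a * g x + f x * b).
Proof.
move=> df dg; have := is_deriveM df dg.
by rewrite /GRing.scale /= addrC [g x * a]mulrC.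
Qed.

Lemma is_derive_constl (c x : R) : is_derive x 1 (fun=> c) 0.
Proof. exact: is_derive_cst. Qed.

Lemma is_derive_affine (c d x : R) : is_derive x 1 (fun y => c * y + d) c.
Proof.
have := is_derive_add (is_derive_mul (is_derive_constl c x) (is_derive_id x 1))
  (is_derive_constl d x).
by rewrite mul0r add0r addr0 mulr1.
Qed.

Lemma cvgr_powRN (q : R) : 0 < q -> x `^ (- q) @[x --> +oo] --> (0 : R).
Proof.
move=> q0; apply/cvgrPdist_lt => e e0; near=> x.
rewrite sub0r normrN ger0_norm ?powR_ge0// powRN.
have x0 : 0 < x by near: x; exact: nbhs_pinfty_gt.
rewrite -[ltRHS]invrK ltf_pV2 ?posrE ?powR_gt0 ?invr_gt0//.
have -> : e^-1 = (e^-1 `^ q^-1) `^ q.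
  by rewrite -powRrM mulVf ?gt_eqF// powRr1// invr_ge0 ltW.
have xe : e^-1 `^ q^-1 < x by near: x; apply: nbhs_pinfty_gt; exact: num_real.
by apply: gt0_ltr_powR; rewrite ?nnegrE ?powR_ge0 ?ltW.
Unshelve. all: end_near. Qed.

(** The negative power <x>^(-p) of the Japanese bracket, with 1 + |x| for the bracket as in the
    Bourgain norms. *)
Definition jap (p x : R) : R := (1 + `|x|) `^ (- p).

Lemma onenorm_gt0 (x : R) : 0 < 1 + `|x|.
Proof. by rewrite ltr_pwDl. Qed.

Lemma onenorm_ge1 (x : R) : 1 <= 1 + `|x|.
Proof. by rewrite lerDl. Qed.

Lemma jap_ge0 p x : 0 <= jap p x.
Proof. exact: powR_ge0. Qed.

Lemma jap_le1 p x : 0 <= p -> jap p x <= 1.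
Proof.
move=> p0; rewrite /jap -[leRHS](powRr0 (1 + `|x|)).
by apply: ler_powR; rewrite ?onenorm_ge1 ?oppr_le0.
Qed.

Lemma continuous_powR_comp (p : R) (f : R -> R) x : 0 < f x ->
  {for x, continuous f} -> {for x, continuous (fun y => f y `^ p)}.
Proof.
move=> fx cf.
have cp : {for f x, continuous (fun u : R => u `^ p : R)}.
  apply/differentiable_continuous/derivable1_diffP.
  by have [] := is_derive1_powR p fx.
exact: (@cvg_comp _ _ _ f (fun u : R => u `^ p : R) _ _ _ cf cp).
Qed.

Lemma continuous_jap p : continuous (jap p).
Proof.
move=> x; apply: (@continuous_powR_comp (- p) (fun x => 1 + `|x|)); first exact: onenorm_gt0.
apply: continuousD; first exact: cst_continuous.
exact: norm_continuous.
Qed.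

Lemma measurable_jap p : measurable_fun [set: RR] (jap p).
Proof. by apply: continuous_measurable_fun; exact: continuous_jap. Qed.

(** Evenness reduces the integral to the half-line, where (1 + x)^(1 - p) / (1 - p) is an
    antiderivative that tends to 0 at infinity. *)
Lemma integral_jap_lty p : 1 < p -> (\int[leb]_x (jap p x)%:E < +oo)%E.
Proof.
move=> p1; rewrite ge0_symfun_integralT//; last 3 first.
- by move=> x; exact: jap_ge0.
- exact: continuous_jap.
- by move=> x; rewrite /jap /= normrN.
rewrite (_ : [set x | _] = `[0, +oo[%classic); last first.
  by apply/seteqP; split => x/=; rewrite in_itv/= andbT.
have dF (x : R) : 0 < x -> is_derive x 1 (fun x : R => (1 - p)^-1 * (1 + x) `^ (1 - p))
    ((1 + x) `^ (- p)).
  move=> x0; have x1 : 0 < 1 + x by lra.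
  have H : is_derive x (1 : R) (fun y : R => 1 + y) 1.
    have := is_derive_add (is_derive_constl 1 x) (is_derive_id x 1).
    by rewrite add0r.
  have := is_derive1_comp (is_derive1_powR (1 - p) x1) H.
  move=> /(is_deriveZ (1 - p)^-1); rewrite /GRing.scale /= mulr1.
  by rewrite addrAC subrr add0r mulrA mulVf ?mul1r// subr_eq0 lt_eqF.
rewrite (@ge0_continuous_FTC2y _ _ (fun x : R => (1 - p)^-1 * (1 + x) `^ (1 - p)) 0 0).
- by rewrite -EFinB -EFinM ltry.
- by move=> x _; exact: jap_ge0.
- by apply: continuous_subspaceT => x; exact: continuous_jap.
- rewrite -(mulr0 (1 - p)^-1); apply: cvgMr.
  have -> : (fun x : R => (1 + x) `^ (1 - p)) = (fun x => x `^ (- (p - 1))) \o (fun x => 1 + x).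
    by apply/funext => x /=; rewrite opprB.
  apply: (@cvg_comp _ _ _ _ _ _ (+oo)); last by apply: cvgr_powRN; rewrite subr_gt0.
  apply/cvgryPgt => A; near=> x; rewrite -ltrBlDl.
  by near: x; apply: nbhs_pinfty_gt; exact: num_real.
- by move=> x /dF [].
- apply: cvg_at_right_filter; apply: cvgMr.
  apply: (@continuous_powR_comp (1 - p) (fun x => 1 + x)); first by lra.
  by apply: continuousD; [exact: cst_continuous|].
- move=> x; rewrite in_itv/= andbT => x0.
  rewrite derive1E; have [_ ->] := dF _ x0.
  by rewrite /jap ger0_norm ?ltW.
Unshelve. all: end_near. Qed.
End power_weight.

(** * Pointwise estimates for power weights *)

Section jap_estimates.
Context {R : realType}.
Implicit Types x y s t p q r : R.

Lemma le_integralT d (T : measurableType d) (mu : {measure set T -> \bar R})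
    (f g : T -> \bar R) : (forall z, 0 <= f z)%E -> (forall z, f z <= g z)%E ->
  (\int[mu]_z f z <= \int[mu]_z g z)%E.
Proof.
move=> f0 fg; rewrite !ge0_integralTE//; last by move=> z; exact: le_trans (fg z).
apply: ereal_sup_le => _ [h hf <-]; exists h => // z.
exact: le_trans (fg z).
Qed.

Lemma jap_gt0 p x : 0 < jap p x.
Proof. by rewrite powR_gt0// onenorm_gt0. Qed.

Lemma japD p q x : jap p x * jap q x = jap (p + q) x.
Proof.
rewrite /jap -powRD ?opprD//.
by apply/implyP => _; rewrite gt_eqF ?onenorm_gt0.
Qed.

Lemma jap_scale r x y (c : R) : 0 <= r -> 0 < c -> 1 + `|x| <= c * (1 + `|y|) ->
  jap r y <= c `^ r * jap r x.
Proof.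
move=> r0 c0 xy; rewrite /jap !powRN ler_pdivlMr ?powR_gt0 ?onenorm_gt0//.
rewrite mulrC ler_pdivrMr ?powR_gt0 ?onenorm_gt0//.
rewrite -powRM ?(ltW c0) ?(ltW (onenorm_gt0 _))//.
by apply: ge0_ler_powR; rewrite ?nnegrE// ?mulr_ge0 ?(ltW c0) ?(ltW (onenorm_gt0 _)).
Qed.

Lemma le_jap r x y : 0 <= r -> `|x| <= `|y| -> jap r y <= jap r x.
Proof.
move=> r0 xy; have := @jap_scale r x y 1 r0 ltr01.
by rewrite powR1 !mul1r lerD2l; exact.
Qed.

Lemma le_japr p q x : p <= q -> jap q x <= jap p x.
Proof. by move=> pq; apply: ler_powR; rewrite ?onenorm_ge1// lerN2. Qed.

(** Replacing the variable of larger modulus by the other one only increases the product, so the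
    whole exponent falls on the smaller variable. *)
Lemma jap_young p q x y : 0 <= p -> 0 <= q ->
  jap p x * jap q y <= jap (p + q) x + jap (p + q) y.
Proof.
move=> p0 q0; have [xy|/ltW yx] := leP `|x| `|y|.
  apply: le_trans (_ : jap p x * jap q x <= _).
    by rewrite ler_wpM2l ?jap_ge0 ?le_jap.
  by rewrite japD lerDl jap_ge0.
apply: le_trans (_ : jap p y * jap q y <= _).
  by rewrite ler_wpM2r ?jap_ge0 ?le_jap.
by rewrite japD lerDr jap_ge0.
Qed.

(** The larger of |s| and |t| is at least |x| / 2. An amount r of its decay is spent on x, at the
    price 2^r <= 2, and the remaining q - r is moved to the smaller variable. *)
Lemma jap_conv q r s t x : 0 <= r -> r <= 1 -> r <= q -> `|x| <= `|s| + `|t| ->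
  jap q s * jap q t <= 2 * jap r x * (jap (2 * q - r) s + jap (2 * q - r) t).
Proof.
move=> r0 r1 rq; wlog st : s t / `|s| <= `|t|.
  move=> H xst; have [st|/ltW ts] := leP `|s| `|t|; first exact: H.
  by rewrite [jap q s * _]mulrC [jap _ s + _]addrC; apply: H => //; rewrite addrC.
move=> xst.
have H1 : jap r t <= 2 * jap r x.
  apply: le_trans (jap_scale (x := x) (c := 2) r0 _ _) _ => //.
    by lra.
  rewrite ler_wpM2r ?jap_ge0//.
  by apply: ler1_powR => //; lra.
have -> : jap q t = jap r t * jap (q - r) t by rewrite japD addrC subrK.
apply: le_trans (_ : jap q s * (2 * jap r x * jap (q - r) s) <= _).
  rewrite ler_wpM2l ?jap_ge0// ler_pM ?jap_ge0// le_jap//.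
  by rewrite subr_ge0.
rewrite mulrCA ler_wpM2l ?mulr_ge0 ?jap_ge0// japD.
have -> : q + (q - r) = 2 * q - r by ring.
by rewrite lerDl jap_ge0.
Qed.

(** The larger of the two input frequencies absorbs the weight (1 + |z|)^2 of the output, at the
    price 2^2. What is left is one weight in the smaller frequency; the sum covers both cases. *)
Lemma jap2_split x y (z : R) : `|z| <= `|x| + `|y| ->
  (1 + `|z|) ^+ 2 * (jap 2 x * jap 2 y) <= 4 * (jap 2 x + jap 2 y).
Proof.
wlog xy : x y / `|x| <= `|y|.
  move=> H zxy; have [xy|/ltW yx] := leP `|x| `|y|; first exact: H.
  by rewrite [jap 2 x * _]mulrC [jap 2 x + _]addrC; apply: H => //; rewrite addrC.
move=> zxy.
have H1 : (1 + `|z|) ^+ 2 * jap 2 y <= 4.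
  rewrite /jap powR_invn ?(ltW (onenorm_gt0 _))//.
  rewrite ler_pdivrMr ?exprn_gt0 ?onenorm_gt0//.
  have -> : 4 * (1 + `|y|) ^+ 2 = (2 * (1 + `|y|)) ^+ 2 by ring.
  have z0 := normr_ge0 z; have y0 := normr_ge0 y.
  by rewrite ler_pXn2r// ?nnegrE; lra.
rewrite mulrCA; apply: le_trans (_ : jap 2 x * 4 <= _).
  by rewrite ler_wpM2l ?jap_ge0.
by rewrite mulrC ler_pM2l// lerDl jap_ge0.
Qed.

(* Resonance: [xi^3 = (xi^3 - tau) + D -+ xi^2 - 2 xi x], hence for large [xi] one of
   [tau - xi^3], [D] and [xi x] is comparable with [xi^3]. *)
Lemma jap_resonance (a xi tau sg x D : R) : 1 / 4 <= a -> sg \in [:: 1; -1] ->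
  16 <= `|xi| ->
  D = tau + sg * xi ^+ 2 + 2 * xi * x ->
  xi ^+ 2 * jap (2 * a) (tau - xi ^+ 3) * (jap 2 x * jap (2 / 3) D) <=
  4 * jap 2 x + 16 * (jap (5 / 3) x + jap (5 / 3) D) +
  2 * (jap 4 x + `|xi| / 2 * jap (4 / 3) D).
Proof.
move=> a4 sgE X16 DE.
set X := `|xi|; have X0 : 0 < X by rewrite /X; lra.
(* With |xi| = 2 y the left side of the resonance identity is 8 y^3, enough to compare each term on
   the right with y^3. *)
have [y yE] : exists y, X = 2 * y by exists (X / 2); field.
have y0 : 0 < y by move: X0; rewrite yE; lra.
have xi2 : xi ^+ 2 = 4 * y ^+ 2.
  by rewrite -[xi ^+ 2]real_normK ?num_real// -/X yE; ring.
have yV (r : R) (u : R) : 0 <= r -> y ^+ 3 <= `|u| -> jap r u <= y `^ (- (3 * r)).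
  move=> r0 yu; rewrite /jap -mulrN powRrM powR_mulrn ?(ltW y0)//.
  rewrite !powRN lef_pV2 ?posrE ?powR_gt0 ?exprn_gt0 ?onenorm_gt0//.
  apply: ge0_ler_powR; rewrite ?nnegrE ?exprn_ge0 ?(ltW y0) ?(ltW (onenorm_gt0 _))//.
  by rewrite (le_trans yu)// lerDr.
have nn := (jap_ge0 2 x, jap_ge0 (5 / 3) x, jap_ge0 (5 / 3) D, jap_ge0 4 x,
   jap_ge0 (4 / 3) D, jap_ge0 (2 / 3) D, jap_ge0 (2 * a) (tau - xi ^+ 3)).
have j1 : jap (2 * a) (tau - xi ^+ 3) <= 1 by apply: jap_le1; lra.
have P2 : 0 <= 16 * (jap (5 / 3) x + jap (5 / 3) D) by rewrite !(mulr_ge0, addr_ge0) ?nn.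
have P3 : 0 <= 2 * (jap 4 x + X / 2 * jap (4 / 3) D).
  by rewrite !(mulr_ge0, addr_ge0) ?nn ?invr_ge0// ltW.
have P1 : 0 <= 4 * jap 2 x by rewrite mulr_ge0 ?nn.
(* If |D| >= y^3, the exponent 2/3 gives y^(-2), which cancels xi^2 = 4 y^2. *)
have [D_large|D_small] := leP (y ^+ 3) `|D|.
  have : jap (2 / 3) D <= (y ^+ 2)^-1.
    by rewrite -powR_invn ?(ltW y0)//; have := yV (2 / 3) D; rewrite (_ : 3 * (2 / 3) = 2%:R); [apply=> //; lra|field].
  move=> H; suff : xi ^+ 2 * jap (2 * a) (tau - xi ^+ 3) * (jap 2 x * jap (2 / 3) D)
     <= 4 * jap 2 x by lra.
  have y20 : 0 <= 4 * y ^+ 2 by rewrite mulr_ge0// exprn_ge0// ltW.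
  have K1 : 4 * y ^+ 2 * jap (2 * a) (tau - xi ^+ 3) <= 4 * y ^+ 2 * 1.
    exact: ler_wpM2l.
  have K2 : jap 2 x * jap (2 / 3) D <= jap 2 x * (y ^+ 2)^-1.
    by apply: ler_wpM2l => //; exact: jap_ge0.
  apply: le_trans (_ : (4 * y ^+ 2) * 1 * (jap 2 x * (y ^+ 2)^-1) <= _).
    by rewrite xi2 ler_pM// mulr_ge0// ?jap_ge0.
  by rewrite le_eqVlt; apply/orP; left; apply/eqP; field; rewrite gt_eqF.
(* If |x| is at least of order y^2, one of the two powers in [jap 2 x] pays for xi^2; the other is
   combined with the weight of D into exponent 5/3. *)
have [x_large|x_small] := leP (y ^+ 2) (4 * `|x|).
  have H : xi ^+ 2 * jap 2 x <= 16 * jap 1 x.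
    rewrite xi2 (_ : jap 2 x = jap 1 x * jap 1 x); last by rewrite japD; congr jap; ring.
    rewrite mulrCA mulrC ler_wpM2r ?jap_ge0// /jap powR_inv1 ?(ltW (onenorm_gt0 _))//.
    rewrite ler_pdivrMr ?onenorm_gt0//; have := normr_ge0 x; lra.
  have H2 : jap 1 x * jap (2 / 3) D <= jap (5 / 3) x + jap (5 / 3) D.
    have := @jap_young 1 (2 / 3) x D; rewrite (_ : 1 + 2 / 3 = 5 / 3); last by field.
    by apply; lra.
  suff : xi ^+ 2 * jap (2 * a) (tau - xi ^+ 3) * (jap 2 x * jap (2 / 3) D)
     <= 16 * (jap (5 / 3) x + jap (5 / 3) D) by lra.
  apply: le_trans (_ : 16 * jap 1 x * jap (2 / 3) D <= _); last first.
    by rewrite -mulrA ler_wpM2l.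
  rewrite mulrA ler_wpM2r ?nn// mulrAC.
  rewrite -[leRHS]mulr1; apply: ler_pM => //; last exact: jap_ge0.
  by apply: mulr_ge0; [exact: sqr_ge0|exact: jap_ge0].
(* Here |D| and 4 y |x| are at most y^3, and 4 y^2 <= y^3 / 2 because |xi| >= 16 means y >= 8; of
   the 8 y^3 more than y^3 is left for tau - xi^3. *)
have t_large : y ^+ 3 <= `|tau - xi ^+ 3|.
  have E : xi ^+ 3 = (xi ^+ 3 - tau) + D - sg * xi ^+ 2 - 2 * xi * x by rewrite DE; ring.
  have X3 : `|xi ^+ 3| = 8 * y ^+ 3 by rewrite normrX -/X yE; ring.
  have S2 : `|sg * xi ^+ 2| = 4 * y ^+ 2.
    have E2 : `|4 * y ^+ 2| = 4 * y ^+ 2 by rewrite ger0_norm// mulr_ge0// exprn_ge0// ltW.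
    rewrite normrM xi2 E2.
    by move: sgE; rewrite !inE => /orP[/eqP->|/eqP->]; rewrite ?normrN normr1 mul1r.
  have S3 : `|2 * xi * x| = 4 * y * `|x| by rewrite !normrM ger0_norm// -/X yE; ring.
  have := ler_normB (xi ^+ 3 - tau + D - sg * xi ^+ 2) (2 * xi * x).
  have := ler_normB (xi ^+ 3 - tau + D) (sg * xi ^+ 2).
  have := ler_normD (xi ^+ 3 - tau) D.
  rewrite -E X3 S2 S3 (distrC tau) => N1 N2 N3.
  have y8 : 8 <= y by move: X16; rewrite -/X yE; lra.
  have y2 : 8 * y ^+ 2 <= y ^+ 3 by rewrite [y ^+ 3]exprS ler_wpM2r ?exprn_ge0 ?(ltW y0).
  have y3 : 4 * y * `|x| <= y ^+ 3.
    rewrite (_ : 4 * y * `|x| = y * (4 * `|x|)); last by ring.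
    by rewrite [y ^+ 3]exprS; apply: ler_wpM2l; exact: ltW.
  have y4 : 0 <= y ^+ 3 by rewrite exprn_ge0 ?(ltW y0).
  by lra.
have H : jap (2 * a) (tau - xi ^+ 3) <= y `^ (- (3 / 2)).
  apply: le_trans (le_japr _ (_ : 1 / 2 <= _)) _; first by lra.
  have := yV (1 / 2) _ _ t_large; rewrite (_ : 3 * (1 / 2) = 3 / 2); last by field.
  by apply; lra.
(* Since 2 a >= 1/2, the weight is at most y^(-3/2), half a power of y short of cancelling xi^2. *)
have H2 : xi ^+ 2 * jap (2 * a) (tau - xi ^+ 3) <= 4 * Num.sqrt y.
  rewrite xi2 -mulrA ler_wpM2l//; apply: le_trans (_ : y ^+ 2 * y `^ (- (3 / 2)) <= _).
    by rewrite ler_wpM2l ?exprn_ge0 ?(ltW y0).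
  rewrite -powR_mulrn ?(ltW y0)// -powRD ?(gt_eqF y0) ?implybT//.
  rewrite -powR12_sqrt ?(ltW y0)// (_ : 2%:R + - (3 / 2) = 2^-1)//; by field.
suff : xi ^+ 2 * jap (2 * a) (tau - xi ^+ 3) * (jap 2 x * jap (2 / 3) D)
     <= 2 * (jap 4 x + X / 2 * jap (4 / 3) D) by lra.
apply: le_trans (_ : 4 * Num.sqrt y * (jap 2 x * jap (2 / 3) D) <= _).
  by rewrite ler_wpM2r// mulr_ge0 ?nn.
have -> : jap 4 x = jap 2 x ^+ 2 by rewrite expr2 japD; congr jap; ring.
have -> : jap (4 / 3) D = jap (2 / 3) D ^+ 2 by rewrite expr2 japD; congr jap; field.
have -> : X / 2 = y by rewrite yE; field.
rewrite -[X in _ + X * _](sqr_sqrtr (ltW y0)) -exprMn.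
(* The square distributes the surplus: the root of y becomes a full y in front of [jap (4 / 3) D]
   alone, where the Jacobian of x -> D will remove it. *)
have := sqr_ge0 (jap 2 x - Num.sqrt y * jap (2 / 3) D).
by rewrite sqrrB; lra.
Qed.

End jap_estimates.

(** * Measurability of explicit formulas *)

Section measurability.
Context d (T : measurableType d) {R : realType}.
Notation RR := (measurableTypeR R).
Implicit Types f g : T -> R.

Lemma mfE f : measurable_fun [set: T] f -> measurable_fun [set: T] (fun x => (f x)%:E).
Proof. by move=> mf; apply/measurable_EFinP. Qed.

Lemma mfD f g : measurable_fun [set: T] f -> measurable_fun [set: T] g ->
  measurable_fun [set: T] (fun x => f x + g x).
Proof. exact: measurable_funD. Qed.

Lemma mfM f g : measurable_fun [set: T] f -> measurable_fun [set: T] g ->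
  measurable_fun [set: T] (fun x => f x * g x).
Proof. exact: measurable_funM. Qed.

Lemma mfN f : measurable_fun [set: T] f -> measurable_fun [set: T] (fun x => - f x).
Proof. exact: measurable_funN. Qed.

Lemma mfX f n : measurable_fun [set: T] f -> measurable_fun [set: T] (fun x => f x ^+ n).
Proof. exact: measurable_funX. Qed.

Lemma mfabs f : measurable_fun [set: T] f -> measurable_fun [set: T] (fun x => `|f x|).
Proof. by move=> mf; apply: measurableT_comp. Qed.

Lemma mfpow f (p : R) : measurable_fun [set: T] f ->
  measurable_fun [set: T] (fun x => f x `^ p).
Proof. by move=> mf; apply: (measurableT_comp (measurable_powR p)). Qed.

Lemma mfjap f (p : R) : measurable_fun [set: T] f ->
  measurable_fun [set: T] (fun x => jap p (f x)).
Proof. by move=> mf; apply: (measurableT_comp (measurable_jap p)). Qed.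

Lemma mfcont f (h : R -> R) : continuous h -> measurable_fun [set: T] f ->
  measurable_fun [set: T] (fun x => h (f x)).
Proof.
by move=> ch mf; apply: (measurableT_comp (continuous_measurable_fun ch)).
Qed.

End measurability.

Section measurability2.
Context d (T : measurableType d) d1 (T1 : measurableType d1) d2 (T2 : measurableType d2).

Lemma mffst (f : T -> T1 * T2) : measurable_fun [set: T] f ->
  measurable_fun [set: T] (fun x => (f x).1).
Proof. by move=> mf; apply: (measurableT_comp measurable_fst). Qed.

Lemma mfsnd (f : T -> T1 * T2) : measurable_fun [set: T] f ->
  measurable_fun [set: T] (fun x => (f x).2).
Proof. by move=> mf; apply: (measurableT_comp measurable_snd). Qed.

Lemma mfcomp (h : T1 -> T2) (f : T -> T1) : measurable_fun [set: T1] h ->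
  measurable_fun [set: T] f -> measurable_fun [set: T] (fun x => h (f x)).
Proof. by move=> mh mf; apply: (measurableT_comp mh). Qed.

End measurability2.

(* Dispatching on the head symbol first avoids unification attempts that unfold the real
   number structures. *)
Ltac mf_head :=
  lazymatch goal with
  | |- measurable_fun _ (fun x => x) => exact: measurable_id
  | |- measurable_fun _ (fun _ => ?c) => exact: measurable_cst
  | |- measurable_fun _ (fun x => (_)%:E) => apply: mfE
  | |- measurable_fun _ (fun x => (_ + _)%R) => apply: mfD
  | |- measurable_fun _ (fun x => (_ * _)%R) => apply: mfM
  | |- measurable_fun _ (fun x => (- _)%R) => apply: mfN
  | |- measurable_fun _ (fun x => (_ ^+ _)%R) => apply: mfX
  | |- measurable_fun _ (fun x => `|_|%R) => apply: mfabs
  | |- measurable_fun _ (fun x => (_ `^ _)%R) => apply: mfpow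
  | |- measurable_fun _ (fun x => jap _ _) => apply: mfjap
  | |- measurable_fun _ (fun x => (_, _)) => apply: measurable_fun_pair
  | |- measurable_fun _ (fun x => _.1) => apply: mffst
  | |- measurable_fun _ (fun x => _.2) => apply: mfsnd
  | |- measurable_fun _ fst => exact: measurable_fst
  | |- measurable_fun _ snd => exact: measurable_snd
  | |- measurable_fun _ (jap _) => exact: measurable_jap
  | |- measurable_fun _ ( *%R _) => apply: mfM
  end.
Ltac mf_step :=
  first
  [ match goal with
    | H : measurable_fun _ ?h |- measurable_fun _ ?h => exact: H
    | H : measurable_fun _ ?h |- measurable_fun _ (fun x => ?h (@?k x)) =>
        apply: (mfcomp H)
    end
  | mf_head
  | exact: measurable_id | exact: measurable_cst | assumption
  | exact: measurable_fst | exact: measurable_snd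
  | apply: mfE | apply: mfD | apply: mfM | apply: mfN | apply: mfX
  | apply: mfabs | apply: mfpow | apply: mfjap
  | apply: measurable_fun_pair
  | apply: mffst | apply: mfsnd ].
Ltac mf := repeat mf_step.

(** * Bounds for integrals of nonnegative functions *)

Section integral_le.
Context d (T : measurableType d) {R : realType} (mu : {measure set T -> \bar R}).

(** The bound travels with the side conditions of additivity, so that a sum of weights is integrated
    term by term without restating them. *)
Definition integral_le (f : T -> R) (c : R) :=
  [/\ forall x, 0 <= f x, measurable_fun [set: T] f & (\int[mu]_x (f x)%:E <= c%:E)%E].

Lemma integral_leD f g a b : integral_le f a -> integral_le g b ->
  integral_le (fun x => f x + g x) (a + b).
Proof.
move=> [f0 mf_ fa] [g0 mg gb]; split; [by move=> x; rewrite addr_ge0|by mf|].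
under eq_integral do rewrite EFinD.
rewrite ge0_integralD//; [by rewrite EFinD leeD| | | |].
- by move=> x _; rewrite lee_fin.
- exact: mfE.
- by move=> x _; rewrite lee_fin.
- exact: mfE.
Qed.

Lemma integral_leZ k f a : 0 <= k -> integral_le f a ->
  integral_le (fun x => k * f x) (k * a).
Proof.
move=> k0 [f0 mf_ fa]; split; [by move=> x; rewrite mulr_ge0|by mf|].
under eq_integral do rewrite EFinM.
rewrite ge0_integralZl//; [by rewrite EFinM lee_wpmul2l ?lee_fin| |].
- exact: mfE.
- by move=> x _; rewrite lee_fin.
Qed.

Lemma le_integral_le (f g : T -> R) c : (forall x, 0 <= f x) ->
  (forall x, f x <= g x) -> integral_le g c -> (\int[mu]_x (f x)%:E <= c%:E)%E.
Proof.
move=> f0 fg [_ _]; apply: le_trans; by apply: le_integralT => x; rewrite ?lee_fin /= ?lee_fin.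
Qed.

End integral_le.

(** * Integrals of power weights and the resonance integral *)

Section jap_integrals.
Context {R : realType}.
Notation RR := (measurableTypeR R).
Local Notation leb := (@lebesgue_measure R).

(** [fine] maps an infinite integral to 0, so the value is meaningful only when the integral
    converges, as for p > 1. *)
Definition Ijap (p : R) : R := fine (\int[leb]_x (jap p x)%:E).

Lemma Ijap_ge0 p : 0 <= Ijap p.
Proof. by apply: fine_ge0; apply: integral_ge0 => x _; rewrite lee_fin jap_ge0. Qed.

Lemma integral_le_jap p : 1 < p -> integral_le leb (jap p) (Ijap p).
Proof.
move=> p1; split => //; first exact: jap_ge0; first exact: measurable_jap.
rewrite fineK// ge0_fin_numE ?integral_jap_lty//.
by apply: integral_ge0 => x _; rewrite lee_fin jap_ge0.
Qed.

Lemma integral_le_jap_affine p (a b : R) : 1 < p -> a != 0 ->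
  integral_le leb (fun x : R => jap p (a * x + b)) (`|a|^-1 * Ijap p).
Proof.
move=> p1 a0; split; [by move=> x; exact: jap_ge0|by mf|].
rewrite (ge0_integral_affine b (f := EFin \o jap p) a0)//=.
- rewrite EFinM lee_wpmul2l ?lee_fin ?invr_ge0//.
  by have [] := integral_le_jap p1.
- by apply/measurable_EFinP; exact: measurable_jap.
- by move=> x; rewrite lee_fin jap_ge0.
Qed.

(** Used with q = 2 b and r = 2/3: integrating out the time frequency keeps decay 2/3 in the
    distance D between the two parabolas. *)
Lemma integral_jap_conv q r (D : R) : 0 <= r -> r <= 1 -> r <= q -> 1 < 2 * q - r ->
  (\int[leb]_s (jap q s * jap q (s - D))%:E <=
   (2 * jap r D * (Ijap (2 * q - r) + Ijap (2 * q - r)))%:E)%E.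
Proof.
move=> r0 r1 rq qr; apply: (@le_integral_le _ RR R leb (fun s => jap q s * jap q (s - D)) (fun s => 2 * jap r D *
    (jap (2 * q - r) s + jap (2 * q - r) (1 * s - D)))).
- by move=> s; rewrite mulr_ge0 ?jap_ge0.
- move=> s; rewrite mul1r; apply: jap_conv => //.
  by rewrite -[in leLHS](subKr s D); exact: ler_normB.
- apply: integral_leZ; first by rewrite mulr_ge0 ?jap_ge0.
  apply: integral_leD; first exact: integral_le_jap.
  have := integral_le_jap_affine (- D) qr (oner_neq0 _).
  by rewrite normr1 invr1 mul1r.
Qed.

(** For |xi| <= 16 the factor [jap 2 x] alone is integrable. For larger |xi| the bound of
    [jap_resonance] is integrated; D is affine in x with slope 2 xi, which compensates the factor
    |xi| / 2 in front of [jap (4 / 3) D]. *)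
Lemma integral_jap_resonance (a : R) : 1 / 4 <= a -> exists C : R, 0 <= C /\
  forall xi tau sg : R, sg \in [:: 1; -1] ->
  (\int[leb]_x ((1 + xi ^+ 2) * jap (2 * a) (tau - xi ^+ 3) *
     (jap 2 x * jap (2 / 3) (tau + sg * xi ^+ 2 + 2 * xi * x)))%:E <= C%:E)%E.
Proof.
move=> a4.
(* 257 = 1 + 16^2 bounds 1 + xi^2 for small xi. In [C2] the leading 2 comes from 1 + xi^2 <= 2 xi^2
   for large xi. *)
pose C1 : R := 257 * Ijap 2.
pose C2 : R := 2 * (4 * Ijap 2 + 16 * (Ijap (5 / 3) + Ijap (5 / 3)) +
  2 * (Ijap 4 + Ijap (4 / 3))).
have C10 : 0 <= C1 by apply: mulr_ge0; [exact: ler0n|exact: Ijap_ge0].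
have C20 : 0 <= C2 by rewrite !(mulr_ge0, addr_ge0) ?Ijap_ge0.
exists (C1 + C2); split; first exact: addr_ge0.
move=> xi tau sg sgE.
have p53 : 1 < 5 / 3 :> R by lra.
have p43 : 1 < 4 / 3 :> R by lra.
have p2 : 1 < 2 :> R by lra.
have p4 : 1 < 4 :> R by lra.
have K0 : 0 <= (1 + xi ^+ 2) * jap (2 * a) (tau - xi ^+ 3).
  by rewrite mulr_ge0 ?jap_ge0// addr_ge0 ?sqr_ge0.
have j1 : jap (2 * a) (tau - xi ^+ 3) <= 1 by apply: jap_le1; lra.
pose F x := (1 + xi ^+ 2) * jap (2 * a) (tau - xi ^+ 3) *
     (jap 2 x * jap (2 / 3) (tau + sg * xi ^+ 2 + 2 * xi * x)).
have [xi_small|xi_large] := leP `|xi| 16.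
  apply: (@le_trans _ _ C1%:E); last by rewrite lee_fin lerDl.
  apply: (@le_integral_le _ RR R leb F (fun x => 257 * jap 2 x)).
  - by move=> x; rewrite !mulr_ge0 ?jap_ge0// addr_ge0 ?sqr_ge0.
  - move=> x; apply: ler_pM => //; first by rewrite mulr_ge0 ?jap_ge0.
      have : `|xi| ^+ 2 <= 16 ^+ 2 by rewrite ler_pXn2r// nnegrE.
      rewrite real_normK ?num_real// => xi2.
      rewrite -[leRHS]mulr1; apply: ler_pM => //; [|exact: jap_ge0|lra].
      by rewrite addr_ge0 ?sqr_ge0.
    by rewrite ler_piMr ?jap_ge0// jap_le1.
  - by apply: integral_leZ; [exact: ler0n|exact: integral_le_jap].
apply: (@le_trans _ _ C2%:E); last by rewrite lee_fin lerDr.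
have xi0 : 2 * xi != 0 by rewrite mulf_neq0// -normr_gt0; lra.
have xi1 : 0 < `|xi| by lra.
pose D x := 2 * xi * x + (tau + sg * xi ^+ 2).
have ID p c : 1 < p -> `|2 * xi|^-1 <= c ->
    integral_le leb (fun x => jap p (D x)) (c * Ijap p).
  move=> p1 xic; have [H1 H2 H3] := integral_le_jap_affine (tau + sg * xi ^+ 2) p1 xi0.
  split => //; apply: (le_trans H3); rewrite lee_fin.
  by rewrite ler_wpM2r ?Ijap_ge0.
pose F1 x := 2 * (4 * jap 2 x + 16 * (jap (5 / 3) x + jap (5 / 3) (D x)) +
  2 * (jap 4 x + `|xi| / 2 * jap (4 / 3) (D x))).
apply: (@le_integral_le _ RR R leb F F1).
- by move=> x; rewrite !mulr_ge0 ?jap_ge0// addr_ge0 ?sqr_ge0.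
- move=> x; have DE : D x = tau + sg * xi ^+ 2 + 2 * xi * x by rewrite /D addrC.
  have H := jap_resonance a4 sgE (ltW xi_large) DE.
  apply: le_trans (_ : 2 * (xi ^+ 2 * jap (2 * a) (tau - xi ^+ 3) *
     (jap 2 x * jap (2 / 3) (D x))) <= _); last by rewrite ler_wpM2l.
  rewrite /F -DE [leRHS]mulrA ler_wpM2r ?mulr_ge0 ?jap_ge0//.
  rewrite mulrA ler_wpM2r ?jap_ge0//.
  have : 1 <= `|xi| ^+ 2 by rewrite exprn_ege1//; lra.
  rewrite real_normK ?num_real//; lra.
apply: integral_leZ => //; apply: integral_leD; last first.
  apply: integral_leZ => //; apply: integral_leD; first exact: integral_le_jap.
  (* The Jacobian |2 xi|^-1 is at most 2 / |xi|, which matches the factor |xi| / 2. *)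
  rewrite (_ : Ijap (4 / 3) = `|xi| / 2 * (2 / `|xi| * Ijap (4 / 3))).
    apply: integral_leZ; first by rewrite divr_ge0.
    apply: ID => //; rewrite normrM ger0_norm// invfM.
    by rewrite ler_wpM2r ?invr_ge0//; lra.
  by field; rewrite gt_eqF.
apply: integral_leD; first by apply: integral_leZ => //; exact: integral_le_jap.
apply: integral_leZ => //; apply: integral_leD; first exact: integral_le_jap.
rewrite -[Ijap _]mul1r; apply: ID => //.
by rewrite invf_le1 ?normr_gt0// normrM ger0_norm//; lra.
Qed.

End jap_integrals.

(** * The bilinear estimate *)

Section cauchy_schwarz.
Local Open Scope ereal_scope.
Context d (T : measurableType d) {R : realType} (mu : {measure set T -> \bar R}).

(** Hoelder with both exponents 2, squared: products in place of roots remain meaningful when an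
    integral is infinite. *)
Lemma ge0_cauchy_schwarz (f g : T -> R) :
  (forall x, 0 <= f x)%R -> (forall x, 0 <= g x)%R ->
  measurable_fun [set: T] f -> measurable_fun [set: T] g ->
  (\int[mu]_x (f x * g x)%:E) * (\int[mu]_x (f x * g x)%:E) <=
  (\int[mu]_x (f x ^+ 2)%:E) * (\int[mu]_x (g x ^+ 2)%:E).
Proof.
move=> f0 g0 mf_ mg.
have H22 : (2^-1 + 2^-1 = 1 :> R)%R by field.
have := hoelder mu mf_ mg (ltr0n _ 2) (ltr0n _ 2) H22.
set I := \int[mu]_x (f x * g x)%:E.
have I0 : 0 <= I by apply: integral_ge0 => x _; rewrite lee_fin mulr_ge0.
have -> : 'N[mu]_1[EFin \o (f \* g)%R] = I.
  by rewrite Lnorm1; apply: eq_integral => x _ /=; rewrite ger0_norm// mulr_ge0.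
have N2 (h : T -> R) : (forall x, 0 <= h x)%R ->
    'N[mu]_2%:E[EFin \o h] * 'N[mu]_2%:E[EFin \o h] = \int[mu]_x (h x ^+ 2)%:E.
  move=> h0; have := poweR_Lnorm mu (EFin \o h) (r := 2) _.
  have -> : 'N[mu]_2%:E[EFin \o h] `^ 2 = 'N[mu]_2%:E[EFin \o h] * 'N[mu]_2%:E[EFin \o h].
    rewrite (_ : 2 = 1 + 1)%R// poweRD; last by apply: add_neq0_poweRD_def; rewrite -(natrD _ 1 1) pnatr_eq0.
    by rewrite !poweRe1// Lnorm_ge0.
  move=> ->//; apply: eq_integral => x _ /=.
  by rewrite ger0_norm// powR_mulrn.
move=> H; rewrite -(N2 f)// -(N2 g)//.
set a := 'N[mu]_2%:E[EFin \o f] in H *; set b := 'N[mu]_2%:E[EFin \o g] in H *.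
have -> : a * a * (b * b) = (a * b) * (a * b) by rewrite muleACA.
by apply: lee_pmul.
Qed.

End cauchy_schwarz.

Section bilinear.
Context {R : realType}.
Notation RR := (measurableTypeR R).
Local Notation leb := (@lebesgue_measure R).

Lemma plane_tonelli (f : RR * RR -> \bar R) :
  measurable_fun [set: (RR * RR)%type] f -> (forall z, 0 <= f z)%E ->
  (\int[plane]_z f z = \int[leb]_x \int[leb]_y f (x, y))%E.
Proof. exact: fubini_tonelli1. Qed.

Lemma plane_affine (k a1 a2 : R) (f : RR * RR -> \bar R) : k != 0 ->
  measurable_fun [set: (RR * RR)%type] f -> (forall z, 0 <= f z)%E ->
  (\int[plane]_z f (k * z.1 + a1, k * z.2 + a2)%R =
   (`|k|^-1 ^+ 2)%:E * \int[plane]_z f z)%E.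
Proof.
move=> k0 mf_ f0.
rewrite plane_tonelli//=; last first.
  apply: (mfcomp mf_); apply: measurable_fun_pair; mf.
have msec x : measurable_fun [set: RR] (fun y : RR => f (x, y)).
  exact: measurable_fun_pair2.
under eq_integral => x _.
  rewrite (ge0_integral_affine a2 (f := fun y => f (k * x + a1, y)) k0)//.
  over.
have mF : measurable_fun [set: RR] (fun x : RR => \int[leb]_y f (x, y))%E.
  exact: (measurable_fun_fubini_tonelli_F (m2 := leb)).
have F0 x : (0 <= \int[leb]_y f (x, y))%E by apply: integral_ge0.
rewrite ge0_integralZl//; last by apply: (mfcomp mF); mf.
rewrite (ge0_integral_affine a1 (f := fun x => (\int[leb]_y f (x, y))%E) k0)//.
by rewrite muleA -EFinM -expr2 [in RHS]plane_tonelli.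
Qed.

Definition Xwinv (b : R) (z : RR * RR) : R := jap 2 z.1 * jap (2 * b) (z.2 + z.1 ^+ 2).
(** The exponent [2 * 1] is kept so that this is literally the weight inside [X_norm b 1]; [Xwinv b]
    is its reciprocal. *)
Definition Xw (b : R) (z : RR * RR) : R :=
  (1 + `|z.1|) `^ (2 * 1) * (1 + `|z.2 + z.1 ^+ 2|) `^ (2 * b).

Lemma Xw_gt0 b z : 0 < Xw b z.
Proof. by rewrite mulr_gt0// powR_gt0// onenorm_gt0. Qed.

Lemma XwV b z : Xw b z * Xwinv b z = 1.
Proof.
rewrite /Xw /Xwinv /jap !mulr1 !powRN mulrACA.
by rewrite !mulfV ?mulr1// gt_eqF// powR_gt0// onenorm_gt0.
Qed.

Lemma Xwinv_ge0 b z : 0 <= Xwinv b z.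
Proof. by rewrite mulr_ge0// jap_ge0. Qed.

Lemma measurable_Xw b : measurable_fun [set: (RR * RR)%type] (Xw b).
Proof. by rewrite /Xw; mf. Qed.

Lemma measurable_Xwinv b : measurable_fun [set: (RR * RR)%type] (Xwinv b).
Proof. by rewrite /Xwinv; mf. Qed.

(** The weight of the first target norm, with the multiplier xi^2 of the derivative enlarged to 1 +
    xi^2 so that it dominates the second norm as well. *)
Definition Yfac (a : R) (z : RR * RR) : R :=
  (1 + z.1 ^+ 2) * ((1 + `|z.1|) ^+ 2 * jap (2 * a) (z.2 - z.1 ^+ 3)).

Lemma Yfac_ge0 a z : 0 <= Yfac a z.
Proof.
by rewrite !mulr_ge0 ?jap_ge0 ?exprn_ge0// ?addr_ge0 ?sqr_ge0.
Qed.

(** For w = (x, y) the two time weights have arguments y + x^2 and y - tau + (x - xi)^2. Their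
    difference D does not depend on y, so the y-integral is a convolution of weights. [jap2_split]
    then leaves one integral centred at x = 0 and one centred at x = xi, and these are the two signs
    of the resonance integral. *)
Lemma multiplier_bound (a b : R) : 1 / 4 <= a -> 5 / 12 < b -> exists C : R, 0 <= C /\
  forall z : RR * RR,
  (\int[plane]_w (Yfac a z * (Xwinv b w * Xwinv b (w.1 - z.1, w.2 - z.2)%R))%:E <= C%:E)%E.
Proof.
move=> a4 b512; have [C [C0 HC]] := integral_jap_resonance a4.
pose I := Ijap (2 * (2 * b) - 2 / 3).
have I0 : 0 <= I by exact: Ijap_ge0.
(* The 16 is 4 from [jap2_split] times 4 from 2 (I + I) in [integral_jap_conv]. *)
exists (16 * I * (C + C)); split; first by rewrite !(mulr_ge0, addr_ge0).
move=> [xi tau]; rewrite plane_tonelli; last 2 first.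
- by rewrite /Xwinv /=; mf.
- by move=> w; rewrite lee_fin; apply: mulr_ge0; [exact: Yfac_ge0|apply: mulr_ge0; exact: Xwinv_ge0].
pose K := (1 + xi ^+ 2) * jap (2 * a) (tau - xi ^+ 3).
have K0 : 0 <= K by rewrite mulr_ge0 ?jap_ge0// addr_ge0 ?sqr_ge0.
pose h sg (x : R) := K * (jap 2 x * jap (2 / 3) (tau + sg * xi ^+ 2 + 2 * xi * x)).
have jj p q (x y : R) : 0 <= jap p x * jap q y by rewrite mulr_ge0 ?jap_ge0.
have h0 sg x : 0 <= h sg x by apply: mulr_ge0.
have xi1 : 0 <= (1 + `|xi|) ^+ 2 by rewrite exprn_ge0// ltW// onenorm_gt0.
have mh sg : measurable_fun [set: RR] (h sg) by rewrite /h; mf.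
have step (x : R) : (\int[leb]_y (Yfac a (xi, tau) *
     (Xwinv b (x, y) * Xwinv b (x - xi, y - tau)%R))%:E <=
   (16 * I * (h (-1) x + h 1 (1 * x - xi)))%:E)%E.
  pose D := tau - xi ^+ 2 + 2 * xi * x.
  pose f (s : R) := ((1 + xi ^+ 2) * jap (2 * a) (tau - xi ^+ 3) * ((1 + `|xi|) ^+ 2 * (jap 2 x * jap 2 (x - xi)))) *
    (jap (2 * b) s * jap (2 * b) (s - D)).
  have f0 s : 0 <= f s.
    by apply: mulr_ge0 => //; apply: mulr_ge0 => //; apply: mulr_ge0.
  have -> : (\int[leb]_y (Yfac a (xi, tau) *
     (Xwinv b (x, y) * Xwinv b (x - xi, y - tau)%R))%:E =
     \int[leb]_y (f (1 * y + x ^+ 2))%:E)%E.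
    apply: eq_integral => y _; congr EFin; rewrite /Yfac /Xwinv /f /= mul1r.
    have -> : y + x ^+ 2 - D = y - tau + (x - xi) ^+ 2 by rewrite /D; ring.
    by ring.
  rewrite (ge0_integral_affine (x ^+ 2) (f := EFin \o f))//; last first.
    by rewrite /f; apply: mfE; mf.
  rewrite normr1 invr1 mul1e.
  under eq_integral do rewrite /= /f EFinM.
  rewrite ge0_integralZl//; last 3 first.
  - by mf.
  - by move=> s _; rewrite lee_fin mulr_ge0 ?jap_ge0.
  - by rewrite lee_fin; apply: mulr_ge0 => //; apply: mulr_ge0.
  have b0 : 2 / 3 <= 2 * b by lra.
  have b1 : 1 < 2 * (2 * b) - 2 / 3 by lra.
  have r0 : 0 <= 2 / 3 :> R by lra.
  have r1 : 2 / 3 <= 1 :> R by lra.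
  have := integral_jap_conv D r0 r1 b0 b1; rewrite -/I => HI.
  have k0 : 0 <= K * ((1 + `|xi|) ^+ 2 * (jap 2 x * jap 2 (x - xi))).
    by apply: mulr_ge0 => //; apply: mulr_ge0.
  apply: (@le_trans _ _ ((K * ((1 + `|xi|) ^+ 2 * (jap 2 x * jap 2 (x - xi))))%:E *
     (2 * jap (2 / 3) D * (I + I))%:E)%E).
    by apply: lee_wpmul2l => //; rewrite lee_fin.
  rewrite -EFinM lee_fin.
  have S : (1 + `|xi|) ^+ 2 * (jap 2 x * jap 2 (x - xi)) <= 4 * (jap 2 x + jap 2 (x - xi)).
    apply: jap2_split; rewrite -[in leLHS](subKr x xi); exact: ler_normB.
  apply: le_trans (_ : K * (4 * (jap 2 x + jap 2 (x - xi))) * (2 * jap (2 / 3) D * (I + I)) <= _).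
    apply: ler_wpM2r; last by apply: ler_wpM2l.
    by rewrite mulr_ge0 ?addr_ge0// mulr_ge0 ?jap_ge0.
  rewrite /h mul1r.
  have -> : tau + -1 * xi ^+ 2 + 2 * xi * x = D by rewrite /D; ring.
  (* Recentring at x = xi turns - xi^2 into + xi^2 in the same D. *)
  have -> : tau + 1 * xi ^+ 2 + 2 * xi * (x - xi) = D by rewrite /D; ring.
  by rewrite le_eqVlt; apply/orP; left; apply/eqP; ring.
apply: (@le_trans _ _ (\int[leb]_x (16 * I * (h (-1) x + h 1 (1 * x - xi)))%:E)%E).
  apply: le_integralT => x //; apply: integral_ge0 => y _.
  by rewrite lee_fin; apply: mulr_ge0; [exact: Yfac_ge0|apply: mulr_ge0; exact: Xwinv_ge0].
have hC sg : sg \in [:: 1; -1] -> integral_le leb (h sg) C.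
  by move=> sgE; split => //; exact: HC.
apply: (@le_integral_le _ RR R leb _ (fun x => 16 * I * (h (-1) x + h 1 (1 * x - xi)))) => //.
  by move=> x; apply: mulr_ge0; [exact: mulr_ge0|exact: addr_ge0].
apply: integral_leZ; first by rewrite mulr_ge0.
apply: integral_leD; first by apply: hC; rewrite !inE eqxx orbT.
have [H1 H2 H3] := hC 1 (mem_head _ _); split; [by move=> x; exact: H1|by mf|].
rewrite (ge0_integral_affine (- xi) (f := EFin \o h 1))//; last by apply: mfE.
by rewrite normr1 invr1 mul1e.
Qed.

(** After Cauchy-Schwarz the factor carrying u and v is a correlation of two nonnegative weighted
    squares; its integral over z is exactly the product of their integrals. *)
Lemma bilinear_bound (a b : R) : 1 / 4 <= a -> 5 / 12 < b -> exists C : R, 0 <= C /\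
  forall u v : RR * RR -> R, (forall z, 0 <= u z) -> (forall z, 0 <= v z) ->
  measurable_fun [set: (RR * RR)%type] u -> measurable_fun [set: (RR * RR)%type] v ->
  (\int[plane]_z ((Yfac a z)%:E *
      ((\int[plane]_w (u w * v (w.1 - z.1, w.2 - z.2)%R)%:E) *
       (\int[plane]_w (u w * v (w.1 - z.1, w.2 - z.2)%R)%:E))) <=
   C%:E * ((\int[plane]_w (Xw b w * u w ^+ 2)%:E) *
           (\int[plane]_w (Xw b w * v w ^+ 2)%:E)))%E.
Proof.
move=> a4 b512; have [C [C0 HC]] := multiplier_bound a4 b512.
exists C; split => // u v u0 v0 mu_ mv.
have mXw := measurable_Xw b; have mXi := measurable_Xwinv b.
pose A (z : RR * RR) := (\int[plane]_w ((Xw b w * u w ^+ 2) *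
  (Xw b (w.1 - z.1, w.2 - z.2)%R * v (w.1 - z.1, w.2 - z.2)%R ^+ 2))%:E)%E.
have A_ge0 z : (0 <= A z)%E.
  apply: integral_ge0 => w _; rewrite lee_fin.
  by rewrite !mulr_ge0 ?sqr_ge0// ltW// Xw_gt0.
pose Fuv (p : (RR * RR) * (RR * RR)) := ((Xw b p.2 * u p.2 ^+ 2) *
  (Xw b (p.2.1 - p.1.1, p.2.2 - p.1.2)%R * v (p.2.1 - p.1.1, p.2.2 - p.1.2)%R ^+ 2))%:E.
have mFuv : measurable_fun [set: ((RR * RR) * (RR * RR))%type] Fuv by rewrite /Fuv; mf.
have Fuv0 p : (0 <= Fuv p)%E.
  rewrite lee_fin.
  by rewrite !mulr_ge0 ?sqr_ge0// ltW// Xw_gt0.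
have mA : measurable_fun [set: (RR * RR)%type] A.
  exact: (measurable_fun_fubini_tonelli_F (m2 := plane) Fuv).
apply: (@le_trans _ _ (\int[plane]_z (C%:E * A z))%E).
  apply: le_integralT => z.
    apply: mule_ge0; first by rewrite lee_fin Yfac_ge0.
    by apply: mule_ge0; apply: integral_ge0 => w _; rewrite lee_fin mulr_ge0.
  (* The weights and their reciprocals are inserted under square roots, so that f^2 carries the
     weighted squares and g^2 the kernel of [multiplier_bound]. *)
  pose f (w : RR * RR) := u w * v (w.1 - z.1, w.2 - z.2)%R *
    Num.sqrt (Xw b w * Xw b (w.1 - z.1, w.2 - z.2)%R).
  pose g (w : RR * RR) := Num.sqrt (Xwinv b w * Xwinv b (w.1 - z.1, w.2 - z.2)%R).
  have fg w : u w * v (w.1 - z.1, w.2 - z.2)%R = f w * g w.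
    rewrite /f /g -mulrA -sqrtrM ?mulr_ge0 ?(ltW (Xw_gt0 _ _))// mulrACA.
    by rewrite !XwV mulr1 sqrtr1 mulr1.
  have f0 w : 0 <= f w by rewrite !mulr_ge0.
  have g0 w : 0 <= g w by exact: sqrtr_ge0.
  have msq (h : RR * RR -> R) : measurable_fun [set: (RR * RR)%type] h ->
     measurable_fun [set: (RR * RR)%type] (fun w => Num.sqrt (h w)).
    move=> mh; apply: mfcont => //; exact: sqrt_continuous.
  have mf_ : measurable_fun [set: (RR * RR)%type] f.
    by rewrite /f; apply: mfM; first mf; apply: msq; mf.
  have mg : measurable_fun [set: (RR * RR)%type] g by rewrite /g; apply: msq; mf.
  under [X in (_ * (X * _))%E]eq_integral do rewrite fg.
  under [X in (_ * (_ * X))%E]eq_integral do rewrite fg.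
  have CS := ge0_cauchy_schwarz plane f0 g0 mf_ mg.
  have f2 : (\int[plane]_w (f w ^+ 2)%:E = A z)%E.
    apply: eq_integral => w _; congr EFin; rewrite /f exprMn sqr_sqrtr.
      by ring.
    by rewrite mulr_ge0// ltW// Xw_gt0.
  have g2 : ((Yfac a z)%:E * \int[plane]_w (g w ^+ 2)%:E <= C%:E)%E.
    rewrite -ge0_integralZl//; last 3 first.
    - by mf.
    - by move=> w _; rewrite lee_fin sqr_ge0.
    - by rewrite lee_fin Yfac_ge0.
    apply: le_trans (HC z); rewrite le_eqVlt; apply/orP; left; apply/eqP.
    apply: eq_integral => w _; rewrite -EFinM /g sqr_sqrtr//.
    by rewrite mulr_ge0 ?Xwinv_ge0.
  apply: (@le_trans _ _ ((Yfac a z)%:E *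
     ((\int[plane]_w (f w ^+ 2)%:E) * \int[plane]_w (g w ^+ 2)%:E))%E).
    by apply: lee_wpmul2l => //; rewrite lee_fin Yfac_ge0.
  rewrite f2 muleCA [leRHS]muleC; exact: lee_wpmul2l.
rewrite ge0_integralZl//; apply: lee_wpmul2l => //.
have -> : (\int[plane]_z A z = \int[plane]_w \int[plane]_z Fuv (z, w))%E.
  exact: (fubini_tonelli (m1 := plane) (m2 := plane) Fuv).
pose V := (\int[plane]_w (Xw b w * v w ^+ 2)%:E)%E.
have inner w : (\int[plane]_z Fuv (z, w) = (Xw b w * u w ^+ 2)%:E * V)%E.
  rewrite /Fuv /=; under eq_integral do rewrite EFinM.
  have xu : (0 <= (Xw b w * u w ^+ 2)%:E)%E.
    by rewrite lee_fin mulr_ge0 ?sqr_ge0// ltW// Xw_gt0.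
  rewrite ge0_integralZl//; last 2 first.
  - by mf.
  - by move=> z _; rewrite lee_fin mulr_ge0 ?sqr_ge0// ltW// Xw_gt0.
  congr (_ * _)%E.
  (* For fixed w the map z -> w - z is affine of slope -1 and preserves the plane measure. *)
  have N1 : -1 != 0 :> R by rewrite oppr_eq0 oner_eq0.
  have PA := @plane_affine (-1) w.1 w.2 (fun z => (Xw b z * v z ^+ 2)%:E) N1.
  rewrite normrN normr1 invr1 expr1n mul1e in PA.
  rewrite -/V in PA; rewrite -PA.
  - by apply: eq_integral => z _ /=; rewrite !mulN1r ![- _ + _]addrC.
  - by mf.
  - by move=> z; rewrite lee_fin mulr_ge0 ?sqr_ge0// ltW// Xw_gt0.
under eq_integral do rewrite inner.
have V0 : (0 <= V)%E.
  by apply: integral_ge0 => w _; rewrite lee_fin mulr_ge0 ?sqr_ge0// ltW// Xw_gt0.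
rewrite ge0_integralZr//; first by mf.
by move=> w _; rewrite lee_fin mulr_ge0 ?sqr_ge0// ltW// Xw_gt0.
Qed.

End bilinear.

Section ge0_real_integral.
Context d (T : measurableType d) {R : realType} (mu : {measure set T -> \bar R}).
Implicit Types f g : T -> R.

Lemma ge0_integralZE (k : R) f : 0 <= k -> (forall x, 0 <= f x) ->
  measurable_fun [set: T] f ->
  (\int[mu]_x (k * f x)%:E = k%:E * \int[mu]_x (f x)%:E)%E.
Proof.
move=> k0 f0 mf_; under eq_integral do rewrite EFinM.
rewrite ge0_integralZl//; first exact: mfE.
by move=> x _; rewrite lee_fin.
Qed.

Lemma ge0_integralDE f g : (forall x, 0 <= f x) -> (forall x, 0 <= g x) ->
  measurable_fun [set: T] f -> measurable_fun [set: T] g ->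
  (\int[mu]_x (f x + g x)%:E = \int[mu]_x (f x)%:E + \int[mu]_x (g x)%:E)%E.
Proof.
move=> f0 g0 mf_ mg; under eq_integral do rewrite EFinD.
rewrite ge0_integralD//.
- by move=> x _; rewrite lee_fin.
- exact: mfE.
- by move=> x _; rewrite lee_fin.
- exact: mfE.
Qed.

End ge0_real_integral.

(** * Continuity of translations in mean square *)

Section vanish.
Context {R : realType}.
Local Open Scope ereal_scope.
Implicit Types u v : nat -> \bar R.

(** Convergence to 0 of nonnegative extended sequences, phrased by upper bounds only: it passes to
    smaller sequences, and early terms may be infinite. *)
Definition vanish u := forall e : R, (0 < e)%R -> \forall n \near \oo, u n <= e%:E.

Lemma le_vanish u v : (forall n, u n <= v n) -> vanish v -> vanish u.
Proof. by move=> uv v0 e e0; near do apply: (le_trans (uv _)); exact: v0. Unshelve. all: by end_near. Qed.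

Lemma vanishD u v : vanish u -> vanish v -> vanish (fun n => u n + v n).
Proof.
move=> u0 v0 e e0; near=> n.
rewrite (splitr e) EFinD leeD//; near: n; [apply: u0|apply: v0]; exact: divr_gt0.
Unshelve. all: by end_near. Qed.

Lemma vanishZ (k : R) u : (0 <= k)%R -> vanish u -> vanish (fun n => k%:E * u n).
Proof.
move=> k0 u0 e e0; have k1 : (0 < k + 1)%R by rewrite ltr_wpDl.
near=> n.
apply: (@le_trans _ _ (k%:E * (e / (k + 1))%:E)).
  apply: lee_wpmul2l; first by rewrite lee_fin.
  by near: n; apply: u0; exact: divr_gt0.
rewrite -EFinM lee_fin mulrA ler_pdivrMr// [leRHS]mulrC.
by apply: ler_wpM2r; [exact: ltW|rewrite lerDl].
Unshelve. all: by end_near. Qed.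

(** The form in which density arguments are used: [v] comes from an approximant, [e] from the
    approximation error. *)
Lemma vanish_approx u : (forall e : R, (0 < e)%R -> exists2 v, vanish v &
  forall n, u n <= v n + e%:E) -> vanish u.
Proof.
move=> H e e0; have [v v0 uv] := H (e / 2)%R (divr_gt0 e0 (ltr0n _ 2)).
near=> n; apply: (le_trans (uv n)).
rewrite [in leRHS](splitr e) EFinD leeD2r//; near: n; apply: v0; exact: divr_gt0.
Unshelve. all: by end_near. Qed.

Lemma vanish_cvg u : (forall n, 0 <= u n) -> vanish u -> u n @[n --> \oo] --> 0.
Proof.
move=> u0 uv; have fu : \forall n \near \oo, u n \is a fin_num.
  near=> n; rewrite ge0_fin_numE//; apply: (@le_lt_trans _ _ 1%:E); last exact: ltry.
  by near: n; exact: uv.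
apply/fine_cvgP; split => //; apply/cvgrPdist_le => e e0; near=> n.
rewrite sub0r normrN ger0_norm ?fine_ge0//=.
rewrite -lee_fin fineK; last by near: n.
by near: n; exact: uv.
Unshelve. all: by end_near. Qed.

Lemma cvg_vanish u : (forall n, 0 <= u n) -> u n @[n --> \oo] --> 0 -> vanish u.
Proof.
move=> u0 /fine_cvgP[fu /cvgrPdist_le cu] e e0; near=> n.
have : (`|0 - fine (u n)| <= e)%R by near: n; exact: cu.
rewrite sub0r normrN ger0_norm ?fine_ge0// -lee_fin fineK//.
by near: n.
Unshelve. all: by end_near. Qed.

(** Dominated convergence. The pointwise condition is asked only where the majorant is finite, which
    is almost everywhere; this disposes of lines on which a function of the plane is not square
    integrable. *)
Lemma vanish_integral d (T : measurableType d) (mu : {measure set T -> \bar R})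
    (f : nat -> T -> \bar R) (g : T -> \bar R) :
  (forall n, measurable_fun [set: T] (f n)) -> measurable_fun [set: T] g ->
  (forall n x, 0 <= f n x) -> (forall n x, f n x <= g x) ->
  \int[mu]_x g x < +oo -> (forall x, g x < +oo -> vanish (f ^~ x)) ->
  vanish (fun n => \int[mu]_x f n x).
Proof.
move=> mf_ mg f0 fg ig fv.
have g0 x : 0 <= g x by exact: le_trans (f0 0%N x) (fg _ _).
have ig' : mu.-integrable [set: T] g.
  apply/integrableP; split => //.
  by under eq_integral do rewrite gee0_abs//.
have [] := @dominated_convergence _ _ _ mu setT measurableT f (cst 0) g mf_
  (measurable_cst _) _ ig' _.
- have := integrable_ae measurableT ig'; apply: filterS => x gx _.
  apply: vanish_cvg => //; apply: fv.
  by rewrite -ge0_fin_numE//; exact: gx.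
- by apply: nearW => x n _; rewrite gee0_abs.
move=> _ _; rewrite integral0 => H.
apply: cvg_vanish => // n; exact: integral_ge0.
Qed.

End vanish.

Section translation1.
Context {R : realType}.
Notation RR := (measurableTypeR R).
Local Notation leb := (@lebesgue_measure R).

Lemma cvg_shift (c x : R) : (x + c * harmonic n)%R @[n --> \oo] --> x.
Proof.
rewrite -[X in _ --> X]addr0; apply: cvgD; first exact: cvg_cst.
by rewrite -(mulr0 c); apply: cvgMr; exact: cvg_harmonic.
Qed.

Lemma harmonic_le1 n : harmonic n <= 1 :> R.
Proof. by rewrite /harmonic invf_le1 ?ltr0n// ler1n. Qed.

(** As [harmonic n] is at most 1, all the differences live on one interval, enlarged by |c|, where 2
    M dominates them. *)
Lemma vanish_shift_cont (g : R -> R) (M N c : R) : continuous g ->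
  (forall x, `|g x| <= M) -> (forall x, N < `|x| -> g x = 0) ->
  vanish (fun n => \int[leb]_x (`|g (x + c * harmonic n) - g x|)%:E)%E.
Proof.
move=> cg gM gN.
have M0 : 0 <= M by exact: le_trans (gM 0).
pose E : set RR := `[- (N + `|c|), N + `|c|]%classic.
have mE : measurable E by exact: measurable_itv.
have Efin : (leb E < +oo)%E.
  rewrite lebesgue_measure_itv/= lte_fin.
  by case: ifP => _; rewrite -?EFinB ltry.
have mg : measurable_fun [set: RR] g by exact: continuous_measurable_fun.
apply: (@vanish_integral _ _ _ _ _ (fun x => (2 * M * \1_E x)%:E)).
- by move=> n; mf.
- apply: mfE; apply: mfM; first by mf.
  exact: measurable_indic.
- by move=> n x; rewrite lee_fin.
- move=> n x; rewrite lee_fin indicE.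
  have [xE|xE] := boolP (x \in E).
    rewrite mulr1; apply: le_trans (ler_normB _ _) _.
    by rewrite (_ : 2 * M = M + M); [exact: lerD|ring].
  have xN : N + `|c| < `|x|.
    rewrite ltNge; apply: contra xE => xE.
    by rewrite inE /E /= in_itv/= -ler_norml.
  have cn : `|c * harmonic n| <= `|c|.
    by rewrite normrM ler_piMr// ger0_norm ?harmonic_le1// /harmonic invr_ge0.
  have c0 := normr_ge0 c.
  rewrite gN; last first.
    have := ler_normB (x + c * harmonic n) (c * harmonic n).
    rewrite addrK; lra.
  by rewrite gN; [rewrite subrr normr0 !mulr0|lra].
- rewrite ge0_integralZE ?mulr_ge0//.
  apply: lte_mul_pinfty; rewrite ?lee_fin ?mulr_ge0//.
  by rewrite integral_indic// setIT; exact: Efin.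
- move=> x _; apply: cvg_vanish => //.
  apply: cvg_EFin; first exact: nearW.
  have H : g (x + c * harmonic n) @[n --> \oo] --> g x.
    apply: (@cvg_comp _ _ _ (fun n => x + c * harmonic n) g _ _ _ (@cvg_shift c x)).
    exact: cg.
  have : `|g (x + c * harmonic n) - g x| @[n --> \oo] --> `|g x - g x|.
    by apply: cvg_norm; apply: cvgB => //; exact: cvg_cst.
  by rewrite subrr normr0.
Qed.

(** Boundedness reduces the mean square to an L^1 statement, since the squared difference is at most
    2 M times the difference; in L^1 a compactly supported continuous function is close to f. *)
Lemma vanish_shift_bounded (f : R -> R) (M N c : R) : measurable_fun [set: RR] f ->
  0 < N -> 0 < M -> (forall x, `|f x| <= M) -> (forall x, N < `|x| -> f x = 0) ->
  vanish (fun n => \int[leb]_x ((f (x + c * harmonic n) - f x) ^+ 2)%:E)%E.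
Proof.
move=> mf_ N0 M0 fM fN.
apply: vanish_approx => e e0.
pose E : set RR := `[- (N + 1), N + 1]%classic.
have mE : measurable E by exact: measurable_itv.
have Efin : (leb E < +oo)%E.
  rewrite lebesgue_measure_itv/= lte_fin.
  by case: ifP => _; rewrite -?EFinB ltry.
have intf : leb.-integrable E (EFin \o f).
  apply: measurable_bounded_integrable => //; first exact: measurable_funTS.
  by exists M; split; [exact: num_real|move=> x Mx y _; exact: le_trans (fM y) (ltW Mx)].
have [g_ [cg_ intg_ g_f]] := approximation_continuous_integrable mE Efin intf.
(* The approximation error enters twice, shifted and unshifted, each time with the factor 2 M. *)
pose d := e / (4 * M).
have d0 : 0 < d by rewrite divr_gt0// mulr_gt0.
have [n gn] : exists n, (\int[leb]_(z in E) `|(f z - g_ n z)%:E| <= d%:E)%E.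
  have [m _ Hm] := cvg_vanish (fun=> integral_ge0 _ (fun _ _ => abse_ge0 _)) g_f d0.
  by exists m; apply: Hm => /=.
have {g_f intg_} cg := cg_ n; move: (g_ n) cg gn => g cg gn {g_ cg_}.
(* The approximant is controlled only on [E]. This cut-off is 1 on the support of f and 0 off [E],
   so multiplying by it does not worsen the approximation. *)
pose chi (x : R) := Num.max 0 (Num.min 1 (N + 1 - `|x|)).
have cchi : continuous chi.
  move=> x.
  have c1 : {for x, continuous (fun x : R => N + 1 - `|x| : R^o)}.
    by apply: continuousB; [exact: cst_continuous|exact: norm_continuous].
  have cc (k : R) : {for x, continuous (fun=> k : R^o)} by exact: cst_continuous.
  exact: (continuous_max (cc 0) (continuous_min (cc 1) c1)).
have chi01 x : 0 <= chi x <= 1.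
  by rewrite /chi le_max lexx/= ge_max ler01 ge_min lexx.
have chi1 x : `|x| <= N -> chi x = 1.
  move=> xN; rewrite /chi min_l; last by lra.
  by rewrite max_r.
have chi0 x : N + 1 <= `|x| -> chi x = 0.
  by move=> xN; rewrite /chi max_l// ge_min; apply/orP; right; lra.
pose h x := g x * chi x.
have ch : continuous h by move=> x; apply: continuousM; [exact: cg|exact: cchi].
have h0 x : N + 1 < `|x| -> h x = 0 by move=> xN; rewrite /h chi0 ?mulr0// ltW.
have [K hK] : exists K, forall x, `|h x| <= K.
  have ab : - (N + 1) <= N + 1 by lra.
  have cw : {within `[- (N + 1), N + 1], continuous (fun x : R => `|h x| : R)}.
    apply: continuous_subspaceT => x.
    apply: (@cvg_comp _ _ _ h (fun y : R => `|y|) _ _ _ (ch x)).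
    exact: norm_continuous.
  have [k _ kmax] := EVT_max ab cw.
  exists `|h k| => x; have [xN|xN] := leP `|x| (N + 1).
    by apply: kmax; rewrite in_itv/= -ler_norml.
  by rewrite h0// normr0.
have mh : measurable_fun [set: RR] h by exact: continuous_measurable_fun.
have mg : measurable_fun [set: RR] g by exact: continuous_measurable_fun.
have fh : (\int[leb]_x `|f x - h x|%:E <= d%:E)%E.
  apply: le_trans gn; rewrite [leRHS]integral_mkcond.
  apply: le_integralT => x; first by rewrite lee_fin.
  rewrite patchE; have [xE|xE] := boolP (x \in E); last first.
    have xN : N + 1 < `|x|.
      rewrite ltNge; apply: contra xE => xE.
      by rewrite inE /E /= in_itv/= -ler_norml.
    by rewrite h0// fN ?subrr ?normr0//; lra.
  rewrite lee_fin; have [xN|xN] := leP `|x| N; first by rewrite /h chi1// mulr1.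
  rewrite fN// !sub0r !normrN /h normrM ler_piMr//.
  by have /andP[c0 c1] := chi01 x; rewrite ger0_norm.
exists (fun n => (2 * M)%:E * \int[leb]_x (`|h (x + c * harmonic n) - h x|)%:E)%E.
  apply: vanishZ; first by rewrite mulr_ge0// ltW.
  exact: (vanish_shift_cont c ch hK h0).
move=> m; set s := c * harmonic m.
have shiftE (F : R -> \bar R) : measurable_fun [set: RR] F -> (forall x, 0 <= F x)%E ->
    (\int[leb]_x F (x + s)%R = \int[leb]_x F x)%E.
  move=> mF F0; have := ge0_integral_affine s (oner_neq0 R) mF F0.
  rewrite normr1 invr1 mul1e => <-.
  by apply: eq_integral => x _; rewrite mul1r.
have mfh : measurable_fun [set: RR] (fun x => `|f x - h x|) by mf.
have M20 : 0 <= 2 * M by rewrite mulr_ge0// ltW.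
apply: (@le_trans _ _ (\int[leb]_x ((2 * M) * (`|f (x + s) - h (x + s)| +
   (`|h (x + s) - h x| + `|f x - h x|)))%:E)%E).
  apply: le_integralT => x; first by rewrite lee_fin sqr_ge0.
  rewrite lee_fin -[leLHS]ger0_norm ?sqr_ge0// expr2 normrM.
  apply: ler_pM => //.
    apply: le_trans (ler_normB _ _) _.
    by rewrite (_ : 2 * M = M + M); [exact: lerD|ring].
  have -> : f (x + s) - f x = (f (x + s) - h (x + s)) + ((h (x + s) - h x) - (f x - h x)) by ring.
  apply: le_trans (ler_normD _ _) _; rewrite lerD2l; exact: ler_normB.
rewrite ge0_integralZE; [|by []|by move=> x; rewrite !addr_ge0|by mf].
rewrite ge0_integralDE; [|by []|by move=> x; rewrite addr_ge0|by mf|by mf].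
rewrite ge0_integralDE; [|by []|by []|by mf|by mf].
rewrite (shiftE (fun x => `|f x - h x|%:E))//; last exact: mfE.
set I := (\int[leb]_x `|h (x + s) - h x|%:E)%E.
apply: (@le_trans _ _ ((2 * M)%:E * (d%:E + (I + d%:E)))%E).
  apply: lee_wpmul2l; first by rewrite lee_fin.
  by rewrite leeD// leeD2l.
have I0 : (0 <= I)%E by apply: integral_ge0 => x _; rewrite lee_fin.
have dE : (0 <= d%:E)%E by rewrite lee_fin ltW.
rewrite ge0_muleDr//; last exact: adde_ge0.
rewrite ge0_muleDr//.
rewrite addeCA leeD2l// -!EFinM -EFinD lee_fin /d.
by rewrite le_eqVlt; apply/orP; left; apply/eqP; field; rewrite gt_eqF.
Qed.

End translation1.

Section translation2.
Context {R : realType}.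
Notation RR := (measurableTypeR R).
Local Notation leb := (@lebesgue_measure R).

Lemma integral_shift (s : R) (F : R -> \bar R) :
  measurable_fun [set: RR] F -> (forall x, 0 <= F x)%E ->
  (\int[leb]_x F (x + s)%R = \int[leb]_x F x)%E.
Proof.
move=> mF F0; have := ge0_integral_affine s (oner_neq0 R) mF F0.
rewrite normr1 invr1 mul1e => <-.
by apply: eq_integral => x _; rewrite mul1r.
Qed.

Lemma plane_shift (s1 s2 : R) (F : RR * RR -> \bar R) :
  measurable_fun [set: (RR * RR)%type] F -> (forall x, 0 <= F x)%E ->
  (\int[plane]_z F (z.1 + s1, z.2 + s2)%R = \int[plane]_z F z)%E.
Proof.
move=> mF F0; have := plane_affine s1 s2 (oner_neq0 R) mF F0.
rewrite normr1 invr1 expr1n mul1e => <-.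
by apply: eq_integral => x _; rewrite !mul1r.
Qed.

Lemma plane_swap (F : RR * RR -> \bar R) :
  measurable_fun [set: (RR * RR)%type] F -> (forall x, 0 <= F x)%E ->
  (\int[plane]_z F (z.2, z.1) = \int[plane]_z F z)%E.
Proof.
move=> mF F0; rewrite plane_tonelli//=; last first.
  by apply: (mfcomp mF); apply: measurable_fun_pair; mf.
rewrite [RHS]plane_tonelli//; symmetry.
exact: (fubini_tonelli (m1 := leb) (m2 := leb) F).
Qed.

Lemma sqr_sum3 (x y z : R) : (x + y + z) ^+ 2 <= 3 * (x ^+ 2 + y ^+ 2 + z ^+ 2).
Proof.
have := sqr_ge0 (x - y); have := sqr_ge0 (x - z); have := sqr_ge0 (y - z).
rewrite !expr2; lra.
Qed.

Lemma sqr_sum2 (x y : R) : (x + y) ^+ 2 <= 2 * (x ^+ 2 + y ^+ 2).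
Proof. have := sqr_ge0 (x - y); rewrite !expr2; lra. Qed.

Definition truncate (f : R -> R) (N x : R) : R :=
  f x * \1_([set y : RR | `|y| <= N] `&` [set y | `|f y| <= N]) x.

Lemma measurable_truncate (f : R -> R) (N : R) : measurable_fun [set: RR] f ->
  measurable_fun [set: RR] (truncate f N).
Proof.
move=> mf_; apply: mfM => //; apply: measurable_indic; apply: measurableI.
  have -> : [set y : RR | `|y| <= N] = setT `&` (fun y : RR => `|y|) @^-1` `]-oo, N].
    by apply/seteqP; split => y /=; rewrite in_itv/=; [split|case].
  have mn : measurable_fun [set: RR] (fun y : RR => `|y|) by mf.
  by apply: mn => //; exact: measurable_itv.
have -> : [set y : RR | `|f y| <= N] = setT `&` (fun y : RR => `|f y|) @^-1` `]-oo, N].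
  by apply/seteqP; split => y /=; rewrite in_itv/=; [split|case].
have mn : measurable_fun [set: RR] (fun y : RR => `|f y|) by mf.
by apply: mn => //; exact: measurable_itv.
Qed.

Lemma vanish_truncate (f : R -> R) : measurable_fun [set: RR] f ->
  (\int[leb]_x (f x ^+ 2)%:E < +oo)%E ->
  vanish (fun n => \int[leb]_x ((f x - truncate f n%:R x) ^+ 2)%:E)%E.
Proof.
move=> mf_ f2; apply: (@vanish_integral _ _ RR leb (fun n (x : RR) => ((f x - truncate f n%:R x) ^+ 2)%:E) (fun x : RR => (f x ^+ 2)%:E)) => //.
- by move=> n; have := measurable_truncate n%:R mf_ => mt; mf.
- by mf.
- by move=> n x; rewrite lee_fin sqr_ge0.
- move=> n x; rewrite lee_fin /truncate indicE.
  by case: (_ \in _); rewrite ?mulr1 ?mulr0 ?subrr ?subr0// expr0n/= sqr_ge0.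
- move=> x _ e e0; near=> n.
  have -> : truncate f n%:R x = f x.
    rewrite /truncate indicE mem_set ?mulr1//; split => /=.
      by near: n; exact: nbhs_infty_ger.
    by near: n; exact: nbhs_infty_ger.
  by rewrite subrr expr0n/= lee_fin ltW.
Unshelve. all: by end_near. Qed.

Lemma vanish_shift1 (f : R -> R) (c : R) : measurable_fun [set: RR] f ->
  (\int[leb]_x (f x ^+ 2)%:E < +oo)%E ->
  vanish (fun n => \int[leb]_x ((f (x + c * harmonic n) - f x) ^+ 2)%:E)%E.
Proof.
move=> mf_ f2; apply: vanish_approx => e e0.
(* The truncation error occurs twice, each time with the factor 3 of [sqr_sum3]. *)
have e60 : 0 < e / 6 by rewrite divr_gt0.
have [k _ Hk] := vanish_truncate mf_ f2 e60.
(* The successor makes the truncation level positive, as [vanish_shift_bounded] requires. *)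
pose N := k.+1; have {Hk} HN : (\int[leb]_x ((f x - truncate f N%:R x) ^+ 2)%:E <= (e / 6)%:E)%E.
  by apply: Hk => /=; rewrite /N.
have mt := measurable_truncate N%:R mf_.
have [g gE] : exists g, g = truncate f N%:R by exists (truncate f N%:R).
rewrite -gE in mt HN; rename mt into mg.
have H := @vanish_shift_bounded R g N%:R N%:R c mg.
exists (fun n => 3%:E * \int[leb]_x ((g (x + c * harmonic n) - g x) ^+ 2)%:E)%E.
  apply: vanishZ => //; apply: H; rewrite ?ltr0n// gE => x.
    rewrite /truncate indicE; have [xA|xA] := boolP (x \in _).
      by move: xA; rewrite inE => -[_ /=]; rewrite mulr1.
    by rewrite mulr0 normr0.
  move=> xN; rewrite /truncate indicE memNset ?mulr0// => -[/= xN' _].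
  by move: xN; rewrite ltNge xN'.
move=> n; set s := c * harmonic n.
have md : measurable_fun [set: RR] (fun x => (f x - g x) ^+ 2) by mf.
apply: (@le_trans _ _ (\int[leb]_x (3 * ((g (x + s) - g x) ^+ 2 +
   ((f (x + s) - g (x + s)) ^+ 2 + (f x - g x) ^+ 2)))%:E)%E).
  apply: le_integralT => x; first by rewrite lee_fin sqr_ge0.
  rewrite lee_fin.
  have -> : f (x + s) - f x = (g (x + s) - g x) + (f (x + s) - g (x + s)) + - (f x - g x) by ring.
  by apply: le_trans (sqr_sum3 _ _ _) _; rewrite sqrrN addrA.
rewrite ge0_integralZE; [|by []|by move=> x; rewrite !addr_ge0 ?sqr_ge0|by mf].
rewrite ge0_integralDE; [|by move=> x; rewrite sqr_ge0|by move=> x; rewrite addr_ge0 ?sqr_ge0|by mf|by mf].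
rewrite ge0_integralDE; [|by move=> x; rewrite sqr_ge0|by move=> x; rewrite sqr_ge0|by mf|by mf].
rewrite (integral_shift s (F := fun x => ((f x - g x) ^+ 2)%:E)); last 2 first.
- exact: mfE.
- by move=> x; rewrite lee_fin sqr_ge0.
set I := (\int[leb]_x ((g (x + s) - g x) ^+ 2)%:E)%E; set J := (\int[leb]_x ((f x - g x) ^+ 2)%:E)%E.
have I0 : (0 <= I)%E by apply: integral_ge0 => x _; rewrite lee_fin sqr_ge0.
have J0 : (0 <= J)%E by apply: integral_ge0 => x _; rewrite lee_fin sqr_ge0.
rewrite ge0_muleDr//; last exact: adde_ge0.
rewrite leeD2l//; apply: (@le_trans _ _ (3%:E * ((e / 6)%:E + (e / 6)%:E))%E).
  by apply: lee_wpmul2l => //; exact: leeD.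
by rewrite -EFinD -EFinM lee_fin; lra.
Qed.

(** The one-dimensional statement holds on every line x = const where u is square integrable; four
    times the squared norm of the slice dominates in x. *)
Lemma vanish_shift_snd (u : RR * RR -> R) (c : R) :
  measurable_fun [set: (RR * RR)%type] u ->
  (\int[plane]_z (u z ^+ 2)%:E < +oo)%E ->
  vanish (fun n => \int[plane]_z ((u (z.1, z.2 + c * harmonic n) - u z) ^+ 2)%:E)%E.
Proof.
move=> mu_ u2.
have mu2 : measurable_fun [set: (RR * RR)%type] (fun z => (u z ^+ 2)%:E) by mf.
have u20 z : (0 <= (u z ^+ 2)%:E)%E by rewrite lee_fin sqr_ge0.
pose F n (z : RR * RR) := ((u (z.1, z.2 + c * harmonic n)%R - u z) ^+ 2)%:E.
have mF n : measurable_fun [set: (RR * RR)%type] (F n) by rewrite /F; mf.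
have F0 n z : (0 <= F n z)%E by rewrite lee_fin sqr_ge0.
apply: (@le_vanish _ _ (fun n => \int[leb]_x \int[leb]_y F n (x, y))%E).
  by move=> n; rewrite (plane_tonelli (mF n)).
have msec x : measurable_fun [set: RR] (fun y : RR => u (x, y)).
  exact: measurable_fun_pair2.
have mG : measurable_fun [set: RR] (fun x : RR => \int[leb]_y (u (x, y) ^+ 2)%:E)%E.
  exact: (measurable_fun_fubini_tonelli_F (m2 := leb) (fun z => (u z ^+ 2)%:E)).
have G0 x : (0 <= \int[leb]_y (u (x, y) ^+ 2)%:E)%E by exact: integral_ge0.
apply: (@vanish_integral _ _ _ _ _ (fun x => 4%:E * \int[leb]_y (u (x, y) ^+ 2)%:E)%E).
- by move=> n; exact: (measurable_fun_fubini_tonelli_F (m2 := leb) (F n)).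
- exact: measurable_funeM.
- by move=> n x; exact: integral_ge0.
- move=> n x; rewrite /F /=.
  have mx := msec x.
  apply: (@le_trans _ _ (\int[leb]_y (2 * (u (x, y + c * harmonic n) ^+ 2 + u (x, y) ^+ 2))%:E)%E).
    apply: le_integralT => y; first by rewrite lee_fin sqr_ge0.
    by rewrite lee_fin; apply: le_trans (sqr_sum2 _ _) _; rewrite sqrrN.
  have mxs : measurable_fun [set: RR] (fun y => u (x, y + c * harmonic n)).
    by mf.
  rewrite ge0_integralZE; [|by []|by move=> y; rewrite addr_ge0 ?sqr_ge0|by mf].
  rewrite ge0_integralDE; [|by move=> y; rewrite sqr_ge0|by move=> y; rewrite sqr_ge0|by mf|by mf].
  rewrite (integral_shift (c * harmonic n) (F := fun y => (u (x, y) ^+ 2)%:E)); last 2 first.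
  + by apply: mfE; mf.
  + by [].
  set I := (\int[leb]_y _)%E.
  have I0 : (0 <= I)%E by exact: G0.
  have -> : (4%:E = 2%:E + 2%:E :> \bar R)%E by rewrite -EFinD; congr EFin; ring.
  by rewrite ge0_muleDl// ge0_muleDr.
- rewrite ge0_integralZl//.
  by apply: lte_mul_pinfty => //; rewrite -(plane_tonelli mu2).
- move=> x Gx; have mx := msec x.
  apply: (@vanish_shift1 (fun y => u (x, y)) c mx).
  rewrite ltey; apply/negP => /eqP Goo; move: Gx; rewrite Goo.
  by rewrite gt0_muley// ?lte_fin// ltxx.
Qed.

Lemma vanish_shift_fst (u : RR * RR -> R) (c : R) :
  measurable_fun [set: (RR * RR)%type] u ->
  (\int[plane]_z (u z ^+ 2)%:E < +oo)%E ->
  vanish (fun n => \int[plane]_z ((u (z.1 + c * harmonic n, z.2) - u z) ^+ 2)%:E)%E.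
Proof.
move=> mu_ u2; pose v (z : RR * RR) := u (z.2, z.1).
have mv : measurable_fun [set: (RR * RR)%type] v.
  by apply: (mfcomp mu_); apply: measurable_fun_pair; mf.
have v2 : (\int[plane]_z (v z ^+ 2)%:E < +oo)%E.
  rewrite (plane_swap (F := fun z => (u z ^+ 2)%:E))//; first by mf.
  by move=> z; rewrite lee_fin sqr_ge0.
apply: le_vanish (vanish_shift_snd c mv v2) => n; rewrite le_eqVlt; apply/orP; left; apply/eqP.
rewrite -(plane_swap (F := fun z => ((u (z.1 + c * harmonic n, z.2) - u z) ^+ 2)%:E)).
- by [].
- by mf.
- by move=> z; rewrite lee_fin sqr_ge0.
Qed.

(** The coordinates are moved one after the other; the second shift, present in both terms of the
    first difference, is removed by translation invariance. *)
Lemma vanish_shift2 (u : RR * RR -> R) (c1 c2 : R) :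
  measurable_fun [set: (RR * RR)%type] u ->
  (\int[plane]_z (u z ^+ 2)%:E < +oo)%E ->
  vanish (fun n => \int[plane]_z
    ((u (z.1 + c1 * harmonic n, z.2 + c2 * harmonic n) - u z) ^+ 2)%:E)%E.
Proof.
move=> mu_ u2.
have V1 := vanishZ (ler0n R 2) (vanish_shift_fst c1 mu_ u2).
have V2 := vanishZ (ler0n R 2) (vanish_shift_snd c2 mu_ u2).
apply: le_vanish (vanishD V1 V2) => n.
set s1 := c1 * harmonic n; set s2 := c2 * harmonic n.
apply: (@le_trans _ _ (\int[plane]_z (2 * (u (z.1 + s1, z.2 + s2) - u (z.1, z.2 + s2)) ^+ 2 +
   2 * (u (z.1, z.2 + s2) - u z) ^+ 2)%:E)%E).
  apply: le_integralT => z; first by rewrite lee_fin sqr_ge0.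
  rewrite lee_fin -mulrDr.
  have -> : u (z.1 + s1, z.2 + s2) - u z = (u (z.1 + s1, z.2 + s2) - u (z.1, z.2 + s2)) +
    (u (z.1, z.2 + s2) - u z) by ring.
  exact: sqr_sum2.
rewrite ge0_integralDE; [|by move=> x; rewrite mulr_ge0 ?sqr_ge0|by move=> x; rewrite mulr_ge0 ?sqr_ge0|by mf|by mf].
rewrite ge0_integralZE; [|by []|by move=> x; rewrite sqr_ge0|by mf].
rewrite ge0_integralZE; [|by []|by move=> x; rewrite sqr_ge0|by mf].
rewrite leeD2r//.
have := @plane_shift 0 s2 (fun z => ((u (z.1 + s1, z.2) - u z) ^+ 2)%:E) _ _.
move=> <-; [|by mf|by move=> z; rewrite lee_fin sqr_ge0].
by under [in leRHS]eq_integral do rewrite /= addr0.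
Qed.

End translation2.

(** * Complex-valued integrals *)

Section complex_facts.
Context {R : realType}.
Implicit Types (x y : R[i]) (s t : R).

Definition cis t : R[i] := cos t +i* sin t.

Lemma cReM x y : complex.Re (x * y) = complex.Re x * complex.Re y - complex.Im x * complex.Im y.
Proof. by case: x y => [a b] [c d]. Qed.

Lemma cImM x y : complex.Im (x * y) = complex.Re x * complex.Im y + complex.Im x * complex.Re y.
Proof. by case: x y => [a b] [c d]. Qed.

Lemma cReD x y : complex.Re (x + y) = complex.Re x + complex.Re y.
Proof. by case: x y => [a b] [c d]. Qed.

Lemma cImD x y : complex.Im (x + y) = complex.Im x + complex.Im y.
Proof. by case: x y => [a b] [c d]. Qed.

Lemma cReJ x : complex.Re (x^*)%C = complex.Re x.
Proof. by case: x. Qed.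

Lemma cImJ x : complex.Im (x^*)%C = - complex.Im x.
Proof. by case: x. Qed.

Lemma complexP x y : complex.Re x = complex.Re y -> complex.Im x = complex.Im y -> x = y.
Proof. by case: x y => [a b] [c d] /= -> ->. Qed.

Lemma normcE2 x : normc x = Num.sqrt (complex.Re x ^+ 2 + complex.Im x ^+ 2).
Proof. by case: x. Qed.

Lemma normc_ge0 x : 0 <= normc x.
Proof. by rewrite normcE2 sqrtr_ge0. Qed.

Lemma normc_sqr x : normc x ^+ 2 = complex.Re x ^+ 2 + complex.Im x ^+ 2.
Proof. by rewrite normcE2 sqr_sqrtr// addr_ge0 ?sqr_ge0. Qed.

Lemma normr_Re_le x : `|complex.Re x| <= normc x.
Proof. by rewrite normcE2 -sqrtr_sqr ler_wsqrtr// lerDl sqr_ge0. Qed.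

Lemma normr_Im_le x : `|complex.Im x| <= normc x.
Proof. by rewrite normcE2 -sqrtr_sqr ler_wsqrtr// lerDr sqr_ge0. Qed.

Lemma normcM' x y : normc (x * y) = normc x * normc y.
Proof. exact: normcM. Qed.

Lemma normcJ' x : normc (x^*)%C = normc x.
Proof. by case: x => a b; rewrite /normc /= sqrrN. Qed.

Lemma normcR t : normc t%:C = `|t|.
Proof. by rewrite /normc /= expr0n/= addr0 sqrtr_sqr. Qed.

Lemma normc_cis t : normc (cis t) = 1.
Proof. by rewrite /normc /= cos2Dsin2 sqrtr1. Qed.

Lemma cisD s t : cis (s + t) = cis s * cis t.
Proof. by apply: complexP; rewrite ?cReM ?cImM /= ?cosD// sinD addrC. Qed.

Lemma cis0 : cis 0 = 1.
Proof. by rewrite /cis cos0 sin0. Qed.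

Lemma cisN t : cis (- t) = (cis t)^*%C.
Proof. by rewrite /cis cosN sinN. Qed.

Lemma realcM s x : s%:C * x = (s * complex.Re x) +i* (s * complex.Im x).
Proof. by apply: complexP; rewrite ?cReM ?cImM /= mul0r ?subr0 ?addr0. Qed.

End complex_facts.

Section complex_measurable.
Context d (T : measurableType d) {R : realType}.
Implicit Types f g : T -> R[i].

Definition cmeas f := measurable_fun [set: T] (fun x => complex.Re (f x)) /\
  measurable_fun [set: T] (fun x => complex.Im (f x)).

Lemma cmeasM f g : cmeas f -> cmeas g -> cmeas (fun x => f x * g x).
Proof.
move=> [f1 f2] [g1 g2]; split.
  by under eq_fun do rewrite cReM; mf.
by under eq_fun do rewrite cImM; mf.
Qed.

Lemma cmeasD f g : cmeas f -> cmeas g -> cmeas (fun x => f x + g x).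
Proof.
move=> [f1 f2] [g1 g2]; split.
  by under eq_fun do rewrite cReD; mf.
by under eq_fun do rewrite cImD; mf.
Qed.

Lemma cmeasN f : cmeas f -> cmeas (fun x => - f x).
Proof.
move=> [f1 f2]; split.
  by under eq_fun do rewrite (raddfN (@complex.Re R)); mf.
by under eq_fun do rewrite (raddfN (@complex.Im R)); mf.
Qed.

Lemma mfRe f : cmeas f -> measurable_fun [set: T] (fun x => complex.Re (f x)).
Proof. by case. Qed.

Lemma mfIm f : cmeas f -> measurable_fun [set: T] (fun x => complex.Im (f x)).
Proof. by case. Qed.

Lemma cmeasJ f : cmeas f -> cmeas (fun x => (f x)^*%C).
Proof.
move=> [f1 f2]; split.
  by under eq_fun do rewrite cReJ; mf.
by under eq_fun do rewrite cImJ; mf.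
Qed.

Lemma cmeas_cst (c : R[i]) : cmeas (fun=> c).
Proof. by split; exact: measurable_cst. Qed.

Lemma cmeasR (h : T -> R) : measurable_fun [set: T] h -> cmeas (fun x => (h x)%:C).
Proof. by move=> mh; split => //=; exact: measurable_cst. Qed.

Lemma cmeas_cis (h : T -> R) : measurable_fun [set: T] h -> cmeas (fun x => cis (h x)).
Proof.
move=> mh; split => /=; apply: mfcont => //.
  exact: continuous_cos.
exact: continuous_sin.
Qed.

Lemma mf_normc f : cmeas f -> measurable_fun [set: T] (fun x => normc (f x)).
Proof.
move=> [f1 f2]; under eq_fun do rewrite normcE2.
apply: mfcont; [exact: sqrt_continuous|mf].
Qed.

End complex_measurable.

Lemma cmeas_comp d1 (T1 : measurableType d1) d2 (T2 : measurableType d2) (R : realType)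
    (f : T2 -> R[i]) (k : T1 -> T2) : cmeas f -> measurable_fun [set: T1] k ->
  cmeas (fun x => f (k x)).
Proof. by move=> [f1 f2] mk; split; [apply: (mfcomp f1)|apply: (mfcomp f2)]. Qed.

Ltac cmf_head :=
  lazymatch goal with
  | |- cmeas (fun _ => ?c) => exact: cmeas_cst
  | |- cmeas (fun x => (_ * _)%R) => apply: cmeasM
  | |- cmeas (fun x => (_ + _)%R) => apply: cmeasD
  | |- cmeas (fun x => (- _)%R) => apply: cmeasN
  | |- cmeas (fun x => (_)^*%C) => apply: cmeasJ
  | |- cmeas (fun x => (_)%:C) => apply: cmeasR
  | |- cmeas (fun x => cis _) => apply: cmeas_cis
  | |- measurable_fun _ (fun x => complex.Re _) => apply: mfRe
  | |- measurable_fun _ (fun x => complex.Im _) => apply: mfIm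
  | |- measurable_fun _ (fun x => normc _) => apply: mf_normc
  end.
Ltac cmf_step := first
  [ match goal with
    | H : cmeas ?h |- cmeas ?h => exact: H
    | H : cmeas ?h |- cmeas (fun x => ?h (@?k x)) => apply: (cmeas_comp H)
    end
  | cmf_head | mf_step ].
Ltac cmf := repeat cmf_step.

Section complex_integral.
Context d (T : measurableType d) {R : realType} (mu : {measure set T -> \bar R}).
Implicit Types f g : T -> R[i].

(** Over [plane], [cint] and [cintble] unfold to [cintegral] and [cintegrable]; the general form
    also serves on the line. *)
Definition cint f : R[i] :=
  Rintegral mu [set: T] (fun x => complex.Re (f x)) +i*
  Rintegral mu [set: T] (fun x => complex.Im (f x)).

Definition cintble f := mu.-integrable [set: T] (fun x => (complex.Re (f x))%:E) /\
  mu.-integrable [set: T] (fun x => (complex.Im (f x))%:E).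

Lemma cintble_meas f : cintble f -> cmeas f.
Proof.
by move=> [/measurable_int/measurable_EFinP f1 /measurable_int/measurable_EFinP f2].
Qed.

Lemma integrable_le (f g : T -> R) : measurable_fun [set: T] f ->
  (forall x, `|f x| <= g x) -> (\int[mu]_x (g x)%:E < +oo)%E ->
  mu.-integrable [set: T] (fun x => (f x)%:E).
Proof.
move=> mf_ fg ig; apply/integrableP; split; first exact: mfE.
by apply: le_lt_trans ig; apply: le_integralT => x //; rewrite lee_fin.
Qed.

Lemma cintbleP f : cmeas f -> (\int[mu]_x (normc (f x))%:E < +oo)%E -> cintble f.
Proof.
move=> [f1 f2] fi; split; apply: (integrable_le _ _ fi) => // x.
  exact: normr_Re_le.
exact: normr_Im_le.
Qed.

Lemma cintble_le f (g : T -> R) : cmeas f -> (forall x, normc (f x) <= g x) ->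
  (\int[mu]_x (g x)%:E < +oo)%E -> cintble f.
Proof.
move=> mf_ fg ig; apply: cintbleP => //; apply: le_lt_trans ig.
by apply: le_integralT => x; rewrite lee_fin// normc_ge0.
Qed.

Lemma cintble_normc f : cintble f -> (\int[mu]_x (normc (f x))%:E < +oo)%E.
Proof.
move=> fi; have [f1 f2] := cintble_meas fi.
move: fi => [/integrableP[_ i1] /integrableP[_ i2]].
apply: (@le_lt_trans _ _ (\int[mu]_x (`|complex.Re (f x)| + `|complex.Im (f x)|)%:E)%E).
  apply: le_integralT => x; rewrite lee_fin ?normc_ge0//.
  rewrite -(@ler_pXn2r _ 2)// ?nnegrE ?normc_ge0 ?addr_ge0//.
  rewrite normc_sqr sqrrD !real_normK ?num_real// [leRHS]addrAC lerDl.
  by rewrite mulrn_wge0 ?mulr_ge0.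
by rewrite ge0_integralDE//; [exact: lte_add_pinfty|mf|mf].
Qed.

Lemma eq_cint f g : f =1 g -> cint f = cint g.
Proof. by move=> fg; congr cint; apply/funext. Qed.

Lemma cintZ (c : R[i]) f : cintble f -> cint (fun x => c * f x) = c * cint f.
Proof.
move=> [i1 i2]; apply: complexP; rewrite ?cReM ?cImM /=.
  under eq_Rintegral do rewrite cReM.
  rewrite RintegralB//=; last 2 first.
  - exact: (integrableZl measurableT (complex.Re c) i1).
  - exact: (integrableZl measurableT (complex.Im c) i2).
  by rewrite !RintegralZl.
under eq_Rintegral do rewrite cImM.
rewrite RintegralD//=; last 2 first.
- exact: (integrableZl measurableT (complex.Re c) i2).
- exact: (integrableZl measurableT (complex.Im c) i1).
by rewrite !RintegralZl.
Qed.

Lemma cintJ f : cintble f -> cint (fun x => (f x)^*%C) = (cint f)^*%C.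
Proof.
move=> [i1 i2]; apply: complexP; rewrite ?cReJ ?cImJ /=.
  by apply: eq_Rintegral => x _; rewrite cReJ.
rewrite -mulN1r -RintegralZl//.
by apply: eq_Rintegral => x _; rewrite cImJ mulN1r.
Qed.

Lemma cintD f g : cintble f -> cintble g ->
  cint (fun x => f x + g x) = cint f + cint g.
Proof.
move=> [i1 i2] [j1 j2]; apply: complexP; rewrite ?cReD ?cImD /=.
  by rewrite -RintegralD//; apply: eq_Rintegral => x _; rewrite cReD.
by rewrite -RintegralD//; apply: eq_Rintegral => x _; rewrite cImD.
Qed.

(* With [c] the conjugate of the integral, [c * cint f] is the square of its modulus. *)
Lemma normc_cint_le f : cintble f ->
  ((normc (cint f))%:E <= \int[mu]_x (normc (f x))%:E)%E.
Proof.
move=> fi; have fN := cintble_normc fi; have mf_ := cintble_meas fi.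
set I := cint f; have [I0|I0] := eqVneq (normc I) 0.
  by rewrite I0; apply: integral_ge0 => x _; rewrite lee_fin normc_ge0.
have Ipos : 0 < normc I by rewrite lt_neqAle eq_sym I0 normc_ge0.
have [i1 i2] := fi.
have Nfin : (\int[mu]_x (normc (f x))%:E)%E \is a fin_num.
  by rewrite ge0_fin_numE//; apply: integral_ge0 => x _; rewrite lee_fin normc_ge0.
rewrite -(fineK Nfin) lee_fin -(ler_pM2l Ipos) -expr2 normc_sqr.
have j1 : mu.-integrable [set: T] (fun x => (complex.Re I * complex.Re (f x))%:E).
  exact: (integrableZl measurableT (complex.Re I) i1).
have j2 : mu.-integrable [set: T] (fun x => (complex.Im I * complex.Im (f x))%:E).
  exact: (integrableZl measurableT (complex.Im I) i2).
have -> : complex.Re I ^+ 2 + complex.Im I ^+ 2 =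
    Rintegral mu [set: T] (fun x => complex.Re I * complex.Re (f x) +
       complex.Im I * complex.Im (f x)).
  by rewrite RintegralD// !RintegralZl//.
rewrite -[fine _]/(Rintegral mu [set: T] (fun x => normc (f x))).
have iN : mu.-integrable [set: T] (fun x => (normc (f x))%:E).
  apply: (integrable_le _ _ fN); first exact: mf_normc.
  by move=> x; rewrite ger0_norm ?normc_ge0.
rewrite -RintegralZl//; apply: le_Rintegral => //.
- exact: (integrableD measurableT j1 j2).
- exact: (integrableZl measurableT (normc I) iN).
move=> x _.
have -> : complex.Re I * complex.Re (f x) + complex.Im I * complex.Im (f x) =
   complex.Re (I^*%C * f x) by rewrite cReM cReJ cImJ mulNr opprK.
apply: le_trans (ler_norm _) _; apply: le_trans (normr_Re_le _) _.
by rewrite normcM' normcJ'.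
Qed.

End complex_integral.

(** * Fubini under a product majorant *)

Section fubini_product_bound.
Context d1 d2 (T1 : measurableType d1) (T2 : measurableType d2) {R : realType}.
Variables (m1 : {sigma_finite_measure set T1 -> \bar R})
  (m2 : {sigma_finite_measure set T2 -> \bar R}).
Variables (A : T1 -> R) (B : T2 -> R).
Hypotheses (mA : measurable_fun [set: T1] A) (mB : measurable_fun [set: T2] B).
Hypotheses (A0 : forall x, 0 <= A x) (B0 : forall y, 0 <= B y).
Hypotheses (iA : (\int[m1]_x (A x)%:E < +oo)%E) (iB : (\int[m2]_y (B y)%:E < +oo)%E).

Lemma integral_prod_bound : (\int[m1 \x m2]_z (A z.1 * B z.2)%:E < +oo)%E.
Proof.
have mAB : measurable_fun [set: T1 * T2] (fun z : T1 * T2 => (A z.1 * B z.2)%:E) by mf.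
rewrite fubini_tonelli1//=; last by move=> z; rewrite lee_fin mulr_ge0.
rewrite /fubini_F /=; under eq_integral => x _.
  rewrite ge0_integralZE//; over.
have IB0 : (0 <= \int[m2]_y (B y)%:E)%E by apply: integral_ge0 => y _; rewrite lee_fin.
rewrite ge0_integralZr//; last 2 first.
- by mf.
- by move=> x _; rewrite lee_fin.
have IA0 : (0 <= \int[m1]_x (A x)%:E)%E by apply: integral_ge0 => y _; rewrite lee_fin.
by apply: lte_mul_pinfty => //; rewrite ge0_fin_numE.
Qed.

Section real.
Variable f : T1 * T2 -> R.
Hypothesis (mf_ : measurable_fun [set: T1 * T2] f).
Hypothesis fAB : forall x y, `|f (x, y)| <= A x * B y.

Lemma integrable_prod_bound : (m1 \x m2)%E.-integrable [set: T1 * T2] (fun z => (f z)%:E).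
Proof. by apply: (integrable_le _ _ integral_prod_bound) => // -[x y]; exact: fAB. Qed.

Let sec1 x : m2.-integrable [set: T2] (fun y => (f (x, y))%:E).
Proof.
apply: (@integrable_le _ _ _ m2 _ (fun y => A x * B y)).
- by mf.
- by move=> y; exact: fAB.
- rewrite ge0_integralZE//; apply: lte_mul_pinfty => //; rewrite ?lee_fin//.
Qed.

Let sec2 y : m1.-integrable [set: T1] (fun x => (f (x, y))%:E).
Proof.
apply: (@integrable_le _ _ _ m1 _ (fun x => B y * A x)).
- by mf.
- by move=> x; rewrite mulrC; exact: fAB.
- rewrite ge0_integralZE//; apply: lte_mul_pinfty => //; rewrite ?lee_fin//.
Qed.

(** The majorant A(x) B(y) makes every section integrable, not merely almost every one, so [fine]
    loses nothing in the inner integral. *)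
Lemma Rintegral_fubini1 :
  Rintegral m1 [set: T1] (fun x => Rintegral m2 [set: T2] (fun y => f (x, y))) =
  Rintegral (m1 \x m2)%E [set: T1 * T2] f.
Proof.
rewrite /Rintegral -(integral12_prod_meas1 integrable_prod_bound); congr fine.
apply: eq_integral => x _; rewrite fineK//.
exact: integrable_fin_num.
Qed.

Lemma Rintegral_fubini2 :
  Rintegral m2 [set: T2] (fun y => Rintegral m1 [set: T1] (fun x => f (x, y))) =
  Rintegral (m1 \x m2)%E [set: T1 * T2] f.
Proof.
rewrite /Rintegral -(integral21_prod_meas1 integrable_prod_bound); congr fine.
apply: eq_integral => x _; rewrite fineK//.
exact: integrable_fin_num.
Qed.

End real.

Variable f : T1 * T2 -> R[i].
Hypothesis (mf_ : cmeas f).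
Hypothesis fAB : forall x y, normc (f (x, y)) <= A x * B y.

Lemma cint_fubini1 : cint m1 (fun x => cint m2 (fun y => f (x, y))) = cint (m1 \x m2)%E f.
Proof.
have [f1 f2] := mf_.
apply: complexP => /=.
  rewrite -(Rintegral_fubini1 f1)// => x y; exact: le_trans (normr_Re_le _) (fAB _ _).
rewrite -(Rintegral_fubini1 f2)// => x y; exact: le_trans (normr_Im_le _) (fAB _ _).
Qed.

Lemma cint_fubini2 : cint m2 (fun y => cint m1 (fun x => f (x, y))) = cint (m1 \x m2)%E f.
Proof.
have [f1 f2] := mf_.
apply: complexP => /=.
  rewrite -(Rintegral_fubini2 f1)// => x y; exact: le_trans (normr_Re_le _) (fAB _ _).
rewrite -(Rintegral_fubini2 f2)// => x y; exact: le_trans (normr_Im_le _) (fAB _ _).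
Qed.

Lemma cint_fubini : cint m1 (fun x => cint m2 (fun y => f (x, y))) =
  cint m2 (fun y => cint m1 (fun x => f (x, y))).
Proof. by rewrite cint_fubini1 cint_fubini2. Qed.

End fubini_product_bound.

(** * Substitution and differentiation under the integral *)

Section affine_Rintegral.
Context {R : realType}.
Notation RR := (measurableTypeR R).
Local Notation leb := (@lebesgue_measure R).

Lemma integral_affine (a b : R) (f : R -> \bar R) : a != 0 ->
  leb.-integrable [set: RR] f ->
  (\int[leb]_x f (a * x + b)%R = (`|a|^-1)%:E * \int[leb]_x f x)%E.
Proof.
move=> a0 fi; have /integrableP[mf_ _] := fi.
rewrite integralE [in RHS]integralE.
have -> : (\int[leb]_x (fun x : RR => f (a * x + b)%R)^\+ x =
    (`|a|^-1)%:E * \int[leb]_x f^\+ x)%E.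
  by rewrite -(ge0_integral_affine b (f := f^\+)%E a0 (measurable_funepos mf_) (funepos_ge0 f)); apply: eq_integral => x _; rewrite !funeposE.
have -> : (\int[leb]_x (fun x : RR => f (a * x + b)%R)^\- x =
    (`|a|^-1)%:E * \int[leb]_x f^\- x)%E.
  by rewrite -(ge0_integral_affine b (f := f^\-)%E a0 (measurable_funeneg mf_) (funeneg_ge0 f)); apply: eq_integral => x _; rewrite !funenegE.
have := integrable_neg_fin_num measurableT fi.
move: (\int[leb]_x f^\- x)%E (\int[leb]_x f^\+ x)%E => N P Nf.
by rewrite muleBr// fin_num_adde_defl// fin_numN.
Qed.

Lemma integrable_affine (a b : R) (f : R -> R) : a != 0 ->
  leb.-integrable [set: RR] (fun x => (f x)%:E) ->
  leb.-integrable [set: RR] (fun x : RR => (f (a * x + b))%:E).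
Proof.
move=> a0 /integrableP[/measurable_EFinP mf_ fi].
apply: (@integrable_le _ _ _ leb _ (fun x : R => `|f (a * x + b)|)) => //; first by mf.
rewrite (ge0_integral_affine b (f := fun x => `|f x|%:E))//; last by mf.
by apply: lte_mul_pinfty => //; rewrite lee_fin invr_ge0.
Qed.

Lemma Rintegral_affine (a b : R) (f : R -> R) : a != 0 ->
  leb.-integrable [set: RR] (fun x => (f x)%:E) ->
  Rintegral leb [set: RR] (fun x => f (a * x + b)) =
  `|a|^-1 * Rintegral leb [set: RR] f.
Proof.
move=> a0 fi; rewrite /Rintegral (integral_affine b a0 fi) fineM//.
exact: integrable_fin_num.
Qed.

Lemma cint_affine (a b : R) (f : R -> R[i]) : a != 0 -> cintble leb f ->
  cint leb (fun x : RR => f (a * x + b)) = (`|a|^-1)%:C * cint leb (f : RR -> R[i]).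
Proof.
move=> a0 [i1 i2]; rewrite realcM /cint.
by rewrite (Rintegral_affine b a0 i1) (Rintegral_affine b a0 i2).
Qed.

Lemma is_derive_Rintegral d (Y : measurableType d) (mu : {measure set Y -> \bar R})
    (f df : R -> Y -> R) (G : Y -> R) (a : R) :
  (forall x, mu.-integrable [set: Y] (fun y => (f x y)%:E)) ->
  (forall (x : R) y, is_derive x 1 (fun t : R => f t y) (df x y)) ->
  (forall x y, `|x - a| < 1 -> `|df x y| <= G y) ->
  mu.-integrable [set: Y] (fun y => (G y)%:E) ->
  is_derive a 1 (fun x => Rintegral mu [set: Y] (f x)) (Rintegral mu [set: Y] (df a)).
Proof.
move=> fi fdf dfG Gi.
have Ia : a \in `](a - 1), (a + 1)[ by rewrite in_itv/=; lra.
have d1E x y : partial1of2 f x y = df x y.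
  by rewrite /partial1of2 derive1E; have [_ ->] := fdf x y.
have G0 y : 0 <= G y.
  by apply: le_trans (dfG a y _) => //; rewrite subrr normr0.
have Gub x y : `](a - 1), (a + 1)[%classic x -> [set: Y] y -> `|partial1of2 f x y| <= G y.
  by rewrite /= in_itv/= => /andP[x1 x2] _; rewrite d1E dfG// ltr_norml; lra.
have derf x y : `](a - 1), (a + 1)[%classic x -> [set: Y] y -> derivable (fun t : R => f t y) x 1.
  by move=> _ _; have [] := fdf x y.
have fi' x : `](a - 1), (a + 1)[%classic x -> mu.-integrable [set: Y] (EFin \o f x).
  by move=> _; exact: fi.
split.
  exact: (@derivable_under_integral R _ Y mu f setT measurableT a (a - 1) (a + 1) Ia fi' derf G G0 Gi Gub).
rewrite -derive1E (@differentiation_under_integral R _ Y mu f setT measurableT a (a - 1) (a + 1) Ia fi' derf G G0 Gi Gub).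
by apply: eq_Rintegral => y _; rewrite d1E.
Qed.

End affine_Rintegral.

(** * Gaussian wave packets *)

Section gauss.
Context {R : realType}.
Notation RR := (measurableTypeR R).
Local Notation leb := (@lebesgue_measure R).

(** With y = c x^2 and m = k + 1, the inequality 1 + y / m <= exp (y / m) raised to the power m
    shows that exp y dominates a multiple of (1 + |x|)^(2 m). *)
Lemma gauss_poly_bound (c : R) (k : nat) : 0 < c -> exists C : R, 0 <= C /\
  forall x, (1 + `|x|) ^+ k * expR (- (c * x ^+ 2)) <= C.
Proof.
(* The three factors come from (1 + |x|)^2 <= 2 (1 + x^2), from 1 + x^2 <= (1 + 1/c) (1 + y), and
   from 1 + y <= m (1 + y / m). *)
move=> c0; pose m := k.+1; pose K := 2 * (1 + c^-1) * m%:R.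
have cV0 : 0 < c^-1 by rewrite invr_gt0.
have m0 : 0 < m%:R :> R by rewrite ltr0n.
have K0 : 0 < K by rewrite !mulr_gt0// addr_gt0.
exists (K ^+ m); split; first by rewrite exprn_ge0// ltW.
move=> x; rewrite expRN ler_pdivrMr ?expR_gt0//.
have [y yE] : exists y, y = c * x ^+ 2 by exists (c * x ^+ 2).
have y0 : 0 <= y by rewrite yE mulr_ge0 ?sqr_ge0// ltW.
rewrite -yE.
have H1 : (1 + `|x|) ^+ 2 <= K * (1 + y / m%:R).
  have h1 : (1 + `|x|) ^+ 2 <= 2 * (1 + x ^+ 2).
    by rewrite -[x ^+ 2]real_normK ?num_real//; have := sqr_ge0 (1 - `|x|); rewrite !expr2; lra.
  have h2 : 1 + x ^+ 2 <= (1 + c^-1) * (1 + y).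
    have -> : (1 + c^-1) * (1 + y) = 1 + x ^+ 2 + c^-1 + y by rewrite yE; field; rewrite gt_eqF.
    by lra.
  have h3 : 1 + y <= m%:R * (1 + y / m%:R).
    rewrite mulrDr mulr1 mulrCA divff ?gt_eqF// mulr1 lerD2r.
    by rewrite ler1n.
  apply: (le_trans h1); rewrite /K -!mulrA ler_pM2l//; apply: (le_trans h2).
  by apply: ler_wpM2l => //; lra.
have H2 : 1 + y / m%:R <= expR (y / m%:R) by exact: expR_ge1Dx.
have H3 : (1 + `|x|) ^+ 2 ^+ m <= (K * expR (y / m%:R)) ^+ m.
  apply: lerXn2r; rewrite ?nnegrE.
  - by rewrite exprn_ge0// ltW// onenorm_gt0.
  - by rewrite mulr_ge0 ?expR_ge0// ltW.
  - by apply: (le_trans H1); apply: ler_wpM2l => //; exact: ltW.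
move: H3; rewrite [(K * _) ^+ m]exprMn -expRM_natl mulrCA divff ?gt_eqF// mulr1 => H3.
apply: le_trans H3; rewrite -exprM.
by apply: ler_weXn2l; [rewrite lerDl|exact: leq_trans (leqnSn k) (leq_pmull _ _)].
Qed.

(** The parameter is the inverse width, so the Fourier transform of [gau t] is a multiple of
    [gau t^-1]. *)
Definition gau (t x : R) : R := expR (- ((t * x) ^+ 2 / 2)).

Lemma gau_ge0 t x : 0 <= gau t x. Proof. exact: expR_ge0. Qed.

Lemma gau_le1 t x : gau t x <= 1.
Proof. by rewrite /gau expR_le1 oppr_le0 divr_ge0// sqr_ge0. Qed.

Lemma gau_scale t x : gau t x = gau 1 (t * x).
Proof. by rewrite /gau mul1r. Qed.

Lemma measurable_gau t : measurable_fun [set: RR] (gau t).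
Proof.
apply: mfcont; first exact: continuous_expR.
by mf.
Qed.

Lemma gau_jap t k : 0 < t -> exists C : R, 0 <= C /\
  forall x, (1 + `|x|) ^+ k * gau t x <= C * jap 2 x.
Proof.
move=> t0; have c0 : 0 < t ^+ 2 / 2 by rewrite divr_gt0// exprn_gt0.
have [C [C0 HC]] := gauss_poly_bound k.+2 c0.
exists C; split => // x; rewrite /jap powR_invn ?(ltW (onenorm_gt0 _))//.
rewrite ler_pdivlMr ?exprn_gt0 ?onenorm_gt0//.
apply: le_trans (HC x); rewrite mulrAC -exprD addn2 /gau exprMn.
by rewrite (_ : t ^+ 2 * x ^+ 2 / 2 = t ^+ 2 / 2 * x ^+ 2)//; field.
Qed.

Lemma integrable_jap2 (C : R) : 0 <= C -> (\int[leb]_x (C * jap 2 x)%:E < +oo)%E.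
Proof.
move=> C0; have p2 : 1 < 2 :> R by lra.
have [_ _] := integral_leZ C0 (integral_le_jap p2).
by move=> H; apply: (le_lt_trans H); exact: ltry.
Qed.

Lemma integrable_dom (f : R -> R) (C : R) : measurable_fun [set: RR] f ->
  (forall x, `|f x| <= C * jap 2 x) -> leb.-integrable [set: RR] (fun x => (f x)%:E).
Proof.
move=> mf_ fC; apply: (integrable_le mf_ fC); apply: integrable_jap2.
by rewrite -(pmulr_lge0 _ (jap_gt0 2 0)); exact: le_trans (normr_ge0 _) (fC 0).
Qed.

Let Phi (xi : R) := Rintegral leb [set: RR] (fun x => gau 1 x * cos (xi * x)).

Lemma is_derive_gau1 (x : R) : is_derive x 1 (gau 1) (- x * gau 1 x).
Proof.
have H : is_derive x 1 (fun y : R => - ((1 * y) ^+ 2 / 2)) (- x).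
  have := is_derive_mul (is_derive_affine (- 2^-1) 0 x) (is_derive_affine 1 0 x).
  have -> : (fun y : R => (- 2^-1 * y + 0) * (1 * y + 0)) = (fun y => - ((1 * y) ^+ 2 / 2)).
    by apply/funext => y; ring.
  by have -> : - 2^-1 * (1 * x + 0) + (- 2^-1 * x + 0) * 1 = - x by field.
have := @is_derive1_comp R expR (fun y : R => - ((1 * y) ^+ 2 / 2)) x _ _ (is_derive_expR _) H.
by rewrite mulrC.
Qed.

Lemma is_derive_cos_scale (k x : R) : is_derive x 1 (fun y => cos (k * y)) (- k * sin (k * x)).
Proof.
have := @is_derive1_comp R cos (fun y : R => k * y + 0) x _ _ (is_derive_cos _) (is_derive_affine k 0 x).
rewrite addr0 mulrC mulrN -mulNr.
by under [X in is_derive _ _ X]eq_fun do rewrite addr0.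
Qed.

Lemma is_derive_sin_scale (k x : R) : is_derive x 1 (fun y => sin (k * y)) (k * cos (k * x)).
Proof.
have := @is_derive1_comp R sin (fun y : R => k * y + 0) x _ _ (is_derive_sin _) (is_derive_affine k 0 x).
rewrite addr0 mulrC.
by under [X in is_derive _ _ X]eq_fun do rewrite addr0.
Qed.

Lemma normr_cos_le1 (x : R) : `|cos x| <= 1.
Proof. by rewrite ler_norml cos_geN1 cos_le1. Qed.

Lemma normr_sin_le1 (x : R) : `|sin x| <= 1.
Proof. by rewrite ler_norml sin_geN1 sin_le1. Qed.

Lemma mfcos d (T : measurableType d) (f : T -> R) : measurable_fun [set: T] f ->
  measurable_fun [set: T] (fun x => cos (f x)).
Proof. by move=> mf_; apply: mfcont => //; exact: continuous_cos. Qed.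

Lemma mfsin d (T : measurableType d) (f : T -> R) : measurable_fun [set: T] f ->
  measurable_fun [set: T] (fun x => sin (f x)).
Proof. by move=> mf_; apply: mfcont => //; exact: continuous_sin. Qed.

(* Integrating the derivative of [x |-> gau 1 x * sin (xi * x)] over the line gives 0,
   by translation invariance. *)
Lemma gau_by_parts (xi : R) :
  Rintegral leb [set: RR] (fun x => - x * gau 1 x * sin (xi * x)) = - xi * Phi xi.
Proof.
have [C [C0 HC]] := gau_jap 1 (ltr01 : 0 < 1 :> R).
have mg := measurable_gau 1.
pose F (x : R) : R := gau 1 x * sin (xi * x).
pose dF (x : R) : R := - x * gau 1 x * sin (xi * x) + gau 1 x * (xi * cos (xi * x)).
have HF (x : R) : is_derive x 1 F (dF x).
  exact: is_derive_mul (is_derive_gau1 x) (is_derive_sin_scale xi x).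
have gC x : gau 1 x <= C * jap 2 x.
  by apply: le_trans (HC x); rewrite expr1 ler_peMl ?gau_ge0// lerDl.
have xgC x : `|x| * gau 1 x <= C * jap 2 x.
  by apply: le_trans (HC x); rewrite expr1 ler_wpM2r ?gau_ge0// lerDr.
have F1 x : `|F x| <= C * jap 2 x.
  rewrite normrM ger0_norm ?gau_ge0//; apply: le_trans (gC x).
  by rewrite ler_piMr ?gau_ge0// normr_sin_le1.
have T1 x : `|- x * gau 1 x * sin (xi * x)| <= C * jap 2 x.
  rewrite !normrM normrN (ger0_norm (gau_ge0 _ _)); apply: le_trans (xgC x).
  by rewrite ler_piMr ?mulr_ge0 ?gau_ge0// normr_sin_le1.
have T2' x : `|gau 1 x * cos (xi * x)| <= C * jap 2 x.
  rewrite normrM ger0_norm ?gau_ge0//; apply: le_trans (gC x).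
  by rewrite ler_piMr ?gau_ge0// normr_cos_le1.
have T2 x : `|gau 1 x * (xi * cos (xi * x))| <= (`|xi| * C) * jap 2 x.
  by rewrite mulrCA normrM -mulrA ler_wpM2l.
have dF1 x : `|dF x| <= (C + `|xi| * C) * jap 2 x.
  by rewrite mulrDl; apply: le_trans (ler_normD _ _) _; exact: lerD.
have iF : leb.-integrable [set: RR] (fun x => (F x)%:E).
  apply: (integrable_dom _ F1); rewrite /F; apply: mfM => //; apply: mfsin; mf.
(* A majorant independent of the shift: for |s| < 1 one has 1 + |x| <= 2 (1 + |x + s|), which costs
   2^2 = 4. *)
have shift s x : `|s - 0| < 1 -> `|dF (1 * x + s)| <= 4 * (C + `|xi| * C) * jap 2 x.
  rewrite subr0 mul1r => s1; apply: (le_trans (dF1 _)).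
  rewrite -mulrA mulrCA ler_wpM2l ?addr_ge0 ?mulr_ge0//.
  have -> : 4 = 2 `^ 2 :> R by rewrite (powR_mulrn 2) -?natrX.
  apply: jap_scale => //.
  have := ler_normB (x + s) s; rewrite addrK; have := normr_ge0 (x + s); lra.
have iS s : leb.-integrable [set: RR] (fun x : RR => (F (1 * x + s))%:E).
  exact: integrable_affine.
have D1 : is_derive (0 : R) 1 (fun s => Rintegral leb [set: RR] (fun x : RR => F (1 * x + s)))
    (Rintegral leb [set: RR] (fun x : RR => dF (1 * x + 0))).
  apply: (@is_derive_Rintegral R _ RR leb (fun s x => F (1 * x + s)) (fun s x => dF (1 * x + s))
    (fun x => 4 * (C + `|xi| * C) * jap 2 x)) => //.
    move=> s x; have := @is_derive1_comp R F (fun y : R => 1 * y + x) s _ _ (HF _) (is_derive_affine 1 x s).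
    rewrite mulr1 mul1r addrC => H.
    have -> : (fun s => F (1 * x + s)) = F \o (fun y => 1 * y + x).
      by apply/funext => y /=; rewrite !mul1r addrC.
    by rewrite mul1r.
  apply: (@integrable_dom _ (4 * (C + `|xi| * C))); first by mf.
  by move=> x; rewrite ger0_norm// !mulr_ge0 ?addr_ge0 ?mulr_ge0 ?jap_ge0.
have D2 : is_derive (0 : R) 1 (fun s => Rintegral leb [set: RR] (fun x : RR => F (1 * x + s))) 0.
  under eq_fun do rewrite (Rintegral_affine _ (oner_neq0 R) iF).
  exact: is_derive_constl.
have E0 : Rintegral leb [set: RR] (fun x : RR => dF (1 * x + 0)) = 0.
  by have [_ <-] := D1; have [_ ->] := D2.
have : Rintegral leb [set: RR] (fun x : RR => dF x) = 0.
  by rewrite -E0; apply: eq_Rintegral => x _; rewrite mul1r addr0.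
have i1 : leb.-integrable [set: RR] (fun x : RR => (- x * gau 1 x * sin (xi * x))%:E).
  by apply: (integrable_dom _ T1); apply: mfM; [mf|apply: mfsin; mf].
have i3 : leb.-integrable [set: RR] (fun x : RR => (gau 1 x * cos (xi * x))%:E).
  by apply: (integrable_dom _ T2'); apply: mfM => //; apply: mfcos; mf.
have i2 : leb.-integrable [set: RR] (fun x : RR => (gau 1 x * (xi * cos (xi * x)))%:E).
  by apply: (integrable_dom _ T2); apply: mfM => //; apply: mfM; [mf|apply: mfcos; mf].
rewrite RintegralD// => /eqP; rewrite addr_eq0 => /eqP ->.
rewrite mulNr; congr (- _); rewrite -RintegralZl//.
by apply: eq_Rintegral => x _; rewrite mulrCA.
Qed.

(** Differentiation under the integral followed by [gau_by_parts]; this is the differential equation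
    of a Gaussian. *)
Lemma Phi_derive (xi : R) : is_derive xi 1 Phi (- xi * Phi xi).
Proof.
have [C [C0 HC]] := gau_jap 1 (ltr01 : 0 < 1 :> R).
have mg := measurable_gau 1.
rewrite -gau_by_parts.
apply: (@is_derive_Rintegral R _ RR leb (fun xi x => gau 1 x * cos (xi * x))
  (fun xi x => - x * gau 1 x * sin (xi * x)) (fun x => C * jap 2 x)).
- move=> t; apply: (@integrable_dom _ C).
    by apply: mfM => //; apply: mfcos; mf.
  move=> x; rewrite normrM ger0_norm ?gau_ge0//; apply: le_trans (HC x).
  rewrite expr1 -[leRHS]mulrC; apply: ler_pM => //; rewrite ?gau_ge0//.
  by apply: le_trans (normr_cos_le1 _) _; rewrite lerDl.
- move=> t x; have := is_derive_mul (is_derive_constl (gau 1 x) t) (is_derive_cos_scale x t).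
  rewrite mul0r add0r mulrA [gau 1 x * _]mulrC.
  under [X in is_derive _ _ X]eq_fun do rewrite [x * _]mulrC.
  by rewrite [x * t]mulrC.
- move=> t x _; rewrite !normrM normrN (ger0_norm (gau_ge0 _ _)).
  apply: le_trans (HC x); rewrite expr1.
  apply: le_trans (_ : `|x| * gau 1 x <= _).
    by rewrite ler_piMr ?mulr_ge0 ?gau_ge0// normr_sin_le1.
  by rewrite ler_wpM2r ?gau_ge0// lerDr.
- apply: (@integrable_dom _ C); first by mf.
  by move=> x; rewrite ger0_norm// !mulr_ge0 ?jap_ge0.
Qed.

Lemma Phi0 : Phi 0 = Num.sqrt (pi *+ 2).
Proof.
rewrite /Phi.
have E x : gau 1 x * cos (0 * x) = gauss_fun ((Num.sqrt 2)^-1 * x + 0).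
  rewrite mul0r cos0 mulr1 addr0 /gau /gauss_fun mul1r exprMn exprVn sqr_sqrtr//.
  by rewrite mulrC.
have s2 : (Num.sqrt 2)^-1 != 0 :> R by rewrite invr_eq0 gt_eqF// sqrtr_gt0.
have -> : Rintegral leb [set: RR] (fun x : RR => gau 1 x * cos (0 * x)) =
    Rintegral leb [set: RR] (fun x : RR => gauss_fun ((Num.sqrt 2)^-1 * x + 0)).
  by apply: eq_Rintegral => x _; exact: E.
rewrite (Rintegral_affine 0 s2 (f := gauss_fun)); last exact: integrableT_gauss.
rewrite /Rintegral integralT_gauss /= ger0_norm ?invr_ge0 ?sqrtr_ge0// invrK.
by rewrite -sqrtrM// mulr_natl.
Qed.

(** By [Phi_derive] the product of Phi with exp (xi^2 / 2) has derivative 0, so it keeps its value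
    at 0. *)
Lemma gauss_cos (xi : R) : Phi xi = Num.sqrt (pi *+ 2) * gau 1 xi.
Proof.
pose Q (x : R) := Phi x * expR (x ^+ 2 / 2).
have HQ (x : R) : is_derive x 1 Q 0.
  have H : is_derive x 1 (fun y : R => y ^+ 2 / 2) x.
    have := is_derive_mul (is_derive_affine 2^-1 0 x) (is_derive_affine 1 0 x).
    have -> : (fun y : R => (2^-1 * y + 0) * (1 * y + 0)) = (fun y => y ^+ 2 / 2).
      by apply/funext => y; ring.
    by have -> : 2^-1 * (1 * x + 0) + (2^-1 * x + 0) * 1 = x by field.
  have := is_derive_mul (Phi_derive x) (@is_derive1_comp R expR (fun y : R => y ^+ 2 / 2) x _ _ (is_derive_expR _) H).
  by have -> : - x * Phi x * expR (x ^+ 2 / 2) + Phi x * (expR (x ^+ 2 / 2) * x) = 0 by ring.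
have := is_derive_0_is_cst xi 0 HQ.
rewrite /Q Phi0 expr0n/= mul0r expR0 mulr1 => <-.
rewrite /gau mul1r -mulrA -expRD subrr expR0 mulr1.
by [].
Qed.

Lemma gauss_sin (xi : R) : Rintegral leb [set: RR] (fun x => gau 1 x * sin (xi * x)) = 0.
Proof.
have [C [C0 HC]] := gau_jap 1 (ltr01 : 0 < 1 :> R).
have mg := measurable_gau 1.
have iF : leb.-integrable [set: RR] (fun x => (gau 1 x * sin (xi * x))%:E).
  apply: (@integrable_dom _ C); first by apply: mfM => //; apply: mfsin; mf.
  move=> x; rewrite normrM ger0_norm ?gau_ge0//; apply: le_trans (HC x).
  rewrite expr1 -[leRHS]mulrC; apply: ler_pM => //; rewrite ?gau_ge0//.
  by apply: le_trans (normr_sin_le1 _) _; rewrite lerDl.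
have N1 : -1 != 0 :> R by rewrite oppr_eq0 oner_eq0.
have := Rintegral_affine 0 N1 (f := fun x => gau 1 x * sin (xi * x)) iF.
rewrite normrN normr1 invr1 mul1r.
set I := Rintegral leb [set: RR] (fun x : RR => gau 1 x * sin (xi * x)) => H.
have : Rintegral leb [set: RR]
   (fun x : RR => gau 1 (-1 * x + 0) * sin (xi * (-1 * x + 0))) = -1 * I.
  rewrite -RintegralZl//; apply: eq_Rintegral => x _.
  have gE : gau 1 (- x) = gau 1 x by rewrite /gau mulrN sqrrN.
  by rewrite addr0 !mulN1r gE mulrN sinN mulrN.
by rewrite H; lra.
Qed.

End gauss.

(** * Fourier transforms of wave packets *)

Section atom_fourier.
Context {R : realType}.
Notation RR := (measurableTypeR R).
Local Notation leb := (@lebesgue_measure R).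

Lemma gau_jap0 t : 0 < t -> exists C : R, 0 <= C /\ forall x, gau t x <= C * jap 2 x.
Proof.
move=> t0; have [C [C0 HC]] := gau_jap 0 t0; exists C; split => // x.
by have := HC x; rewrite expr0 mul1r.
Qed.

Lemma cintble_gau_cis (t k : R) : 0 < t -> cintble leb (fun x : RR => (gau t x)%:C * cis (k * x)).
Proof.
move=> t0; have mg := measurable_gau t; have [C [C0 HC]] := gau_jap0 t0.
apply: (@cintble_le _ RR R leb _ (fun x => C * jap 2 x)); first by cmf.
  by move=> x; rewrite normcM' normcR normc_cis mulr1 ger0_norm ?gau_ge0.
exact: integrable_jap2.
Qed.

Lemma gauss_fourier (xi : R) :
  cint leb (fun x : RR => (gau 1 x)%:C * cis (xi * x)) =
  (Num.sqrt (pi *+ 2) * gau 1 xi)%:C.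
Proof.
apply: complexP => /=.
  rewrite -gauss_cos; apply: eq_Rintegral => x _.
  by rewrite mul0r subr0.
rewrite -[RHS](gauss_sin xi); apply: eq_Rintegral => x _.
by rewrite mul0r addr0.
Qed.

(** The packet of inverse width t at position q and frequency w. The phase is centred at q too, so
    that packets of one frequency are translates of each other. *)
Definition atom1 (t q w x : R) : R[i] := (gau t (x - q))%:C * cis (w * (x - q)).

Lemma normc_atom1 t q w x : normc (atom1 t q w x) = gau t (x - q).
Proof. by rewrite normcM' normcR normc_cis mulr1 ger0_norm ?gau_ge0. Qed.

Lemma cmeas_atom1 t q w : cmeas (atom1 t q w : RR -> R[i]).
Proof. by rewrite /atom1; have mg := measurable_gau t; cmf. Qed.

(** The substitution of t (x - q) for x leads to the standard Gaussian at frequency (w - p) / t. *)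
Lemma atom1_fourier (t q w p : R) : 0 < t ->
  cint leb (fun x : RR => atom1 t q w x * cis (- (x * p))) =
  cis (- (q * p)) * (Num.sqrt (pi *+ 2) / t * gau t^-1 (p - w))%:C.
Proof.
move=> t0; pose xi := (w - p) / t.
have tn0 : t != 0 by rewrite gt_eqF.
pose f x := (gau 1 x)%:C * cis (xi * x).
have fi : cintble leb (f : RR -> R[i]) by exact: (cintble_gau_cis xi (ltr01 : 0 < 1 :> R)).
have E x : atom1 t q w x * cis (- (x * p)) = cis (- (q * p)) * f (t * x + (- (t * q))).
  rewrite /atom1 /f gau_scale.
  have -> : t * x + - (t * q) = t * (x - q) by ring.
  rewrite mulrCA -mulrA; congr (_ * _); rewrite -!cisD; congr cis.
  by rewrite /xi; field.
transitivity (cint leb (fun x : RR => cis (- (q * p)) * f (t * x + (- (t * q))))).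
  by apply: eq_cint => x; exact: E.
have [i1 i2] := fi.
rewrite cintZ; last by split; [exact: (integrable_affine _ tn0 i1)|exact: (integrable_affine _ tn0 i2)].
rewrite (cint_affine _ tn0 fi) /f gauss_fourier gtr0_norm//.
rewrite -rmorphM /=; congr (_ * _%:C).
have -> : gau t^-1 (p - w) = gau 1 xi.
  by rewrite /gau /xi; congr (expR (- (_ / 2))); field.
by rewrite mulrA [_ / t]mulrC.
Qed.

Lemma cintble_atom1 t q w (p : R) : 0 < t ->
  exists A : R -> R, [/\ forall x, 0 <= A x, measurable_fun [set: RR] A,
    (\int[leb]_x (A x)%:E < +oo)%E &
    forall x, normc (atom1 t q w x * cis (- (x * p))) <= A x].
Proof.
move=> t0; have [C [C0 HC]] := gau_jap0 t0.
exists (fun x => C * jap 2 (1 * x - q)); split.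
- by move=> x; rewrite mulr_ge0 ?jap_ge0.
- by mf.
- rewrite (ge0_integral_affine (- q) (f := fun x => (C * jap 2 x)%:E))//.
  + by apply: lte_mul_pinfty; rewrite ?lee_fin ?invr_ge0// integrable_jap2.
  + by mf.
  + by move=> x; rewrite lee_fin mulr_ge0 ?jap_ge0.
- by move=> x; rewrite normcM' normc_atom1 normc_cis mulr1 mul1r.
Qed.

Definition atom (t : R) (q w z : R * R) : R[i] := atom1 t q.1 w.1 z.1 * atom1 t q.2 w.2 z.2.

Lemma fourier_atom (t : R) (q w p : R * R) : 0 < t ->
  fourier_transform (atom t q w) p =
  cis (- (q.1 * p.1 + q.2 * p.2)) *
  (pi *+ 2 / t ^+ 2 * (gau t^-1 (p.1 - w.1) * gau t^-1 (p.2 - w.2)))%:C.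
Proof.
move=> t0.
have [A [A0 mA iA HA]] := cintble_atom1 q.1 w.1 p.1 t0.
have [B [B0 mB iB HB]] := cintble_atom1 q.2 w.2 p.2 t0.
pose f1 x := atom1 t q.1 w.1 x * cis (- (x * p.1)).
pose f2 x := atom1 t q.2 w.2 x * cis (- (x * p.2)).
have mf1 : cmeas (f1 : RR -> R[i]).
  by rewrite /f1; have ma := cmeas_atom1 t q.1 w.1; cmf.
have mf2 : cmeas (f2 : RR -> R[i]).
  by rewrite /f2; have ma := cmeas_atom1 t q.2 w.2; cmf.
pose F (z : RR * RR) := f1 z.1 * f2 z.2.
have mF : cmeas F by rewrite /F; cmf.
have FAB x y : normc (F (x, y)) <= A x * B y.
  by rewrite normcM'; apply: ler_pM; rewrite ?normc_ge0//; [exact: HA|exact: HB].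
have -> : fourier_transform (atom t q w) p = cint (leb \x leb)%E F.
  rewrite /fourier_transform -[cintegral _]/(cint (leb \x leb)%E _); apply: eq_cint => z.
  rewrite /F /f1 /f2 /atom [RHS]mulrACA -cisD -opprD cisN; congr (_ * _).
rewrite -(cint_fubini1 mA mB A0 B0 iA iB mF FAB) /F /=.
have i2 : cintble leb (f2 : RR -> R[i]).
  exact: (cintble_le mf2 HB iB).
have i1 : cintble leb (f1 : RR -> R[i]).
  exact: (cintble_le mf1 HA iA).
transitivity (cint leb (fun x : RR => cint leb (f2 : RR -> R[i]) * f1 x)).
  by apply: eq_cint => x; rewrite cintZ// mulrC.
rewrite cintZ// /f1 /f2 !atom1_fourier//.
rewrite mulrC mulrACA -cisD -opprD; congr (_ * _).
rewrite -rmorphM /=; congr (_%:C).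
have s2 : Num.sqrt (pi *+ 2) ^+ 2 = pi *+ 2 :> R.
  by rewrite sqr_sqrtr// mulrn_wge0// pi_ge0.
rewrite mulrACA; congr (_ * _).
by rewrite -{3}s2; field; rewrite gt_eqF.
Qed.

End atom_fourier.

(** * Wave packets are Schwartz functions *)

Section tensor_schwartz.
Context {R : realType}.

(** Componentwise, to match [partial], which differentiates real and imaginary parts separately. *)
Definition cderive (A : R -> R[i]) (x : R) (d : R[i]) :=
  is_derive x 1 (fun y : R => complex.Re (A y)) (complex.Re d) /\
  is_derive x 1 (fun y : R => complex.Im (A y)) (complex.Im d).

Lemma cderive_mulr (A : R -> R[i]) x d (c : R[i]) : cderive A x d ->
  cderive (fun y => A y * c) x (d * c).
Proof.
move=> [d1 d2]; split.
  have -> : (fun y => complex.Re (A y * c)) = (fun y => complex.Re (A y) * complex.Re c +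
      complex.Im (A y) * (- complex.Im c)).
    by apply/funext => y; rewrite cReM mulrN.
  have H1 := is_derive_mul d1 (is_derive_constl (complex.Re c) x).
  have H2 := is_derive_mul d2 (is_derive_constl (- complex.Im c) x).
  by have := is_derive_add H1 H2; rewrite !mulr0 !addr0 cReM !mulrN.
have -> : (fun y => complex.Im (A y * c)) = (fun y => complex.Re (A y) * complex.Im c +
    complex.Im (A y) * complex.Re c).
  by apply/funext => y; rewrite cImM.
have H1 := is_derive_mul d1 (is_derive_constl (complex.Im c) x).
have H2 := is_derive_mul d2 (is_derive_constl (complex.Re c) x).
by have := is_derive_add H1 H2; rewrite !mulr0 !addr0 cImM.
Qed.

Lemma partial_tensor_fst (A A' B : R -> R[i]) : (forall x, cderive A x (A' x)) ->
  partial_derivable true (fun z => A z.1 * B z.2) /\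
  partial true (fun z => A z.1 * B z.2) = (fun z => A' z.1 * B z.2).
Proof.
move=> AA'; split.
  by move=> [x y]; have [[H1 _] [H2 _]] := cderive_mulr (B y) (AA' x).
apply/funext => -[x y]; have [H1 H2] := cderive_mulr (B y) (AA' x).
rewrite /partial /slice /coordinate /= !derive1E; apply: complexP => /=.
  by have [_ ->] := H1.
by have [_ ->] := H2.
Qed.

Lemma partial_tensor_snd (A B B' : R -> R[i]) : (forall x, cderive B x (B' x)) ->
  partial_derivable false (fun z => A z.1 * B z.2) /\
  partial false (fun z => A z.1 * B z.2) = (fun z => A z.1 * B' z.2).
Proof.
move=> BB'.
have H x y : cderive (fun s => A x * B s) y (A x * B' y).
  have -> : (fun s => A x * B s) = (fun s => B s * A x) by apply/funext => s; rewrite mulrC.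
  by rewrite mulrC; exact: cderive_mulr.
split; first by move=> [x y]; have [[H1 _] [H2 _]] := H x y.
apply/funext => -[x y]; have [H1 H2] := H x y.
rewrite /partial /slice /coordinate /= !derive1E; apply: complexP => /=.
  by have [_ ->] := H1.
by have [_ ->] := H2.
Qed.

(** [D] and [E] list the successive derivatives of the two factors. Any word of partial derivatives
    then yields D k times E l, with k and l counting its letters, and decay is needed only for
    these. *)
Lemma schwartz_tensor (D E : nat -> R -> R[i]) :
  (forall n x, cderive (D n) x (D n.+1 x)) -> (forall n x, cderive (E n) x (E n.+1 x)) ->
  (forall n m, exists M, forall x, `|x| ^+ m * normc (D n x) <= M) ->
  (forall n m, exists M, forall x, `|x| ^+ m * normc (E n x) <= M) ->
  schwartz (fun z => D 0%N z.1 * E 0%N z.2).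
Proof.
move=> dD dE bD bE.
have iter w : exists k l, iter_partial w (fun z => D 0%N z.1 * E 0%N z.2) =
    (fun z => D k z.1 * E l z.2).
  elim: w => [|[] w [k [l IH]]]; first by exists 0%N, 0%N.
    by exists k.+1, l; rewrite /= IH; have [_ ->] := partial_tensor_fst (E l) (dD k).
  by exists k, l.+1; rewrite /= IH; have [_ ->] := partial_tensor_snd (D k) (dE l).
split.
  move=> w i; have [k [l ->]] := iter w; case: i.
    by have [] := partial_tensor_fst (E l) (dD k).
  by have [] := partial_tensor_snd (D k) (dE l).
move=> w m n; have [k [l ->]] := iter w.
have [M1 H1] := bD k m; have [M2 H2] := bE l n.
exists (M1 * M2) => p; rewrite normcM' mulrACA.
by apply: ler_pM; rewrite ?mulr_ge0 ?exprn_ge0 ?normc_ge0.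
Qed.

End tensor_schwartz.

Section atom_schwartz.
Context {R : realType}.

Lemma poly_bound (p : {poly R}) : exists C k, 0 <= C /\
  forall x, `|p.[x]| <= C * (1 + `|x|) ^+ k.
Proof.
elim/poly_ind: p => [|p c [C [k [C0 HC]]]].
  by exists 0, 0%N; split => // x; rewrite horner0 normr0 mul0r.
exists (C + `|c|), k.+1; split => [|x]; first by rewrite addr_ge0.
rewrite hornerMXaddC; apply: le_trans (ler_normD _ _) _.
rewrite mulrDl; apply: lerD.
  rewrite normrM exprSr mulrA; apply: ler_pM => //.
  by rewrite lerDr.
by rewrite ler_peMr// exprn_ege1// onenorm_ge1.
Qed.

(** The effect of d/dx on the factor P + iQ of (P + iQ) exp (- t^2 x^2 / 2 + i w x), for real
    polynomials P and Q. Its iterates from (1, 0) give the derivatives of a packet, in the variable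
    x - q. *)
Definition hermite (t w : R) (PQ : {poly R} * {poly R}) : {poly R} * {poly R} :=
  (PQ.1^`() - (t ^+ 2)%:P * ('X * PQ.1) - w%:P * PQ.2,
   PQ.2^`() - (t ^+ 2)%:P * ('X * PQ.2) + w%:P * PQ.1).

Definition atomn (t q w : R) (n : nat) (x : R) : R[i] :=
  let PQ := iter n (hermite t w) (1, 0) in
  (PQ.1.[x - q] +i* PQ.2.[x - q]) * atom1 t q w x.

Lemma atomn0 t q w : atomn t q w 0 = atom1 t q w.
Proof. by apply/funext => x; rewrite /atomn /= hornerC horner0 -[_ +i* _]/(1 : R[i]) mul1r. Qed.

Lemma is_derive_shift (f : R -> R) (q x d : R) : is_derive (x - q) 1 f d ->
  is_derive x 1 (fun y : R => f (y - q)) d.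
Proof.
move=> df; have df' : is_derive (1 * x + (- q)) 1 f d by rewrite mul1r.
have -> : (fun y : R => f (y - q)) = f \o (fun y => 1 * y + (- q)).
  by apply/funext => y /=; rewrite mul1r.
have := @is_derive1_comp R f (fun y => 1 * y + (- q)) x d 1 df' (is_derive_affine 1 (- q) x).
by rewrite mulr1.
Qed.

Lemma is_derive_gau (t x : R) : is_derive x 1 (gau t) (- (t ^+ 2 * x) * gau t x).
Proof.
have H := @is_derive1_comp R (gau 1) (fun y => t * y + 0) x _ _ (is_derive_gau1 _) (is_derive_affine t 0 x).
have E : gau t = gau 1 \o (fun y => t * y + 0).
  by apply/funext => y; rewrite /= addr0 -gau_scale.
rewrite [X in is_derive _ _ X]E; apply: (is_derive_eq H).
by rewrite [in LHS]addr0 -gau_scale; ring.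
Qed.

Lemma cderive_atomn t q w n x : cderive (atomn t q w n) x (atomn t q w n.+1 x).
Proof.
rewrite /atomn iterS; case: (iter n (hermite t w) (1, 0)) => P Q /=.
set y := x - q.
have dP := is_derive_shift (is_derive_poly P (x - q)).
have dQ := is_derive_shift (is_derive_poly Q (x - q)).
have dg := is_derive_shift (is_derive_gau t (x - q)).
have dc := is_derive_shift (is_derive_cos_scale w (x - q)).
have ds := is_derive_shift (is_derive_sin_scale w (x - q)).
pose F z := (P.[z - q] +i* Q.[z - q]) * atom1 t q w z.
have EF z : F z = (P.[z - q] * (gau t (z - q) * cos (w * (z - q))) +
     (Q.[z - q] * -1) * (gau t (z - q) * sin (w * (z - q)))) +i*
    (P.[z - q] * (gau t (z - q) * sin (w * (z - q))) +
     Q.[z - q] * (gau t (z - q) * cos (w * (z - q)))).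
  by apply: complexP; rewrite /F /atom1 ?cReM ?cImM /= ?cReM ?cImM /=; ring.
have -> : (fun x0 => (P.[x0 - q] +i* Q.[x0 - q]) * atom1 t q w x0) = F by [].
split.
  have -> : (fun z => complex.Re (F z)) = (fun z => P.[z - q] * (gau t (z - q) * cos (w * (z - q))) +
     (Q.[z - q] * -1) * (gau t (z - q) * sin (w * (z - q)))).
    by apply/funext => z; rewrite EF.
  have H1 := is_derive_mul dP (is_derive_mul dg dc).
  have H2 := is_derive_mul (is_derive_mul dQ (is_derive_constl (-1) x)) (is_derive_mul dg ds).
  apply: (is_derive_eq (is_derive_add H1 H2)).
  by rewrite cReM /atom1 cReM cImM /= !hornerE /= /y; ring.
have -> : (fun z => complex.Im (F z)) = (fun z => P.[z - q] * (gau t (z - q) * sin (w * (z - q))) +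
     Q.[z - q] * (gau t (z - q) * cos (w * (z - q)))).
  by apply/funext => z; rewrite EF.
have H1 := is_derive_mul dP (is_derive_mul dg ds).
have H2 := is_derive_mul dQ (is_derive_mul dg dc).
apply: (is_derive_eq (is_derive_add H1 H2)).
by rewrite cImM /atom1 cReM cImM /= !hornerE /= /y; ring.
Qed.

(** Powers of |x| are at most (1 + |q|)^m times powers of 1 + |x - q|, so all polynomial growth is
    measured from the centre, where the Gaussian dominates it. *)
Lemma atomn_decay t q w n m : 0 < t ->
  exists M, forall x, `|x| ^+ m * normc (atomn t q w n x) <= M.
Proof.
move=> t0; case EPQ : (iter n (hermite t w) (1, 0)) => [P Q].
have EA x : atomn t q w n x = (P.[x - q] +i* Q.[x - q]) * atom1 t q w x.
  by rewrite /atomn EPQ.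
have [C1 [k1 [C10 H1]]] := poly_bound P.
have [C2 [k2 [C20 H2]]] := poly_bound Q.
have c0 : 0 < t ^+ 2 / 2 by rewrite divr_gt0// exprn_gt0.
have [G1 [G10 HG1]] := gauss_poly_bound (m + k1) c0.
have [G2 [G20 HG2]] := gauss_poly_bound (m + k2) c0.
pose K := (1 + `|q|) ^+ m.
have K0 : 0 <= K by rewrite exprn_ge0// addr_ge0.
exists (K * (C1 * G1 + C2 * G2)) => x; rewrite EA normcM' normc_atom1.
set y := x - q.
have gE : gau t y = expR (- (t ^+ 2 / 2 * y ^+ 2)).
  by rewrite /gau; congr (expR (- _)); field.
have xm : `|x| ^+ m <= K * (1 + `|y|) ^+ m.
  rewrite -exprMn; apply: lerXn2r; rewrite ?nnegrE ?mulr_ge0 ?addr_ge0//.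
  have := ler_normD y q; rewrite /y subrK => H.
  by have := mulr_ge0 (normr_ge0 q) (normr_ge0 (x - q)); lra.
have nPQ : normc (P.[y] +i* Q.[y]) <= C1 * (1 + `|y|) ^+ k1 + C2 * (1 + `|y|) ^+ k2.
  apply: le_trans (_ : `|P.[y]| + `|Q.[y]| <= _); last by rewrite lerD.
  rewrite -(@ler_pXn2r _ 2)// ?nnegrE ?normc_ge0 ?addr_ge0//.
  rewrite normc_sqr sqrrD !real_normK ?num_real//= [leRHS]addrAC lerDl.
  by rewrite mulrn_wge0 ?mulr_ge0.
have a0 := normc_ge0 (P.[y] +i* Q.[y]).
have e0 : 0 <= (1 + `|y|) ^+ m by rewrite exprn_ge0// addr_ge0.
apply: le_trans (_ : (K * (1 + `|y|) ^+ m) * ((C1 * (1 + `|y|) ^+ k1 + C2 * (1 + `|y|) ^+ k2) * gau t y) <= _).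
  apply: ler_pM => //; rewrite ?exprn_ge0 ?mulr_ge0 ?gau_ge0//.
  by apply: ler_wpM2r => //; exact: gau_ge0.
have -> : K * (1 + `|y|) ^+ m * ((C1 * (1 + `|y|) ^+ k1 + C2 * (1 + `|y|) ^+ k2) * gau t y) =
  K * (C1 * ((1 + `|y|) ^+ (m + k1) * gau t y) + C2 * ((1 + `|y|) ^+ (m + k2) * gau t y)).
  by rewrite !exprD; ring.
by apply: ler_wpM2l => //; apply: lerD; apply: ler_wpM2l => //; rewrite gE.
Qed.

Lemma schwartz_atom (t : R) (q w : R * R) : 0 < t -> schwartz (atom t q w).
Proof.
move=> t0.
have := @schwartz_tensor R (atomn t q.1 w.1) (atomn t q.2 w.2).
rewrite !atomn0; apply.
- by move=> n x; exact: cderive_atomn.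
- by move=> n x; exact: cderive_atomn.
- by move=> n m; exact: atomn_decay.
- by move=> n m; exact: atomn_decay.
Qed.

End atom_schwartz.

(** * Square integrable functions on the plane *)

Section param_measurable.
Context d1 d2 (T1 : measurableType d1) (T2 : measurableType d2) {R : realType}.
Variable m2 : {sigma_finite_measure set T2 -> \bar R}.

Lemma measurable_param_Rintegral (f : T1 * T2 -> R) :
  measurable_fun [set: T1 * T2] f ->
  measurable_fun [set: T1] (fun x => Rintegral m2 [set: T2] (fun y => f (x, y))).
Proof.
move=> mf_; have mf' : measurable_fun [set: T1 * T2] (fun z => (f z)%:E) by cmf.
have H : measurable_fun [set: T1] (fun x => (\int[m2]_y (f (x, y))%:E)%E).
  have -> : (fun x => (\int[m2]_y (f (x, y))%:E)%E) = (fun x =>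
      (fubini_F m2 (fun z => (f z)%:E)^\+ x - fubini_F m2 (fun z => (f z)%:E)^\- x)%E).
    apply/funext => x; rewrite integralE /fubini_F.
    by congr (_ - _)%E; apply: eq_integral => y _; rewrite ?funeposE ?funenegE.
  apply: emeasurable_funB; apply: measurable_fun_fubini_tonelli_F.
  - exact: measurable_funepos.
  - exact: funepos_ge0.
  - exact: measurable_funeneg.
  - exact: funeneg_ge0.
exact: (measurableT_comp (fine_measurable measurableT) H).
Qed.

Lemma cmeas_param_cint (f : T1 * T2 -> R[i]) : cmeas f ->
  cmeas (fun x => cint m2 (fun y => f (x, y))).
Proof.
move=> [f1 f2]; split => /=.
  exact: (measurable_param_Rintegral f1).
exact: (measurable_param_Rintegral f2).
Qed.

End param_measurable.

Section plane_tools.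
Context {R : realType}.
Notation RR := (measurableTypeR R).
Local Notation leb := (@lebesgue_measure R).
Implicit Types u v : RR * RR -> R[i].

Lemma plane_integral_affine (k a1 a2 : R) (f : RR * RR -> R) : k != 0 ->
  plane.-integrable [set: (RR * RR)%type] (fun z => (f z)%:E) ->
  (\int[plane]_z (f (k * z.1 + a1, k * z.2 + a2)%R)%:E =
   (`|k|^-1 ^+ 2)%:E * \int[plane]_z (f z)%:E)%E.
Proof.
move=> k0 fi; have /integrableP[mf_ _] := fi.
rewrite integralE [in RHS]integralE.
have -> : (\int[plane]_z (fun z : RR * RR => (f (k * z.1 + a1, k * z.2 + a2)%R)%:E)^\+ z =
    (`|k|^-1 ^+ 2)%:E * \int[plane]_z (fun z => (f z)%:E)^\+ z)%E.
  rewrite -(plane_affine a1 a2 k0 (measurable_funepos mf_) (funepos_ge0 _)).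
  by apply: eq_integral => x _; rewrite !funeposE.
have -> : (\int[plane]_z (fun z : RR * RR => (f (k * z.1 + a1, k * z.2 + a2)%R)%:E)^\- z =
    (`|k|^-1 ^+ 2)%:E * \int[plane]_z (fun z => (f z)%:E)^\- z)%E.
  rewrite -(plane_affine a1 a2 k0 (measurable_funeneg mf_) (funeneg_ge0 _)).
  by apply: eq_integral => x _; rewrite !funenegE.
have := integrable_neg_fin_num measurableT fi.
move: (\int[plane]_x (fun z => (f z)%:E)^\- x)%E (\int[plane]_x (fun z => (f z)%:E)^\+ x)%E => N P Nf.
by rewrite muleBr// fin_num_adde_defl// fin_numN.
Qed.

Lemma plane_cint_affine (k a1 a2 : R) u : k != 0 -> cintble plane u ->
  cint plane (fun z => u (k * z.1 + a1, k * z.2 + a2)) = (`|k|^-1 ^+ 2)%:C * cint plane u.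
Proof.
move=> k0 [i1 i2]; rewrite realcM /cint /Rintegral.
rewrite (plane_integral_affine a1 a2 k0 i1) (plane_integral_affine a1 a2 k0 i2).
by rewrite !fineM ?(integrable_fin_num measurableT).
Qed.

Definition G2 (t : R) (z : RR * RR) : R := gau t z.1 * gau t z.2.

Lemma G2_ge0 t z : 0 <= G2 t z.
Proof. by rewrite mulr_ge0 ?gau_ge0. Qed.

Lemma G2_le1 t z : G2 t z <= 1.
Proof. by rewrite -[leRHS]mulr1 ler_pM ?gau_ge0 ?gau_le1. Qed.

Lemma measurable_G2 t : measurable_fun [set: (RR * RR)%type] (G2 t).
Proof. by rewrite /G2; have mg := measurable_gau t; mf. Qed.

Lemma integral_G2_lty t : 0 < t -> (\int[plane]_z (G2 t z)%:E < +oo)%E.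
Proof.
move=> t0; have [C [C0 HC]] := gau_jap0 t0; have mg := measurable_gau t.
have i1 : (\int[leb]_x (gau t x)%:E < +oo)%E.
  apply: le_lt_trans (integrable_jap2 C0); apply: le_integralT => x.
    by rewrite lee_fin gau_ge0.
  by rewrite lee_fin.
exact: (integral_prod_bound mg mg (gau_ge0 t) (gau_ge0 t) i1 i1).
Qed.

Lemma integral_gau1 : (\int[leb]_x (gau 1 x)%:E = (Num.sqrt (pi *+ 2))%:E)%E.
Proof.
have [C [C0 HC]] := gau_jap0 (ltr01 : 0 < 1 :> R); have mg := measurable_gau (1 : R).
have i : leb.-integrable [set: RR] (fun x => (gau 1 x)%:E).
  apply: (@integrable_dom _ _ C) => // x; rewrite ger0_norm ?gau_ge0//.
rewrite -[LHS](fineK (integrable_fin_num measurableT i)); congr EFin.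
have := gauss_cos (0 : R); rewrite /gau mulr0 expr0n/= mul0r oppr0 expR0 mulr1 => <-.
by apply: eq_Rintegral => x _; rewrite mul0r cos0 mulr1.
Qed.

Lemma integral_G2 : (\int[plane]_z (G2 1 z)%:E = (pi *+ 2)%:E)%E.
Proof.
have mg := measurable_gau (1 : R).
rewrite plane_tonelli; last 2 first.
- by apply: mfE; exact: measurable_G2.
- by move=> z; rewrite lee_fin G2_ge0.
rewrite /G2 /=; under eq_integral => x _.
  rewrite ge0_integralZE ?gau_ge0//; last by move=> y; exact: gau_ge0.
  rewrite integral_gau1 muleC -EFinM; over.
rewrite ge0_integralZE ?sqrtr_ge0//; last by move=> y; exact: gau_ge0.
by rewrite integral_gau1 -EFinM -expr2 sqr_sqrtr// mulrn_wge0// pi_ge0.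
Qed.

Definition L2 u := cmeas u /\ (\int[plane]_z (normc (u z) ^+ 2)%:E < +oo)%E.

Lemma amgm (x y : R) : x * y <= 2^-1 * (x ^+ 2 + y ^+ 2).
Proof. by have := sqr_ge0 (x - y); rewrite !expr2; lra. Qed.

Lemma L2_product u v : L2 u -> L2 v -> (\int[plane]_z (normc (u z) * normc (v z))%:E < +oo)%E.
Proof.
move=> [mu_ u2] [mv v2].
have n1 := mf_normc mu_; have n2 := mf_normc mv.
apply: (@le_lt_trans _ _ (\int[plane]_z (2^-1 * (normc (u z) ^+ 2 + normc (v z) ^+ 2))%:E)%E).
  apply: le_integralT => z; first by rewrite lee_fin mulr_ge0 ?normc_ge0.
  by rewrite lee_fin amgm.
rewrite ge0_integralZE; [|by []|by move=> z; rewrite addr_ge0 ?sqr_ge0|by cmf].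
rewrite ge0_integralDE; [|by move=> z; rewrite sqr_ge0|by move=> z; rewrite sqr_ge0|by cmf|by cmf].
by apply: lte_mul_pinfty => //; exact: lte_add_pinfty.
Qed.

Lemma L2_le u v : L2 v -> cmeas u -> (forall z, normc (u z) <= normc (v z)) -> L2 u.
Proof.
move=> [mv v2] mu_ uv; split => //; apply: le_lt_trans v2; apply: le_integralT => z.
  by rewrite lee_fin sqr_ge0.
by rewrite lee_fin lerXn2r ?nnegrE ?normc_ge0.
Qed.

Lemma L2_affine (k a1 a2 : R) u : k != 0 -> L2 u ->
  L2 (fun z => u (k * z.1 + a1, k * z.2 + a2)).
Proof.
move=> k0 [mu_ u2]; split; first by cmf.
have n1 := mf_normc mu_.
rewrite (plane_affine a1 a2 (f := fun z => (normc (u z) ^+ 2)%:E) k0); last 2 first.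
- by cmf.
- by move=> z; rewrite lee_fin sqr_ge0.
by apply: lte_mul_pinfty => //; rewrite lee_fin sqr_ge0.
Qed.

Lemma L2_shift (a1 a2 : R) u : L2 u -> L2 (fun z => u (z.1 + a1, z.2 + a2)).
Proof.
move=> /(L2_affine a1 a2 (oner_neq0 R)).
by under [X in L2 X -> _]eq_fun do rewrite !mul1r.
Qed.

Lemma L2_G2 t : 0 < t -> L2 (fun z => (G2 t z)%:C).
Proof.
move=> t0; split; first by apply: cmeasR; exact: measurable_G2.
apply: le_lt_trans (integral_G2_lty t0); apply: le_integralT => z.
  by rewrite lee_fin sqr_ge0.
rewrite lee_fin normcR ger0_norm ?G2_ge0// expr2 ler_piMr ?G2_ge0//.
exact: G2_le1.
Qed.

Lemma vanish_shiftC u (c1 c2 : R) : L2 u ->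
  vanish (fun n => \int[plane]_z
    (normc (u (z.1 + c1 * harmonic n, z.2 + c2 * harmonic n) - u z) ^+ 2)%:E)%E.
Proof.
move=> [mu_ u2]; have [m1 m2] := mu_.
have r2 : (\int[plane]_z (complex.Re (u z) ^+ 2)%:E < +oo)%E.
  apply: le_lt_trans u2; apply: le_integralT => z; rewrite lee_fin ?sqr_ge0//.
  by rewrite normc_sqr lerDl sqr_ge0.
have i2 : (\int[plane]_z (complex.Im (u z) ^+ 2)%:E < +oo)%E.
  apply: le_lt_trans u2; apply: le_integralT => z; rewrite lee_fin ?sqr_ge0//.
  by rewrite normc_sqr lerDr sqr_ge0.
apply: le_vanish (vanishD (vanish_shift2 c1 c2 m1 r2) (vanish_shift2 c1 c2 m2 i2)) => n.
rewrite -ge0_integralDE; [|by move=> z; rewrite sqr_ge0|by move=> z; rewrite sqr_ge0|by cmf|by cmf].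
apply: le_integralT => z; rewrite lee_fin ?sqr_ge0// normc_sqr.
by case: (u z) (u _) => [a b] [c d].
Qed.

(** Cauchy-Schwarz in the additive form with a parameter: a large k makes the second term small,
    after which the first is small for small shifts. *)
Lemma integral_corr_le u v (k : R) (s : RR * RR) : L2 u -> L2 v -> 0 < k ->
  (\int[plane]_y (normc (u (y.1 + s.1, y.2 + s.2) - u y) * normc (v y))%:E <=
   (k / 2)%:E * \int[plane]_y (normc (u (y.1 + s.1, y.2 + s.2) - u y) ^+ 2)%:E +
   (k^-1 / 2)%:E * \int[plane]_y (normc (v y) ^+ 2)%:E)%E.
Proof.
move=> [mu_ u2] [mv v2] k0.
have md : cmeas (fun y : RR * RR => u (y.1 + s.1, y.2 + s.2) - u y).
  by cmf.
have n1 := mf_normc md; have n2 := mf_normc mv.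
have k2 : 0 <= k / 2 by rewrite divr_ge0// ltW.
have kV2 : 0 <= k^-1 / 2 by rewrite divr_ge0// invr_ge0 ltW.
rewrite -ge0_integralZE//; [|by move=> z; rewrite sqr_ge0|by cmf].
rewrite -ge0_integralZE//; [|by move=> z; rewrite sqr_ge0|by cmf].
rewrite -ge0_integralDE; [|by move=> z; rewrite mulr_ge0 ?sqr_ge0|by move=> z; rewrite mulr_ge0 ?sqr_ge0|by cmf|by cmf].
apply: le_integralT => y; first by rewrite lee_fin mulr_ge0 ?normc_ge0.
rewrite lee_fin; set x := normc _; set w := normc _.
rewrite -(@ler_pM2l _ (2 * k)) ?mulr_gt0//.
have -> : 2 * k * (k / 2 * x ^+ 2 + k^-1 / 2 * w ^+ 2) = (k * x) ^+ 2 + w ^+ 2.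
  by field; rewrite gt_eqF.
have := sqr_ge0 (k * x - w); rewrite !expr2; lra.
Qed.

(** For each direction s the mean-square increment of u tends to 0. It never exceeds four times the
    squared norm of u, so the Gaussian in s supplies the majorant. *)
Lemma vanish_corr u v : L2 u -> L2 v ->
  vanish (fun n => \int[plane]_s ((G2 1 s)%:E * \int[plane]_y
    (normc (u (y.1 + s.1 * harmonic n, y.2 + s.2 * harmonic n) - u y) * normc (v y))%:E))%E.
Proof.
move=> Lu Lv; have [mu_ u2] := Lu; have [mv v2] := Lv.
have V0 : (0 <= \int[plane]_y (normc (v y) ^+ 2)%:E)%E.
  by apply: integral_ge0 => y _; rewrite lee_fin sqr_ge0.
have U0 : (0 <= \int[plane]_y (normc (u y) ^+ 2)%:E)%E.
  by apply: integral_ge0 => y _; rewrite lee_fin sqr_ge0.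
have Vfin : (\int[plane]_y (normc (v y) ^+ 2)%:E)%E \is a fin_num by rewrite ge0_fin_numE.
have Ufin : (\int[plane]_y (normc (u y) ^+ 2)%:E)%E \is a fin_num by rewrite ge0_fin_numE.
pose V := fine (\int[plane]_y (normc (v y) ^+ 2)%:E)%E.
have VR0 : 0 <= V by exact: fine_ge0.
pose U := fine (\int[plane]_y (normc (u y) ^+ 2)%:E)%E.
have UR0 : 0 <= U by exact: fine_ge0.
have mG := measurable_G2 1.
pose om n (s : RR * RR) := (\int[plane]_y
    (normc (u (y.1 + s.1 * harmonic n, y.2 + s.2 * harmonic n) - u y) ^+ 2)%:E)%E.
have om0 n s : (0 <= om n s)%E.
  by apply: integral_ge0 => y _; rewrite lee_fin sqr_ge0.
have mom n : measurable_fun [set: (RR * RR)%type] (om n).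
  pose W (p : (RR * RR) * (RR * RR)) := u (p.2.1 + p.1.1 * harmonic n, p.2.2 + p.1.2 * harmonic n) - u p.2.
  have mW : cmeas W by rewrite /W; cmf.
  have nW := mf_normc mW.
  apply: (measurable_fun_fubini_tonelli_F (m2 := plane) (fun p => (normc (W p) ^+ 2)%:E)).
    by cmf.
  by move=> p; rewrite lee_fin sqr_ge0.
have omU n s : (om n s <= (4 * U)%:E)%E.
  rewrite /om EFinM fineK//.
  have n1 := mf_normc mu_.
  apply: (@le_trans _ _ (\int[plane]_y (2 * (normc (u (y.1 + s.1 * harmonic n, y.2 + s.2 * harmonic n)) ^+ 2 +
     normc (u y) ^+ 2))%:E)%E).
    apply: le_integralT => y; first by rewrite lee_fin sqr_ge0.
    rewrite lee_fin; apply: le_trans (sqr_sum2 _ _).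
    rewrite lerXn2r ?nnegrE ?normc_ge0 ?addr_ge0 ?normc_ge0//.
    by rewrite -(normcN (u y)); exact: le_normcD.
  rewrite ge0_integralZE; [|by []|by move=> y; rewrite addr_ge0 ?sqr_ge0|by cmf].
  rewrite ge0_integralDE; [|by move=> y; rewrite sqr_ge0|by move=> y; rewrite sqr_ge0|by cmf|by cmf].
  rewrite (plane_shift _ _ (F := fun y => (normc (u y) ^+ 2)%:E)); last 2 first.
  - by cmf.
  - by move=> y; rewrite lee_fin sqr_ge0.
  move: U0; move: (\int[plane]_y (normc (u y) ^+ 2)%:E)%E => I I0.
  have -> : (4%:E = 2%:E + 2%:E :> \bar R)%E by rewrite -EFinD; congr EFin; ring.
  by rewrite ge0_muleDl// ge0_muleDr.
apply: vanish_approx => e e0.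
have pi2 : 0 < pi *+ 2 :> R by rewrite pmulrn_lgt0// pi_gt0.
(* The term without increments, integrated against the Gaussian of mass 2 pi, becomes e V / (2 (V +
   1)), below e; V + 1 keeps k positive when V = 0. *)
pose k := (pi *+ 2 * (V + 1)) / e.
have k0 : 0 < k by rewrite divr_gt0// mulr_gt0// ltr_wpDl.
exists (fun n => (k / 2)%:E * \int[plane]_s ((G2 1 s)%:E * om n s))%E.
  apply: vanishZ; first by rewrite divr_ge0// ltW.
  apply: (@vanish_integral _ _ _ plane (fun n s => (G2 1 s)%:E * om n s)%E (fun s => (4 * U * G2 1 s)%:E)).
  - by move=> n; apply: emeasurable_funM => //; mf.
  - by cmf.
  - by move=> n s; apply: mule_ge0 => //; rewrite lee_fin G2_ge0.
  - move=> n s; rewrite [(4 * U * _)%:E]EFinM muleC; apply: lee_wpmul2r => //.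
    by rewrite lee_fin G2_ge0.
  - rewrite ge0_integralZE ?mulr_ge0//; last by move=> z; exact: G2_ge0.
    by rewrite integral_G2 -EFinM ltry.
  - move=> s _; apply: (vanishZ (G2_ge0 1 s)).
    exact: (vanish_shiftC s.1 s.2 Lu).
move=> n; have k2 : 0 <= k / 2 by rewrite divr_ge0// ltW.
have GE s : (0 <= (G2 1 s)%:E)%E by rewrite lee_fin G2_ge0.
have mGo : measurable_fun [set: (RR * RR)%type] (fun s => (G2 1 s)%:E * om n s)%E.
  by apply: emeasurable_funM => //; mf.
rewrite -ge0_integralZl//; last by move=> s _; exact: mule_ge0.
apply: (@le_trans _ _ (\int[plane]_s ((k / 2)%:E * ((G2 1 s)%:E * om n s) +
   (k^-1 / 2 * V * G2 1 s)%:E))%E).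
  apply: le_integralT => s.
    apply: mule_ge0 => //; apply: integral_ge0 => y _.
    by rewrite lee_fin mulr_ge0 ?normc_ge0.
  have := integral_corr_le (s.1 * harmonic n, s.2 * harmonic n) Lu Lv k0.
  rewrite -/(om n s) -(fineK Vfin) -/V -EFinM => H.
  apply: (@le_trans _ _ ((G2 1 s)%:E * ((k / 2)%:E * om n s + (k^-1 / 2 * V)%:E))%E).
    exact: lee_wpmul2l.
  rewrite ge0_muleDr; last 2 first.
  - by apply: mule_ge0 => //; rewrite lee_fin.
  - by rewrite lee_fin !mulr_ge0// invr_ge0 ltW.
  by rewrite muleCA -EFinM [G2 1 s * _]mulrC.
have kV : 0 <= k^-1 / 2 * V by rewrite !mulr_ge0// invr_ge0 ltW.
rewrite ge0_integralD//; last 4 first.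
- by move=> s _; apply: mule_ge0; [rewrite lee_fin|exact: mule_ge0].
- exact: measurable_funeM.
- by move=> s _; rewrite lee_fin mulr_ge0 ?G2_ge0.
- by cmf.
rewrite leeD2l// ge0_integralZE//.
have V1 : 0 < V + 1 by rewrite ltr_wpDl.
rewrite integral_G2 -EFinM lee_fin /k.
move: (pi *+ 2 : R) pi2 => P P0.
have -> : ((P * (V + 1)) / e)^-1 / 2 * V * P = e * (V / (2 * (V + 1))).
  by field; rewrite !gt_eqF.
rewrite ler_piMr ?(ltW e0)// ler_pdivrMr ?mul1r; first by lra.
by rewrite mulr_gt0// ltr_wpDl.
Qed.

End plane_tools.

(** * Weak Fourier transforms and correlations *)

Section smoothing.
Context {R : realType}.
Notation RR := (measurableTypeR R).
Implicit Types u v : RR * RR -> R[i].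

Lemma cintbleZ d (T : measurableType d) (mu : {measure set T -> \bar R}) (c : R[i])
    (f : T -> R[i]) : cintble mu f -> cintble mu (fun x => c * f x).
Proof.
move=> fi; have mf_ := cintble_meas fi; have nf := mf_normc mf_.
apply: cintbleP; first by cmf.
under eq_integral do rewrite normcM'.
rewrite ge0_integralZE ?normc_ge0//; last by move=> x; exact: normc_ge0.
by apply: lte_mul_pinfty; rewrite ?lee_fin ?normc_ge0//; exact: cintble_normc.
Qed.

Lemma L2_cintble u v : L2 u -> L2 v -> cintble plane (fun z => u z * v z).
Proof.
move=> Lu Lv; have [mu_ _] := Lu; have [mv _] := Lv.
apply: (cintble_le (g := fun z => normc (u z) * normc (v z))); first by cmf.
  by move=> z; rewrite normcM'.
exact: L2_product.
Qed.

Lemma L2_scale (t : R) (y : RR * RR) u : t != 0 -> L2 u ->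
  L2 (fun s => u (y.1 + s.1 * t, y.2 + s.2 * t)).
Proof.
move=> t0 /(L2_affine y.1 y.2 t0).
have -> // : (fun z : RR * RR => u (t * z.1 + y.1, t * z.2 + y.2)) =
  (fun s => u (y.1 + s.1 * t, y.2 + s.2 * t)).
by apply/funext => s; rewrite ![_ + y.1]addrC ![_ + y.2]addrC ![t * _]mulrC.
Qed.

(* The Gaussian [G2 1] has mass [2 pi], whence the factors [pi *+ 2] below. *)
Definition smooth_at (t : R) u (y : RR * RR) : R[i] :=
  cint plane (fun s => u (y.1 + s.1 * t, y.2 + s.2 * t) * (G2 1 s)%:C).

Lemma cintble_smooth_at t u y : t != 0 -> L2 u ->
  cintble plane (fun s => u (y.1 + s.1 * t, y.2 + s.2 * t) * (G2 1 s)%:C).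
Proof.
move=> t0 Lu; apply: L2_cintble; [exact: L2_scale|exact: L2_G2].
Qed.

Lemma cmeas_smooth_at t u : cmeas u -> cmeas (smooth_at t u).
Proof.
move=> mu_; have mG := measurable_G2 (1 : R).
apply: (cmeas_param_cint plane (f := fun p : (RR * RR) * (RR * RR) =>
  u (p.1.1 + p.2.1 * t, p.1.2 + p.2.2 * t) * (G2 1 p.2)%:C)).
by cmf.
Qed.

(** The average at scale t in the form in which the transform of a packet produces it: a Gaussian of
    inverse width 1/t centred at y. *)
Lemma smooth_atE t u y : 0 < t -> L2 u ->
  cint plane (fun p => u p * (G2 t^-1 (p.1 - y.1, p.2 - y.2))%:C) =
  (t ^+ 2)%:C * smooth_at t u y.
Proof.
move=> t0 Lu; have tn0 : t != 0 by rewrite gt_eqF.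
have i : cintble plane (fun p => u p * (G2 t^-1 (p.1 - y.1, p.2 - y.2))%:C).
  apply: L2_cintble => //.
  apply: (@L2_shift R (- y.1) (- y.2) (fun p => (G2 t^-1 p)%:C)).
  by apply: L2_G2; rewrite invr_gt0.
have := plane_cint_affine y.1 y.2 tn0 i.
have -> : (fun z : RR * RR => u (t * z.1 + y.1, t * z.2 + y.2) *
   (G2 t^-1 ((t * z.1 + y.1, t * z.2 + y.2).1 - y.1, (t * z.1 + y.1, t * z.2 + y.2).2 - y.2))%:C) =
   (fun s => u (y.1 + s.1 * t, y.2 + s.2 * t) * (G2 1 s)%:C).
  apply/funext => s; rewrite /= ![_ + y.1]addrC ![_ + y.2]addrC ![t * _]mulrC.
  congr (_ * _%:C); rewrite /G2 /= !(addrAC _ _ (- _)) !subrr !add0r.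
  rewrite -(mulr1 s.1) -(mulr1 s.2).
  by rewrite /gau ![1 * _]mulrC !mulr1 ![t^-1 * _]mulrC !mulfK.
rewrite -/(smooth_at t u y) => ->.
rewrite mulrA -rmorphM /= gtr0_norm// -exprMn mulfV// expr1n mul1r.
by [].
Qed.

(** The error made by averaging u at scale t, measured in L^1 against v. *)
Definition corr (t : R) u v : \bar R := (\int[plane]_s ((G2 1 s)%:E * \int[plane]_y
    (normc (u (y.1 + s.1 * t, y.2 + s.2 * t) - u y) * normc (v y))%:E))%E.

Lemma corr_swap t u v : cmeas u -> cmeas v ->
  corr t u v = (\int[plane]_y \int[plane]_s
    (normc (u (y.1 + s.1 * t, y.2 + s.2 * t) - u y) * normc (v y) * G2 1 s)%:E)%E.
Proof.
move=> mu_ mv; have mG := measurable_G2 (1 : R).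
pose F (p : (RR * RR) * (RR * RR)) := (normc (u (p.1.1 + p.2.1 * t, p.1.2 + p.2.2 * t) - u p.1) *
  normc (v p.1) * G2 1 p.2)%:E.
have mF : measurable_fun [set: (RR * RR) * (RR * RR)] F by rewrite /F; cmf.
have F0 p : (0 <= F p)%E by rewrite lee_fin !mulr_ge0 ?normc_ge0 ?G2_ge0 ?gau_ge0.
rewrite [RHS](fubini_tonelli (m1 := plane) (m2 := plane) F mF F0).
apply: eq_integral => s _; rewrite /F /=.
rewrite -ge0_integralZE; [|exact: G2_ge0|by move=> y; rewrite mulr_ge0 ?normc_ge0|by cmf].
by apply: eq_integral => y _; rewrite mulrC.
Qed.

(** Since the Gaussian has mass 2 pi, (2 pi) u(y) is itself an integral against it, and the two
    integrals are subtracted under one sign. *)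
Lemma smooth_at_diff t u y : t != 0 -> L2 u ->
  ((normc ((pi *+ 2)%:C * u y - smooth_at t u y))%:E <=
   \int[plane]_s (normc (u (y.1 + s.1 * t, y.2 + s.2 * t) - u y) * G2 1 s)%:E)%E.
Proof.
move=> t0 Lu; have [mu_ _] := Lu; have mG := measurable_G2 (1 : R).
have iG : cintble plane (fun s => (G2 1 s)%:C : R[i]).
  apply: (cintble_le (g := G2 1)); first by cmf.
    by move=> s; rewrite normcR ger0_norm ?G2_ge0.
  exact: integral_G2_lty.
have E : (pi *+ 2)%:C * u y = cint plane (fun s => u y * (G2 1 s)%:C).
  rewrite cintZ// mulrC; congr (_ * _); apply: complexP => /=.
    by rewrite /Rintegral integral_G2.
  by rewrite /Rintegral integral0_eq.
have i2 : cintble plane (fun s => (- 1) * (u (y.1 + s.1 * t, y.2 + s.2 * t) * (G2 1 s)%:C)).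
  by apply: cintbleZ; exact: cintble_smooth_at.
have i1 : cintble plane (fun s => u y * (G2 1 s)%:C).
  apply: (cintble_le (g := fun s => normc (u y) * G2 1 s)); first by cmf.
    by move=> s; rewrite normcM' normcR ger0_norm ?G2_ge0.
  rewrite ge0_integralZE ?normc_ge0//; last by move=> s; exact: G2_ge0.
  by rewrite integral_G2 -EFinM ltry.
have -> : (pi *+ 2)%:C * u y - smooth_at t u y = cint plane (fun s => u y * (G2 1 s)%:C +
   (- 1) * (u (y.1 + s.1 * t, y.2 + s.2 * t) * (G2 1 s)%:C)).
  by rewrite (cintD i1 i2) -E (cintZ (-1) (cintble_smooth_at y t0 Lu)) mulN1r.
have i3 : cintble plane (fun s => u y * (G2 1 s)%:C +
   (- 1) * (u (y.1 + s.1 * t, y.2 + s.2 * t) * (G2 1 s)%:C)).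
  move: i1 i2 => [a1 a2] [b1 b2]; split.
    have := integrableD measurableT a1 b1; apply: eq_integrable => // s _.
    by rewrite cReD.
  have := integrableD measurableT a2 b2; apply: eq_integrable => // s _.
  by rewrite cImD.
apply: le_trans (normc_cint_le i3) _; apply: le_integralT => s.
  by rewrite lee_fin normc_ge0.
rewrite lee_fin mulN1r -mulrBl normcM' normcR (ger0_norm (G2_ge0 1 s)).
by rewrite -normcN opprB.
Qed.

Lemma integral_smooth_le t u v : L2 u -> L2 v ->
  (\int[plane]_z \int[plane]_s (normc (v z) * (normc (u (z.1 + s.1 * t, z.2 + s.2 * t)) * G2 1 s))%:E <=
   (pi *+ 2)%:E * \int[plane]_z (normc (v z) * normc (u z))%:E + corr t u v)%E.
Proof.
move=> [mu_ _] [mv _]; have mG := measurable_G2 (1 : R).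
have pi2 : 0 <= pi *+ 2 :> R by rewrite mulrn_wge0// pi_ge0.
rewrite corr_swap// -ge0_integralZE//; last 2 first.
- by move=> z; rewrite mulr_ge0 ?normc_ge0.
- by cmf.
pose F (p : (RR * RR) * (RR * RR)) := (normc (u (p.1.1 + p.2.1 * t, p.1.2 + p.2.2 * t) - u p.1) *
  normc (v p.1) * G2 1 p.2)%:E.
have mF : measurable_fun [set: (RR * RR) * (RR * RR)] F by rewrite /F; cmf.
have F0 p : (0 <= F p)%E by rewrite lee_fin !mulr_ge0 ?normc_ge0 ?G2_ge0 ?gau_ge0.
rewrite -ge0_integralD//; last 4 first.
- by move=> z _; rewrite lee_fin !mulr_ge0 ?normc_ge0.
- by cmf.
- by move=> z _; apply: integral_ge0 => s _; exact: (F0 (z, s)).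
- exact: (measurable_fun_fubini_tonelli_F (m2 := plane) F).
apply: le_integralT => z.
  by apply: integral_ge0 => s _; rewrite lee_fin !mulr_ge0 ?normc_ge0 ?G2_ge0 ?gau_ge0.
have -> : ((pi *+ 2 * (normc (v z) * normc (u z)))%:E = \int[plane]_s ((normc (v z) * normc (u z)) * G2 1 s)%:E)%E.
  rewrite ge0_integralZE ?mulr_ge0 ?normc_ge0//; last by move=> s; exact: G2_ge0.
  by rewrite integral_G2 -EFinM mulrC.
rewrite -ge0_integralDE; [|by move=> s; rewrite !mulr_ge0 ?normc_ge0 ?G2_ge0 ?gau_ge0
  |by move=> s; rewrite !mulr_ge0 ?normc_ge0 ?G2_ge0 ?gau_ge0|by cmf|by cmf].
apply: le_integralT => s; first by rewrite lee_fin !mulr_ge0 ?normc_ge0 ?G2_ge0 ?gau_ge0.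
rewrite lee_fin -mulrDl mulrA ler_wpM2r ?G2_ge0// [normc (_ - _) * _]mulrC -mulrDr.
rewrite ler_wpM2l ?normc_ge0//.
by have := le_normcD (u z) (u (z.1 + s.1 * t, z.2 + s.2 * t) - u z); rewrite addrC subrK.
Qed.

End smoothing.

(** * Testing the weak Fourier transform with wave packets *)

Section parseval.
Context {R : realType}.
Notation RR := (measurableTypeR R).
Implicit Types g h G H : RR * RR -> R[i].

Lemma conjcM (x y : R[i]) : (x * y)^*%C = x^*%C * y^*%C.
Proof. exact: rmorphM. Qed.

Definition dot (p z : RR * RR) : R := p.1 * z.1 + p.2 * z.2.

(** The multiplication formula that defines the distributional Fourier transform. Square
    integrability of G is included; it is read off from the weight of X_{b,1} in
    [fourier_pair_weighted]. *)
Definition fourier_pair g G := [/\ L2 g, L2 G &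
  forall phi, schwartz phi ->
  cint plane (fun p => g p * fourier_transform phi p) = cint plane (fun z => G z * phi z)].

Let tpi : R := pi *+ 2.
Let tpi_gt0 : 0 < tpi. Proof. by rewrite pmulrn_lgt0// pi_gt0. Qed.

(** Test with the packet at position 0 and frequency y: its transform is a Gaussian centred at y.
    This is the inversion formula with a Gaussian cut-off. *)
Lemma smooth_at_fourier g G (t : R) (y : RR * RR) : fourier_pair g G -> 0 < t ->
  smooth_at t g y = (tpi^-1)%:C * cint plane (fun z => G z * ((G2 t z)%:C * cis (dot y z))).
Proof.
move=> [Lg LG pair] t0; have tn0 : t != 0 by rewrite gt_eqF.
have := pair _ (schwartz_atom (0, 0) y t0).
have -> : (fun z => G z * atom t (0, 0) y z) = (fun z => G z * ((G2 t z)%:C * cis (dot y z))).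
  apply/funext => z; rewrite /atom /atom1 /= !subr0 mulrACA -cisD /G2 /dot.
  by rewrite -rmorphM.
have -> : (fun p => g p * fourier_transform (atom t (0, 0) y) p) =
   (fun p => (tpi / t ^+ 2)%:C * (g p * (G2 t^-1 (p.1 - y.1, p.2 - y.2))%:C)).
  apply/funext => p; rewrite fourier_atom//= !mul0r addr0 oppr0 cis0 mul1r.
  by rewrite rmorphM /= mulrCA.
rewrite cintZ; last first.
  apply: L2_cintble => //.
  apply: (@L2_shift R (- y.1) (- y.2) (fun p => (G2 t^-1 p)%:C)).
  by apply: L2_G2; rewrite invr_gt0.
rewrite smooth_atE// mulrA -rmorphM /= divfK ?expf_neq0// => <-.
by rewrite mulrA -rmorphM /= mulVf ?mul1r// gt_eqF.
Qed.

(** The dual test, with position q, frequency 0 and inverse width 1/t: damping h by a Gaussian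
    averages H. *)
Lemma fourier_smooth_at h H (t : R) (q : RR * RR) : fourier_pair h H -> 0 < t ->
  cint plane (fun p => h p * ((G2 t p)%:C * cis (- dot q p))) = (tpi^-1)%:C * smooth_at t H q.
Proof.
move=> [Lh LH pair] t0; have tn0 : t != 0 by rewrite gt_eqF.
have tV0 : 0 < t^-1 by rewrite invr_gt0.
have := pair _ (schwartz_atom q (0, 0) tV0).
have -> : (fun z => H z * atom t^-1 q (0, 0) z) = (fun z => H z * (G2 t^-1 (z.1 - q.1, z.2 - q.2))%:C).
  apply/funext => z; rewrite /atom /atom1 /= !mul0r cis0 !mulr1 /G2 /=.
  by rewrite -rmorphM.
have -> : (fun p => h p * fourier_transform (atom t^-1 q (0, 0)) p) =
   (fun p => (tpi * t ^+ 2)%:C * (h p * ((G2 t p)%:C * cis (- dot q p)))).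
  apply/funext => p; rewrite fourier_atom//= !subr0 invrK exprVn invrK.
  by rewrite rmorphM [RHS]mulrCA; congr (_ * _); rewrite mulrC -mulrA.
rewrite cintZ; last first.
  apply: L2_cintble => //; have [mG _] := L2_G2 t0; apply: (L2_le (L2_G2 t0)).
    have m2 : measurable_fun [set: (RR * RR)%type] (dot q) by rewrite /dot; mf.
    by cmf.
  by move=> z; rewrite normcM' normc_cis mulr1.
rewrite smooth_atE// => E.
have : ((tpi * t ^+ 2)^-1)%:C * ((t ^+ 2)%:C * smooth_at t H q) = (tpi^-1)%:C * smooth_at t H q.
  by rewrite mulrA -rmorphM /= invfM -mulrA mulVf ?mulr1 ?expf_neq0.
rewrite -E mulrA -rmorphM /= mulVf ?mul1r//.
by rewrite mulf_neq0 ?expf_neq0// gt_eqF.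
Qed.

Lemma mf_dot q : measurable_fun [set: (RR * RR)%type] (dot q).
Proof. by rewrite /dot; mf. Qed.

(** The average of g is written through G and the integrals are exchanged. The y-integral is then
    the conjugate of a damped transform of h at z - zeta, that is, an average of H. The damping
    [G2 t y] and the cut-off [G2 t z] give the absolutely convergent majorant A(y) B(z). *)
Lemma parseval_smooth g G h H (t : R) (zeta : RR * RR) :
  fourier_pair g G -> fourier_pair h H -> 0 < t ->
  ((normc (cint plane (fun y => smooth_at t g y * ((h y)^*%C * ((G2 t y)%:C * cis (- dot y zeta))))))%:E
  <= (tpi^-1 ^+ 2)%:E * \int[plane]_z \int[plane]_s
     (normc (G z) * (normc (H (z.1 - zeta.1 + s.1 * t, z.2 - zeta.2 + s.2 * t)) * G2 1 s))%:E)%E.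
Proof.
move=> pg ph t0; have tn0 : t != 0 by rewrite gt_eqF.
have [[mg g2] [mG2 G22] _] := pg; have [[mh h2] [mH H2] _] := ph.
have Lg : L2 g by []. have LG : L2 G by []. have Lh : L2 h by []. have LH : L2 H by [].
have mGt := measurable_G2 t.
have mG1 := measurable_G2 (1 : R).
pose k y := (h y)^*%C * ((G2 t y)%:C * cis (- dot y zeta)).
have mdz : measurable_fun [set: (RR * RR)%type] (fun y => dot y zeta) by rewrite /dot; mf.
have mk : cmeas k by rewrite /k; cmf.
pose A y := normc (h y) * G2 t y.
pose B z := normc (G z) * G2 t z.
have mA : measurable_fun [set: (RR * RR)%type] A by rewrite /A; cmf.
have mB : measurable_fun [set: (RR * RR)%type] B by rewrite /B; cmf.
have A0 y : 0 <= A y by rewrite /A mulr_ge0 ?normc_ge0 ?G2_ge0.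
have B0 z : 0 <= B z by rewrite /B mulr_ge0 ?normc_ge0 ?G2_ge0.
have iA : (\int[plane]_y (A y)%:E < +oo)%E.
  apply: le_lt_trans (L2_product Lh (L2_G2 t0)); apply: le_integralT => y; rewrite ?lee_fin//.
  by rewrite normcR (ger0_norm (G2_ge0 _ _)).
have iB : (\int[plane]_y (B y)%:E < +oo)%E.
  apply: le_lt_trans (L2_product LG (L2_G2 t0)); apply: le_integralT => y; rewrite ?lee_fin//.
  by rewrite normcR (ger0_norm (G2_ge0 _ _)).
have kA y : normc (k y) = A y.
  by rewrite /k !normcM' normcJ' normcR normc_cis mulr1 ger0_norm ?G2_ge0.
pose F (p : (RR * RR) * (RR * RR)) := (G p.2 * ((G2 t p.2)%:C * cis (dot p.1 p.2))) * k p.1.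
have mdd : measurable_fun [set: ((RR * RR) * (RR * RR))%type] (fun p : (RR * RR) * (RR * RR) => dot p.1 p.2).
  by rewrite /dot; mf.
have mF : cmeas F by rewrite /F; cmf.
have FAB y z : normc (F (y, z)) <= A y * B z.
  by rewrite /F /= normcM' kA normcM' normcM' normcR normc_cis mulr1 (ger0_norm (G2_ge0 _ _)) mulrC.
have iGz y : cintble plane (fun z => G z * ((G2 t z)%:C * cis (dot y z))).
  have my := mf_dot y.
  apply: (cintble_le (g := B)) => //; first by cmf.
  by move=> z; rewrite normcM' normcM' normcR normc_cis mulr1 (ger0_norm (G2_ge0 _ _)).
have -> : cint plane (fun y => smooth_at t g y * k y) =
    (tpi^-1)%:C * cint plane (fun y => cint plane (fun z => F (y, z))).
  rewrite -cintZ; last first.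
    apply: (cintble_le (g := fun y => fine (\int[plane]_z (B z)%:E)%E * A y)).
    - exact: (cmeas_param_cint plane mF).
    - move=> y; rewrite -lee_fin.
      have iF : cintble plane (fun z => F (y, z)).
        apply: (cintble_le (g := fun z => A y * B z)).
        + by apply: (cmeas_comp mF); mf.
        + exact: FAB.
        + by rewrite ge0_integralZE//; apply: lte_mul_pinfty; rewrite ?lee_fin.
      apply: le_trans (normc_cint_le iF) _.
      have IB : (\int[plane]_z (B z)%:E)%E \is a fin_num.
        by rewrite ge0_fin_numE//; apply: integral_ge0 => z _; rewrite lee_fin.
      rewrite EFinM fineK// muleC -ge0_integralZE//; apply: le_integralT => z.
        by rewrite lee_fin normc_ge0.
      by rewrite lee_fin; exact: FAB.
    - have IB0 : 0 <= fine (\int[plane]_z (B z)%:E)%E.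
        by apply: fine_ge0; apply: integral_ge0 => z _; rewrite lee_fin.
      by rewrite ge0_integralZE//; apply: lte_mul_pinfty; rewrite ?lee_fin.
  apply: eq_cint => y; rewrite (smooth_at_fourier y pg t0) -mulrA; congr (_ * _).
  rewrite mulrC -cintZ//; apply: eq_cint => z.
  by rewrite /F /= mulrC.
rewrite (cint_fubini mA mB A0 B0 iA iB mF FAB).
have inner z : cint plane (fun y => F (y, z)) =
   (G z * (G2 t z)%:C) * ((tpi^-1)%:C * (smooth_at t H (z.1 - zeta.1, z.2 - zeta.2))^*%C).
  pose q : RR * RR := (z.1 - zeta.1, z.2 - zeta.2).
  have mq := mf_dot q.
  have ih : cintble plane (fun y => h y * ((G2 t y)%:C * cis (- dot q y))).
    apply: (cintble_le (g := A)) => //; first by cmf.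
    by move=> y; rewrite normcM' normcM' normcR normc_cis mulr1 (ger0_norm (G2_ge0 _ _)).
  have -> : (tpi^-1)%:C * (smooth_at t H q)^*%C =
      cint plane (fun y => (h y * ((G2 t y)%:C * cis (- dot q y)))^*%C).
    by rewrite cintJ// (fourier_smooth_at q ph t0) conjcM conjc_real.
  rewrite -cintZ; last first.
    move: ih => [i1 i2]; split.
      by under eq_fun do rewrite cReJ.
    under eq_fun do rewrite cImJ EFinN; exact: integrableN.
  apply: eq_cint => y; rewrite /F /k /= -!mulrA; congr (_ * (_ * _)).
  rewrite !conjcM conjc_real -cisN opprK mulrCA; congr (_ * _).
  rewrite mulrCA; congr (_ * _); rewrite -cisD; congr cis.
  by rewrite /dot /q /=; ring.
rewrite normcM' normcR (ger0_norm (_ : 0 <= tpi^-1)); last by rewrite invr_ge0 ltW.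
have tV0 : 0 <= tpi^-1 by rewrite invr_ge0 ltW.
have smle q : ((normc (smooth_at t H q))%:E <= \int[plane]_s
   (normc (H (q.1 + s.1 * t, q.2 + s.2 * t)) * G2 1 s)%:E)%E.
  apply: le_trans (normc_cint_le (cintble_smooth_at q tn0 LH)) _.
  apply: le_integralT => s; rewrite ?lee_fin ?normc_ge0//.
  by rewrite normcM' normcR (ger0_norm (G2_ge0 _ _)).
(* A uniform bound for the averages of H; with it [B] dominates the outer integrand in z. *)
pose K := tpi * fine (\int[plane]_y (A y)%:E)%E.
have IA : (\int[plane]_z (A z)%:E)%E \is a fin_num.
  by rewrite ge0_fin_numE//; apply: integral_ge0 => z _; rewrite lee_fin.
have smK q : normc (smooth_at t H q) <= K.
  have mq := mf_dot q.
  have ih : cintble plane (fun y => h y * ((G2 t y)%:C * cis (- dot q y))).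
    apply: (cintble_le (g := A)) => //; first by cmf.
    by move=> y; rewrite normcM' normcM' normcR normc_cis mulr1 (ger0_norm (G2_ge0 _ _)).
  have -> : smooth_at t H q = tpi%:C * cint plane (fun y => h y * ((G2 t y)%:C * cis (- dot q y))).
    by rewrite (fourier_smooth_at q ph t0) mulrA -rmorphM /= mulfV ?mul1r// gt_eqF.
  rewrite normcM' normcR gtr0_norm// /K ler_pM2l// -lee_fin fineK//.
  apply: le_trans (normc_cint_le ih) _; apply: le_integralT => y; rewrite ?lee_fin ?normc_ge0//.
  by rewrite normcM' normcM' normcR normc_cis mulr1 (ger0_norm (G2_ge0 _ _)).
have iZ : cintble plane (fun z => cint plane (fun y => F (y, z))).
  apply: (cintble_le (g := fun z => tpi^-1 * K * B z)).
  - apply: (cmeas_param_cint plane (f := fun p => F (p.2, p.1))).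
    by apply: (cmeas_comp mF); apply: measurable_fun_pair; mf.
  - move=> z; rewrite inner !normcM' normcJ' !normcR (ger0_norm (G2_ge0 _ _)) (ger0_norm tV0).
    by rewrite mulrC; apply: ler_wpM2r; [exact: B0|apply: ler_wpM2l].
  - have K0 : 0 <= tpi^-1 * K.
      apply: mulr_ge0 => //; apply: mulr_ge0; first exact: ltW.
      by apply: fine_ge0; apply: integral_ge0 => y _; rewrite lee_fin.
    by rewrite ge0_integralZE//; apply: lte_mul_pinfty; rewrite ?lee_fin.
have mHn := mf_normc mH; have mGn := mf_normc mG2.
have mW : measurable_fun [set: (RR * RR)%type] (fun z => \int[plane]_s
     (normc (G z) * (normc (H (z.1 - zeta.1 + s.1 * t, z.2 - zeta.2 + s.2 * t)) * G2 1 s))%:E)%E.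
  apply: (measurable_fun_fubini_tonelli_F (m2 := plane) (fun p : (RR * RR) * (RR * RR) =>
    (normc (G p.1) * (normc (H (p.1.1 - zeta.1 + p.2.1 * t, p.1.2 - zeta.2 + p.2.2 * t)) * G2 1 p.2))%:E)).
    by cmf.
  by move=> p; rewrite lee_fin !mulr_ge0 ?normc_ge0 ?gau_ge0.
have W0 z : (0 <= \int[plane]_s
     (normc (G z) * (normc (H (z.1 - zeta.1 + s.1 * t, z.2 - zeta.2 + s.2 * t)) * G2 1 s))%:E)%E.
  by apply: integral_ge0 => s _; rewrite lee_fin !mulr_ge0 ?normc_ge0 ?gau_ge0.
rewrite expr2 !EFinM -muleA; apply: lee_wpmul2l; first by rewrite lee_fin.
apply: le_trans (normc_cint_le iZ) _.
rewrite -ge0_integralZl//; apply: le_integralT => z; first by rewrite lee_fin normc_ge0.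
rewrite inner !normcM' normcJ' !normcR (ger0_norm (G2_ge0 _ _)) (ger0_norm tV0).
have Sz0 : (0 <= \int[plane]_s (normc (H (z.1 - zeta.1 + s.1 * t, z.2 - zeta.2 + s.2 * t)) * G2 1 s)%:E)%E.
  by apply: integral_ge0 => s _; rewrite lee_fin !mulr_ge0 ?normc_ge0 ?gau_ge0.
rewrite ge0_integralZE ?normc_ge0//; last 2 first.
- by move=> s; rewrite !mulr_ge0 ?normc_ge0 ?gau_ge0.
- by cmf.
apply: (@le_trans _ _ ((tpi^-1)%:E * ((normc (G z))%:E * (normc (smooth_at t H (z.1 - zeta.1, z.2 - zeta.2)))%:E))%E).
  rewrite -!EFinM lee_fin mulrCA ler_wpM2l// ler_wpM2r ?normc_ge0//.
  by rewrite ler_piMr ?normc_ge0// G2_le1.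
apply: lee_wpmul2l; first by rewrite lee_fin.
by apply: lee_wpmul2l; [rewrite lee_fin normc_ge0|exact: smle].
Qed.

End parseval.

(** * The limit of vanishing scale *)

Section parseval_limit.
Context {R : realType}.
Notation RR := (measurableTypeR R).
Implicit Types g h G H : RR * RR -> R[i].

Let tpi : R := pi *+ 2.
Let tpi_gt0 : 0 < tpi. Proof. by rewrite pmulrn_lgt0// pi_gt0. Qed.

(** Boundedness on the Fourier side makes the average of g times the damped h integrable. *)
Lemma smooth_at_bounded g G (t : R) : fourier_pair g G -> 0 < t ->
  exists K, forall y, normc (smooth_at t g y) <= K.
Proof.
move=> pg t0; have [Lg LG _] := pg; have [mG _] := LG.
have mGt := measurable_G2 t; have mGn := mf_normc mG.
pose B z := normc (G z) * G2 t z.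
have B0 z : 0 <= B z by rewrite /B mulr_ge0 ?normc_ge0 ?G2_ge0.
have iB : (\int[plane]_y (B y)%:E < +oo)%E.
  apply: le_lt_trans (L2_product LG (L2_G2 t0)); apply: le_integralT => y; rewrite ?lee_fin//.
  by rewrite normcR (ger0_norm (G2_ge0 _ _)).
have IB : (\int[plane]_z (B z)%:E)%E \is a fin_num.
  by rewrite ge0_fin_numE//; apply: integral_ge0 => z _; rewrite lee_fin.
exists (tpi^-1 * fine (\int[plane]_z (B z)%:E)%E) => y.
have my := mf_dot y.
have nB z : normc (G z * ((G2 t z)%:C * cis (dot y z))) = B z.
  by rewrite normcM' normcM' normcR normc_cis mulr1 (ger0_norm (G2_ge0 _ _)).
have ih : cintble plane (fun z => G z * ((G2 t z)%:C * cis (dot y z))).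
  by apply: (cintble_le (g := B)); [by cmf|by move=> z; rewrite nB|].
rewrite (smooth_at_fourier y pg t0) normcM' normcR ger0_norm ?invr_ge0 ?(ltW tpi_gt0)//.
rewrite ler_pM2l ?invr_gt0// -lee_fin fineK//.
apply: le_trans (normc_cint_le ih) _; apply: le_integralT => z; rewrite lee_fin ?normc_ge0//.
by rewrite nB.
Qed.

(** From exp (- x) >= 1 - x; t^2 is weakened to t so that the rate is [harmonic n] itself. *)
Lemma G2_ge (t : R) (y : RR * RR) : 0 <= t -> t <= 1 ->
  1 - G2 t y <= t * (y.1 ^+ 2 + y.2 ^+ 2).
Proof.
move=> t0 t1.
have -> : G2 t y = expR (- (t ^+ 2 * (y.1 ^+ 2 + y.2 ^+ 2) / 2)).
  by rewrite /G2 /gau -expRD; congr expR; rewrite !exprMn; field.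
have := expR_ge1Dx (- (t ^+ 2 * (y.1 ^+ 2 + y.2 ^+ 2) / 2)).
set N := y.1 ^+ 2 + y.2 ^+ 2.
have N0 : 0 <= N by rewrite addr_ge0 ?sqr_ge0.
have : t ^+ 2 * N <= t * N.
  by apply: ler_wpM2r => //; rewrite expr2 ler_piMr.
have : 0 <= t * N by rewrite mulr_ge0.
lra.
Qed.

Lemma corr_ge0 (t : R) g h : (0 <= corr t g h)%E.
Proof.
apply: integral_ge0 => s _; apply: mule_ge0; first by rewrite lee_fin G2_ge0.
by apply: integral_ge0 => y _; rewrite lee_fin mulr_ge0 ?normc_ge0.
Qed.

Lemma vanish_harmonic : vanish (fun n => (harmonic n)%:E : \bar R).
Proof.
apply: cvg_vanish => [n|]; first by rewrite lee_fin /harmonic invr_ge0.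
apply: cvg_EFin; first exact: nearW.
exact: cvg_harmonic.
Qed.

(** [parseval_smooth] differs from the claim by three errors that vanish with the scale: averaging
    H, tested against G; averaging g, tested against h; and the damping factor 1 - [G2 t]. *)
Lemma parseval_bound g G h H (zeta : RR * RR) : fourier_pair g G -> fourier_pair h H ->
  ((normc (cint plane (fun y => g y * ((h y)^*%C * cis (- dot y zeta)))))%:E <=
  (tpi^-1 ^+ 2)%:E * \int[plane]_z (normc (G z) * normc (H (z.1 - zeta.1, z.2 - zeta.2)))%:E)%E.
Proof.
move=> pg ph; have [Lg LG _] := pg; have [Lh LH _] := ph.
have [mg _] := Lg; have [mh _] := Lh.
pose Hz z := H (z.1 - zeta.1, z.2 - zeta.2).
have LHz : L2 Hz by exact: (L2_shift (- zeta.1) (- zeta.2) LH).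
have [mHz _] := LHz; have [mG _] := LG.
have mdz : measurable_fun [set: (RR * RR)%type] (fun y => dot y zeta) by rewrite /dot; mf.
pose k y := (h y)^*%C * cis (- dot y zeta).
have mk : cmeas k by rewrite /k; cmf.
have nk y : normc (k y) = normc (h y) by rewrite normcM' normcJ' normc_cis mulr1.
have Lk : L2 k by apply: (L2_le Lh) => // y; rewrite nk.
set B := cint plane _; set X := (\int[plane]_z _)%E.
have X0 : (0 <= X)%E by apply: integral_ge0 => z _; rewrite lee_fin mulr_ge0 ?normc_ge0.
have Xfin : X \is a fin_num by rewrite ge0_fin_numE//; exact: (L2_product LG LHz).
have tV0 : 0 <= tpi^-1 by rewrite invr_ge0 ltW.
have gh0 y : 0 <= normc (g y) * normc (h y) by rewrite mulr_ge0 ?normc_ge0.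
have mgn := mf_normc mg; have mhn := mf_normc mh.
pose E2 n := (\int[plane]_y (tpi * (normc (g y) * normc (h y)) * (1 - G2 (harmonic n) y))%:E)%E.
have G2c (t : R) y : 0 <= 1 - G2 t y by rewrite subr_ge0 G2_le1.
have e2 n y : 0 <= tpi * (normc (g y) * normc (h y)) * (1 - G2 (harmonic n) y).
  by apply: mulr_ge0; [apply: mulr_ge0; [exact: ltW|exact: gh0]|exact: G2c].
have vE2 : vanish E2.
  apply: (@vanish_integral _ _ _ plane (fun n y => (tpi * (normc (g y) * normc (h y)) * (1 - G2 (harmonic n) y))%:E)
     (fun y => (tpi * (normc (g y) * normc (h y)))%:E)).
  - by move=> n; have mGt := measurable_G2 (harmonic n : R); cmf.
  - by cmf.
  - by move=> n y; rewrite lee_fin.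
  - move=> n y; rewrite lee_fin; apply: ler_piMr.
      by apply: mulr_ge0; [exact: ltW|exact: gh0].
    by rewrite gerBl; exact: G2_ge0.
  - rewrite ge0_integralZE ?(ltW tpi_gt0)//; last by cmf.
    apply: lte_mul_pinfty; rewrite ?lee_fin ?(ltW tpi_gt0)//; exact: L2_product.
  - move=> y _; pose c := tpi * (normc (g y) * normc (h y)) * (y.1 ^+ 2 + y.2 ^+ 2).
    have gh1 : 0 <= tpi * (normc (g y) * normc (h y)) by apply: mulr_ge0; [exact: ltW|exact: gh0].
    have c0 : 0 <= c by apply: mulr_ge0 => //; rewrite addr_ge0 ?sqr_ge0.
    apply: le_vanish (vanishZ c0 vanish_harmonic) => n.
    rewrite -EFinM lee_fin.
    have -> : c * harmonic n = tpi * (normc (g y) * normc (h y)) * (harmonic n * (y.1 ^+ 2 + y.2 ^+ 2)).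
      by rewrite /c -!mulrA; congr (_ * (_ * (_ * _))); rewrite mulrC.
    by apply: ler_wpM2l => //; apply: G2_ge; rewrite ?harmonic_le1// /harmonic invr_ge0.
have vE1 : vanish (fun n => corr (harmonic n) g h) by exact: vanish_corr.
have vE3 : vanish (fun n => (tpi^-1 ^+ 2)%:E * corr (harmonic n) Hz G)%E.
  apply: vanishZ; first exact: sqr_ge0.
  exact: vanish_corr.
(* The factor 2 pi on the left is the mass of the Gaussian that averages g; the one that averages H
   has turned (2 pi)^-2 into (2 pi)^-1 on the right. *)
have main n : ((tpi * normc B)%:E <= (tpi^-1)%:E * X +
   ((tpi^-1 ^+ 2)%:E * corr (harmonic n) Hz G + (corr (harmonic n) g h + E2 n)))%E.
  set t : R := harmonic n.
  have t0 : 0 < t by rewrite /t /harmonic invr_gt0 ltr0n.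
  have tn0 : t != 0 by rewrite gt_eqF.
  have mGt := measurable_G2 t.
  pose J := cint plane (fun y => smooth_at t g y * ((h y)^*%C * ((G2 t y)%:C * cis (- dot y zeta)))).
  have JE : J = cint plane (fun y => smooth_at t g y * (k y * (G2 t y)%:C)).
    by apply: eq_cint => y; rewrite /k; congr (_ * _); rewrite -mulrA; congr (_ * _); rewrite mulrC.
  have HJ : ((normc J)%:E <= (tpi^-1)%:E * X + (tpi^-1 ^+ 2)%:E * corr t Hz G)%E.
    apply: le_trans (parseval_smooth zeta pg ph t0) _.
    have -> : ((tpi^-1)%:E * X + (tpi^-1 ^+ 2)%:E * corr t Hz G =
       (tpi^-1 ^+ 2)%:E * (tpi%:E * X + corr t Hz G))%E.
      have := corr_ge0 t Hz G; move: (corr t Hz G) => I I0.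
      have tX : (0 <= tpi%:E * X)%E.
        by apply: mule_ge0; [rewrite lee_fin; exact: ltW|exact: X0].
      rewrite (ge0_muleDr _ tX I0).
      by rewrite muleA -EFinM expr2 -mulrA mulVf ?mulr1// gt_eqF.
    apply: lee_wpmul2l; first by rewrite lee_fin sqr_ge0.
    apply: le_trans _ (integral_smooth_le t LHz LG).
    rewrite le_eqVlt; apply/orP; left; apply/eqP; apply: eq_integral => z _.
    apply: eq_integral => s _; rewrite /Hz /=.
    by rewrite (addrAC z.1) (addrAC z.2).
  have [K HK] := smooth_at_bounded pg t0.
  have K0 : 0 <= K by exact: le_trans (normc_ge0 _) (HK (0, 0)).
  have mS := cmeas_smooth_at t mg.
  have iS : cintble plane (fun y => smooth_at t g y * (k y * (G2 t y)%:C)).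
    apply: (cintble_le (g := fun y => K * (normc (h y) * normc ((G2 t y)%:C : R[i])))).
    - by cmf.
    - by move=> y; rewrite normcM' [normc (k y * _)]normcM' nk; apply: ler_wpM2r => //; rewrite mulr_ge0 ?normc_ge0.
    - rewrite ge0_integralZE//; last 2 first.
      + by move=> y; rewrite mulr_ge0 ?normc_ge0.
      + by under eq_fun do rewrite normcR; cmf.
      apply: lte_mul_pinfty; rewrite ?lee_fin//; exact: (L2_product Lh (L2_G2 t0)).
  have iB : cintble plane (fun y => g y * k y) by exact: L2_cintble.
  have BE : tpi%:C * B = J + cint plane (fun y => tpi%:C * (g y * k y) + (-1) * (smooth_at t g y * (k y * (G2 t y)%:C))).
    rewrite cintD; [|exact: cintbleZ|exact: cintbleZ].
    by rewrite (cintZ _ iB) (cintZ _ iS) -JE mulN1r addrC subrK.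
  have iD : cintble plane (fun y => tpi%:C * (g y * k y) + (-1) * (smooth_at t g y * (k y * (G2 t y)%:C))).
    move: (cintbleZ tpi%:C iB) (cintbleZ (-1) iS) => [a1 a2] [b1 b2]; split.
      have := integrableD measurableT a1 b1; apply: eq_integrable => // s _.
      by rewrite cReD.
    have := integrableD measurableT a2 b2; apply: eq_integrable => // s _.
    by rewrite cImD.
  have -> : tpi * normc B = normc (tpi%:C * B) by rewrite normcM' normcR gtr0_norm.
  rewrite BE; apply: le_trans (_ : ((normc J)%:E + (normc (cint plane (fun y => tpi%:C * (g y * k y) +
    (-1) * (smooth_at t g y * (k y * (G2 t y)%:C)))))%:E <= _)%E).
    by rewrite -EFinD lee_fin le_normcD.
  rewrite addeA; apply: leeD => //.
  apply: le_trans (normc_cint_le iD) _.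
  rewrite corr_swap//.
  have mG1 := measurable_G2 (1 : R).
  pose F (p : (RR * RR) * (RR * RR)) := (normc (g (p.1.1 + p.2.1 * t, p.1.2 + p.2.2 * t) - g p.1) *
    normc (h p.1) * G2 1 p.2)%:E.
  have mF : measurable_fun [set: (RR * RR) * (RR * RR)] F by rewrite /F; cmf.
  have F0 p : (0 <= F p)%E by rewrite lee_fin !mulr_ge0 ?normc_ge0 ?gau_ge0.
  rewrite -ge0_integralD//; last 4 first.
  - by move=> y _; apply: integral_ge0 => s _; exact: (F0 (y, s)).
  - exact: (measurable_fun_fubini_tonelli_F (m2 := plane) F).
  - by move=> y _; rewrite lee_fin; exact: (e2 n).
  - by cmf.
  apply: le_integralT => y; first by rewrite lee_fin normc_ge0.
  (* The total error is split into the averaging of g, still damped, and the missing part of the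
     damping. *)
  have -> : tpi%:C * (g y * k y) + (-1) * (smooth_at t g y * (k y * (G2 t y)%:C)) =
    k y * ((G2 t y)%:C * (tpi%:C * g y - smooth_at t g y) + (tpi * (1 - G2 t y))%:C * g y).
    have -> : (tpi * (1 - G2 t y))%:C = tpi%:C * (1 - (G2 t y)%:C) :> R[i].
      by move: tpi (G2 t y) => p q; apply/eqP; rewrite eq_complex /=; apply/andP; split; apply/eqP; ring.
    by move: (tpi%:C) (G2 t y)%:C (k y) (g y) (smooth_at t g y) => p q r s u; ring.
  apply: (@le_trans _ _ ((normc (h y))%:E * ((normc (tpi%:C * g y - smooth_at t g y))%:E +
     (tpi * (1 - G2 t y) * normc (g y))%:E))%E).
    rewrite -EFinD -EFinM lee_fin normcM' nk; apply: ler_wpM2l; first exact: normc_ge0.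
    apply: le_trans (le_normcD _ _) _; apply: lerD.
      rewrite normcM' normcR (ger0_norm (G2_ge0 t y)).
      by apply: ler_piMl; [exact: normc_ge0|exact: G2_le1].
    rewrite normcM' normcR ger0_norm//.
    by apply: mulr_ge0; [exact: ltW|exact: G2c].
  have n1 : (0 <= (normc (tpi%:C * g y - smooth_at t g y))%:E)%E by rewrite lee_fin normc_ge0.
  have n2 : (0 <= (tpi * (1 - G2 t y) * normc (g y))%:E)%E.
    by rewrite lee_fin; apply: mulr_ge0; [apply: mulr_ge0; [exact: ltW|exact: G2c]|exact: normc_ge0].
  rewrite (ge0_muleDr _ n1 n2).
  apply: leeD; last first.
    by rewrite -EFinM lee_fin le_eqVlt; apply/orP; left; apply/eqP; ring.
  apply: (@le_trans _ _ ((normc (h y))%:E * \int[plane]_s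
    (normc (g (y.1 + s.1 * t, y.2 + s.2 * t) - g y) * G2 1 s)%:E)%E).
    apply: lee_wpmul2l; first by rewrite lee_fin normc_ge0.
    exact: smooth_at_diff.
  have p0 s : 0 <= normc (g (y.1 + s.1 * t, y.2 + s.2 * t) - g y) * G2 1 s.
    by apply: mulr_ge0; [exact: normc_ge0|exact: G2_ge0].
  have mp : measurable_fun [set: (RR * RR)%type]
      (fun s => normc (g (y.1 + s.1 * t, y.2 + s.2 * t) - g y) * G2 1 s) by cmf.
  have /= <- := ge0_integralZE plane (normc_ge0 (h y)) p0 mp.
  apply: le_integralT => s; first by rewrite lee_fin; apply: mulr_ge0; [exact: normc_ge0|exact: p0].
  by rewrite lee_fin mulrA [normc (h y) * _]mulrC.
have : ((tpi * normc B)%:E <= (tpi^-1)%:E * X)%E.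
  apply/lee_addgt0Pr => e e0.
  have [m _ Hm] := vanishD vE3 (vanishD vE1 vE2) e0.
  apply: le_trans (main m) _; exact: leeD (lexx _) (Hm m (leqnn m)).
rewrite -(fineK Xfin) -!EFinM !lee_fin -(ler_pM2l (_ : 0 < tpi^-1)) ?invr_gt0//.
by rewrite mulKf ?gt_eqF// expr2 -mulrA.
Qed.

End parseval_limit.

(** * Schwartz functions *)

Section separately_continuous.
Context {R : realType}.
Notation RR := (measurableTypeR R).

Let grid n (x : R) : R := (Num.floor (n.+1%:R * x))%:~R / n.+1%:R.

Let cvg_grid (x : R) : grid n x @[n --> \oo] --> x.
Proof.
have le n : x - harmonic n <= grid n x <= x.
  have n0 : 0 < n.+1%:R :> R by rewrite ltr0n.
  have /andP[f1 f2] := floor_itv (n.+1%:R * x).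
  rewrite /grid ler_pdivrMr// [x * _]mulrC f1 andbT ler_pdivlMr// mulrBl mulVf ?gt_eqF//.
  by move: f2; rewrite intrD /= => /ltW; lra.
apply: (@squeeze_cvgr _ _ _ _ (fun n => x - harmonic n) (fun=> x)).
- by apply: nearW => n; exact: le.
- by rewrite -[X in _ --> X]subr0; apply: cvgB; [exact: cvg_cst|exact: cvg_harmonic].
- exact: cvg_cst.
Qed.

(* Rounding the first coordinate down to a grid gives measurable approximations. *)
Lemma measurable_separately_continuous (f : RR * RR -> R) :
  (forall t, continuous (fun x : R => f (x, t))) ->
  (forall x, continuous (fun t : R => f (x, t))) ->
  measurable_fun [set: (RR * RR)%type] f.
Proof.
move=> cx ct.
apply: (@measurable_fun_cvg _ _ _ _ (fun n p => f (grid n p.1, p.2))) => [n|[x t] _]; last first.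
  have H : f (grid n x, t) @[n --> \oo] --> f (x, t).
    have c := @cx t x; exact: (cvg_comp (fun n => grid n x) (fun y : R => f (y, t)) (@cvg_grid x) c).
  exact: H.
have n0 : 0 < n.+1%:R :> R by rewrite ltr0n.
pose z k : int := odflt 0 (unpickle k).
pose E k : set (RR * RR) := [set x : R | Num.floor (n.+1%:R * x) = z k] `*` setT.
have -> : [set: (RR * RR)%type] = \bigcup_k E k.
  apply/seteqP; split => // -[x t] _; exists (pickle (Num.floor (n.+1%:R * x))) => //.
  by split => //; rewrite /= /z pickleK.
have mE k : measurable (E k).
  apply: measurableX => //.
  have -> : [set x : R | Num.floor (n.+1%:R * x) = z k] =
      [set` `[(z k)%:~R / n.+1%:R, (z k + 1)%:~R / n.+1%:R[].
    apply/seteqP; split => x /=; rewrite in_itv/= ler_pdivrMr// ltr_pdivlMr// [x * _]mulrC.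
      by move=> <-; exact: floor_itv.
    exact: floor_def.
  exact: measurable_itv.
apply/measurable_fun_bigcup => // k.
apply: (@eq_measurable_fun _ _ _ _ _ (fun p : RR * RR => f ((z k)%:~R / n.+1%:R, p.2))).
  by move=> [x t]; rewrite inE => -[/= <- _].
apply: measurable_funTS.
apply: (@measurableT_comp _ _ _ _ _ _ (fun t : RR => f ((z k)%:~R / n.+1%:R, t))).
  exact: continuous_measurable_fun.
exact: measurable_snd.
Qed.

End separately_continuous.

Section schwartz_functions.
Context {R : realType}.
Notation RR := (measurableTypeR R).
Notation leb := (@lebesgue_measure R).
Implicit Types phi : RR * RR -> R[i].

(** [smooth] speaks of partial derivatives only, so what is directly at hand is continuity in each
    variable separately. *)
Lemma schwartz_cmeas phi : schwartz phi -> cmeas phi.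
Proof.
move=> [sm _].
have cont (f : R -> R) (x : R) : derivable f x 1 -> {for x, continuous f}.
  by move=> /derivable1_diffP; exact: differentiable_continuous.
split; apply: measurable_separately_continuous => y x; apply: cont.
- exact: (sm [::] true (x, y)).1.
- exact: (sm [::] false (y, x)).1.
- exact: (sm [::] true (x, y)).2.
- exact: (sm [::] false (y, x)).2.
Qed.

(** The extra factor 1 + |z.1| is reserved for the multiplier z.1 of the derivative; hence seminorms
    with three powers of z.1 and two of z.2. *)
Lemma schwartz_bound phi : schwartz phi ->
  exists K, 0 <= K /\ forall z, (1 + `|z.1|) * normc (phi z) <= K * (jap 2 z.1 * jap 2 z.2).
Proof.
move=> [_ dc].
have [M0 H0] := dc [::] 0%N 0%N; have [M1 H1] := dc [::] 3%N 0%N.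
have [M2 H2] := dc [::] 0%N 2%N; have [M3 H3] := dc [::] 3%N 2%N.
have K z : (1 + `|z.1|) ^+ 3 * (1 + `|z.2|) ^+ 2 * normc (phi z) <= 8 * (M0 + M1 + M2 + M3).
  move: (H0 z) (H1 z) (H2 z) (H3 z); rewrite /= !expr0 !mul1r mulr1.
  move: (normc_ge0 (phi z)) (normr_ge0 z.1) (normr_ge0 z.2).
  move: (normc (phi z)) `|z.1| `|z.2| => N u v N0 u0 v0 h0 h1 h2 h3.
  have p1 : (1 + u) ^+ 3 <= 4 * (1 + u ^+ 3).
    have -> : (1 + u) ^+ 3 = 4 * (1 + u ^+ 3) - 3 * ((1 - u) ^+ 2 * (1 + u)) by ring.
    by rewrite gerBl mulr_ge0// mulr_ge0 ?sqr_ge0// addr_ge0.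
  have p2 : (1 + v) ^+ 2 <= 2 * (1 + v ^+ 2).
    have -> : (1 + v) ^+ 2 = 2 * (1 + v ^+ 2) - (1 - v) ^+ 2 by ring.
    by rewrite gerBl sqr_ge0.
  apply: (@le_trans _ _ (4 * (1 + u ^+ 3) * (2 * (1 + v ^+ 2)) * N)).
    by apply: ler_wpM2r => //; apply: ler_pM => //; rewrite exprn_ge0// addr_ge0.
  have -> : 4 * (1 + u ^+ 3) * (2 * (1 + v ^+ 2)) * N =
    8 * (N + u ^+ 3 * N + v ^+ 2 * N + u ^+ 3 * v ^+ 2 * N) by ring.
  by apply: ler_wpM2l => //; do 3! apply: lerD => //.
have jE (x : R) : jap 2 x = ((1 + `|x|) ^+ 2)^-1.
  by rewrite /jap powRN powR_mulrn// ltW// onenorm_gt0.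
exists (8 * (M0 + M1 + M2 + M3)); split.
  apply: le_trans (K (0, 0)).
  by rewrite mulr_ge0 ?normc_ge0// mulr_ge0// exprn_ge0// ltW// onenorm_gt0.
move=> z; rewrite !jE -invfM ler_pdivlMr; last by rewrite mulr_gt0// exprn_gt0// onenorm_gt0.
apply: le_trans (K z); rewrite le_eqVlt; apply/orP; left; apply/eqP; ring.
Qed.

Lemma integral_jap_prod (K : R) : 0 <= K ->
  (\int[plane]_z (K * (jap 2 z.1 * jap 2 z.2))%:E < +oo)%E.
Proof.
move=> K0; under eq_integral do rewrite mulrA.
apply: (@integral_prod_bound _ _ _ _ _ leb leb (fun x => K * jap 2 x) (jap 2)); try by mf.
- by move=> x; rewrite mulr_ge0 ?jap_ge0.
- by move=> x; rewrite jap_ge0.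
- exact: integrable_jap2.
- by have := integrable_jap2 (ler01 : 0 <= 1 :> R); under eq_integral do rewrite mul1r.
Qed.

Lemma is_derive_cos_affine (k d x : R) :
  is_derive x 1 (fun y => cos (k * y + d)) (- k * sin (k * x + d)).
Proof.
have := @is_derive1_comp R cos (fun y : R => k * y + d) x _ _ (is_derive_cos _) (is_derive_affine k d x).
by rewrite mulrC mulrN -mulNr.
Qed.

Lemma is_derive_sin_affine (k d x : R) :
  is_derive x 1 (fun y => sin (k * y + d)) (k * cos (k * x + d)).
Proof.
have := @is_derive1_comp R sin (fun y : R => k * y + d) x _ _ (is_derive_sin _) (is_derive_affine k d x).
by rewrite mulrC.
Qed.

(** Differentiation under the integral: the factor - i p.1 falls on phi, and [schwartz_bound]
    supplies a majorant independent of z. *)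
Lemma partial_fourier_transform phi z : schwartz phi ->
  partial true (fourier_transform phi) z =
  fourier_transform (fun p => (0 -i* p.1) * phi p) z.
Proof.
move=> sphi; have mphi := schwartz_cmeas sphi.
have [K [K0 HK]] := schwartz_bound sphi.
have iK := integral_jap_prod K0.
have b0 p : normc (phi p) <= K * (jap 2 p.1 * jap 2 p.2).
  by apply: le_trans (HK p); rewrite ler_peMl ?normc_ge0 ?onenorm_ge1.
have b1 p : `|p.1| * normc (phi p) <= K * (jap 2 p.1 * jap 2 p.2).
  by apply: le_trans (HK p); rewrite ler_wpM2r ?normc_ge0// lerDr.
have nc p (a : R) : normc (phi p * (cos a -i* sin a)) = normc (phi p).
  have -> : cos a -i* sin a = cis (- a) by rewrite /cis cosN sinN.
  by rewrite normcM' normc_cis mulr1.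
have nd p (a : R) : normc ((0 -i* p.1) * phi p * (cos a -i* sin a)) = `|p.1| * normc (phi p).
  have -> : cos a -i* sin a = cis (- a) by rewrite /cis cosN sinN.
  rewrite !normcM' normc_cis mulr1; congr (_ * _).
  by rewrite /normc /= expr0n /= add0r sqrrN sqrtr_sqr.
have ma (y : R) : measurable_fun [set: (RR * RR)%type] (fun p => p.1 * y + p.2 * z.2) by mf.
have mc (y : R) : cmeas (fun p : RR * RR => phi p * (cos (p.1 * y + p.2 * z.2) -i* sin (p.1 * y + p.2 * z.2))).
  apply: cmeasM => //; split => /=; first by apply: mfcont => //; exact: continuous_cos.
  by apply: mfN; apply: mfcont => //; exact: continuous_sin.
have ic (y : R) : cintble plane (fun p => phi p * (cos (p.1 * y + p.2 * z.2) -i* sin (p.1 * y + p.2 * z.2))).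
  by apply: (cintble_le (mc y) _ iK) => p; rewrite nc.
have iG : plane.-integrable [set: (RR * RR)%type] (fun p => (K * (jap 2 p.1 * jap 2 p.2))%:E).
  apply: (integrable_le _ _ iK); first by mf.
  by move=> p; rewrite ger0_norm// mulr_ge0// mulr_ge0 ?jap_ge0.
have dRe (y : R) p : is_derive y 1
    (fun x : R => complex.Re (phi p * (cos (p.1 * x + p.2 * z.2) -i* sin (p.1 * x + p.2 * z.2))))
    (complex.Re ((0 -i* p.1) * phi p * (cos (p.1 * y + p.2 * z.2) -i* sin (p.1 * y + p.2 * z.2)))).
  have -> : (fun x : R => complex.Re (phi p * (cos (p.1 * x + p.2 * z.2) -i* sin (p.1 * x + p.2 * z.2)))) =
     (fun x => complex.Re (phi p) * cos (p.1 * x + p.2 * z.2) + complex.Im (phi p) * sin (p.1 * x + p.2 * z.2)).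
    by apply/funext => x; rewrite cReM /= mulrN opprK.
  apply: is_derive_eq (is_derive_add (is_derive_mul (is_derive_constl _ _) (is_derive_cos_affine _ _ _))
    (is_derive_mul (is_derive_constl _ _) (is_derive_sin_affine _ _ _))) _.
  rewrite !cReM !cImM /=; ring.
have dIm (y : R) p : is_derive y 1
    (fun x : R => complex.Im (phi p * (cos (p.1 * x + p.2 * z.2) -i* sin (p.1 * x + p.2 * z.2))))
    (complex.Im ((0 -i* p.1) * phi p * (cos (p.1 * y + p.2 * z.2) -i* sin (p.1 * y + p.2 * z.2)))).
  have -> : (fun x : R => complex.Im (phi p * (cos (p.1 * x + p.2 * z.2) -i* sin (p.1 * x + p.2 * z.2)))) =
     (fun x => complex.Im (phi p) * cos (p.1 * x + p.2 * z.2) + (- complex.Re (phi p)) * sin (p.1 * x + p.2 * z.2)).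
    by apply/funext => x; rewrite cImM /=; ring.
  apply: is_derive_eq (is_derive_add (is_derive_mul (is_derive_constl _ _) (is_derive_cos_affine _ _ _))
    (is_derive_mul (is_derive_constl _ _) (is_derive_sin_affine _ _ _))) _.
  rewrite !cImM !cReM /=; ring.
have nb p (y : R) : normc ((0 -i* p.1) * phi p * (cos (p.1 * y + p.2 * z.2) -i* sin (p.1 * y + p.2 * z.2)))
    <= K * (jap 2 p.1 * jap 2 p.2) by rewrite nd; exact: b1.
have HRe := is_derive_Rintegral (a := z.1) (fun y => (ic y).1) dRe
  (fun y p _ => le_trans (normr_Re_le _) (nb p y)) iG.
have HIm := is_derive_Rintegral (a := z.1) (fun y => (ic y).2) dIm
  (fun y p _ => le_trans (normr_Im_le _) (nb p y)) iG.
rewrite /partial /fourier_transform /slice /cintegral /=; apply: complexP => /=.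
  by rewrite derive1E; have [_ ->] := HRe.
by rewrite derive1E; have [_ ->] := HIm.
Qed.

End schwartz_functions.

(** * The derivative of the product *)

Section product_representation.
Context {R : realType}.
Notation RR := (measurableTypeR R).
Implicit Types g h G H phi : RR * RR -> R[i].

(** The Fourier transform of g times the conjugate of h as a genuine integral, the product of two
    square integrable functions being integrable. *)
Definition product_fourier g h (z : RR * RR) : R[i] :=
  cint plane (fun p => g p * ((h p)^*%C * cis (- dot p z))).

Lemma dotC (p z : RR * RR) : dot p z = dot z p.
Proof. by rewrite /dot [p.1 * _]mulrC [p.2 * _]mulrC. Qed.

Lemma fourier_transformE phi z : fourier_transform phi z = cint plane (fun p => phi p * cis (- dot p z)).
Proof.
change (cint plane (fun p : RR * RR => phi p * (cos (dot p z) -i* sin (dot p z))) =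
  cint plane (fun p => phi p * cis (- dot p z))).
by apply: eq_cint => p; rewrite /cis cosN sinN.
Qed.

(** The derivative moves onto the transform of phi, where it becomes multiplication of phi by - i
    z.1. Fubini then moves the transform back to the product; the majorant is |g| |h| in one
    variable and [schwartz_bound] in the other. *)
Lemma represented_dx_product g h : L2 g -> L2 h ->
  represented_by (distr_fourier (distr_dx (distr_of (fun p => g p * (h p)^*%C))))
    (fun z => (0 +i* z.1) * product_fourier g h z).
Proof.
move=> Lg Lh; have [mg _] := Lg; have [mh _] := Lh.
have gh := L2_product Lg Lh.
have gh0 p : 0 <= normc (g p) * normc (h p) by apply: mulr_ge0; exact: normc_ge0.
have mgn := mf_normc mg; have mhn := mf_normc mh.
have mdz : measurable_fun [set: (RR * RR) * (RR * RR)] (fun q => dot q.2 q.1) by rewrite /dot; mf.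
have mdz' : measurable_fun [set: (RR * RR) * (RR * RR)] (fun q => dot q.1 q.2) by rewrite /dot; mf.
have miz : cmeas (fun z : RR * RR => 0 +i* z.1) by split => /=; mf.
have mB : cmeas (product_fourier g h).
  by apply: (cmeas_param_cint plane (f := fun q => g q.2 * ((h q.2)^*%C * cis (- dot q.2 q.1)))); cmf.
have mF : cmeas (fun z : RR * RR => (0 +i* z.1) * product_fourier g h z) by cmf.
have nk p z : normc (g p * ((h p)^*%C * cis (- dot p z))) = normc (g p) * normc (h p).
  by rewrite !normcM' normcJ' normc_cis mulr1.
have iB z : cintble plane (fun p => g p * ((h p)^*%C * cis (- dot p z))).
  apply: (cintble_le (g := fun p => normc (g p) * normc (h p))) => //; last by move=> p; rewrite nk.
  have md : measurable_fun [set: (RR * RR)%type] (fun p => dot p z) by rewrite /dot; mf.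
  by cmf.
have [Bm [Bm0 BB]] : exists Bm, 0 <= Bm /\ forall z, normc (product_fourier g h z) <= Bm.
  exists (fine (\int[plane]_p (normc (g p) * normc (h p))%:E)%E); split.
    by apply: fine_ge0; apply: integral_ge0 => p _; rewrite lee_fin.
  move=> z; rewrite -lee_fin fineK; last first.
    by rewrite ge0_fin_numE//; apply: integral_ge0 => p _; rewrite lee_fin.
  apply: le_trans (normc_cint_le (iB z)) _; apply: le_integralT => p; first by rewrite lee_fin normc_ge0.
  by rewrite nk.
split; first exact: mF.
move=> phi sphi; have mphi := schwartz_cmeas sphi.
have [K [K0 HK]] := schwartz_bound sphi.
have niz (z : RR * RR) : normc (0 +i* z.1 : R[i]) = `|z.1| by rewrite /normc /= expr0n /= add0r sqrtr_sqr.
have niz' (z : RR * RR) : normc (0 -i* z.1 : R[i]) = `|z.1| by rewrite /normc /= expr0n /= add0r sqrrN sqrtr_sqr.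
have b1 z : `|z.1| * normc (phi z) <= K * (jap 2 z.1 * jap 2 z.2).
  by apply: le_trans (HK z); apply: ler_wpM2r; [exact: normc_ge0|rewrite lerDr].
have iF : cintble plane (fun z : RR * RR => (0 +i* z.1) * product_fourier g h z * phi z).
  have := @cintble_le _ _ R plane (fun z : RR * RR => (0 +i* z.1) * product_fourier g h z * phi z)
    (fun z => (Bm * K) * (jap 2 z.1 * jap 2 z.2)).
  apply.
  - by cmf.
  - move=> z; rewrite !normcM' niz -mulrA [_ * normc (phi z)]mulrC mulrA mulrC -mulrA.
    by apply: ler_pM => //; [exact: normc_ge0|apply: mulr_ge0; [|exact: normc_ge0]].
  - by apply: integral_jap_prod; apply: mulr_ge0.
split; first exact: iF.
pose f (q : (RR * RR) * (RR * RR)) : R[i] := g q.1 * ((h q.1)^*%C * cis (- dot q.1 q.2)) *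
  ((0 -i* q.2.1) * phi q.2).
have mi2 : cmeas (fun q : (RR * RR) * (RR * RR) => 0 -i* q.2.1) by split => /=; mf.
have mf_ : cmeas f by rewrite /f; cmf.
have fAB p z : normc (f (p, z)) <= (normc (g p) * normc (h p)) * (K * (jap 2 z.1 * jap 2 z.2)).
  rewrite /f /= normcM' nk; apply: ler_wpM2l => //.
  by rewrite normcM' niz'.
have mA : measurable_fun [set: (RR * RR)%type] (fun p => normc (g p) * normc (h p)) by mf.
have mK : measurable_fun [set: (RR * RR)%type] (fun z => K * (jap 2 z.1 * jap 2 z.2)) by mf.
have K0' (z : RR * RR) : 0 <= K * (jap 2 z.1 * jap 2 z.2).
  by apply: mulr_ge0 => //; apply: mulr_ge0; exact: jap_ge0.
have fub := cint_fubini mA mK gh0 K0' gh (integral_jap_prod K0) mf_ fAB.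
have ifour (p : RR * RR) : cintble plane (fun z : RR * RR => (0 -i* z.1) * phi z * cis (- dot z p)).
  have md : measurable_fun [set: (RR * RR)%type] (fun z => dot z p) by rewrite /dot; mf.
  have mi3 : cmeas (fun z : RR * RR => 0 -i* z.1 : R[i]) by split => /=; mf.
  have := @cintble_le _ _ R plane (fun z : RR * RR => (0 -i* z.1) * phi z * cis (- dot z p))
    (fun z => K * (jap 2 z.1 * jap 2 z.2)).
  apply=> [|z|]; last exact: integral_jap_prod.
    by cmf.
  by rewrite !normcM' normc_cis mulr1 niz'; exact: b1.
have L1 : cint plane (fun p => g p * (h p)^*%C * partial true (fourier_transform phi) p) =
    cint plane (fun p => cint plane (fun z => f (p, z))).
  apply: eq_cint => p; rewrite (partial_fourier_transform p sphi) fourier_transformE.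
  rewrite -(cintZ _ (ifour p)); apply: eq_cint => z; rewrite /f /= (dotC z).
  by move: (cis _) (0 -i* z.1) (phi z) (g p) ((h p)^*%C) => c d e k l; ring.
have R1 : cint plane (fun z => cint plane (fun p => f (p, z))) =
    cint plane (fun z : RR * RR => (-1) * ((0 +i* z.1) * product_fourier g h z * phi z)).
  apply: eq_cint => z.
  have -> : (-1) * ((0 +i* z.1) * product_fourier g h z * phi z) =
      ((0 -i* z.1) * phi z) * product_fourier g h z.
    have -> : 0 -i* z.1 = - (0 +i* z.1) :> R[i] by apply: complexP; rewrite /= ?oppr0.
    by move: (0 +i* z.1) (phi z) (product_fourier g h z) => c d e; ring.
  by rewrite /product_fourier -(cintZ _ (iB z)); apply: eq_cint => p; rewrite mulrC.
change (- cint plane (fun p => g p * (h p)^*%C * partial true (fourier_transform phi) p) =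
  cint plane (fun z : RR * RR => (0 +i* z.1) * product_fourier g h z * phi z)).
by rewrite L1 fub R1 (cintZ _ iF) mulN1r opprK.
Qed.

End product_representation.

(** * Passage to the Bourgain norms *)

Section norm_bound.
Context {R : realType}.
Notation RR := (measurableTypeR R).
Implicit Types g h G H : RR * RR -> R[i].

(** Only finite elements of S have to be tested, since for c > 0 an infinite one bounds nothing. For
    c = 0 a finite element is needed, and finiteness of the infimum provides it. *)
Lemma lee_mul_ereal_inf (S : set \bar R) (c : R) (Y : \bar R) : 0 <= c ->
  (ereal_inf S < +oo)%E -> (forall x, S x -> (x < +oo)%E -> (Y <= c%:E * x)%E) ->
  (Y <= c%:E * ereal_inf S)%E.
Proof.
move=> c0 Sfin HS; have [x0 Sx0 x0y] := ereal_inf_lt Sfin.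
have [c00|cn0] := eqVneq c 0.
  by move: (HS _ Sx0 x0y); rewrite c00 !mul0e.
have cp : 0 < c by rewrite lt_neqAle eq_sym cn0.
rewrite -lee_pdivrMl//; apply/le_ereal_inf_tmp => x Sx.
rewrite lee_pdivrMl//; have [->|xy] := eqVneq x +oo%E.
  by rewrite gt0_muley ?lte_fin// leey.
by apply: HS => //; rewrite ltey.
Qed.

Lemma weighted_norm_lty (w : RR * RR -> R) G : (weighted_norm w G < +oo)%E ->
  (\int[plane]_z (w z * normc (G z) ^+ 2)%:E < +oo)%E.
Proof. by apply: lty_poweRy; rewrite invr_eq0 pnatr_eq0. Qed.

(** For b >= 0 the weight is at least 1, so a finite weighted norm makes G square integrable. *)
Lemma fourier_pair_weighted b g G : 0 <= b -> square_integrable g ->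
  represented_by (distr_fourier (distr_of g)) G ->
  (weighted_norm (Xw b) G < +oo)%E -> fourier_pair g G.
Proof.
move=> b0 sg [mG rG] /weighted_norm_lty XG; split => //.
  split => //; apply: le_lt_trans XG; apply: le_integralT => z; first by rewrite lee_fin sqr_ge0.
  rewrite lee_fin; apply: ler_peMl; first exact: sqr_ge0.
  have one (q x : R) : 0 <= q -> 1 <= (1 + `|x|) `^ q.
    by move=> q0; rewrite -[leLHS](powRr0 (1 + `|x|)) ler_powR// onenorm_ge1.
  rewrite -[leLHS]mulr1; apply: ler_pM => //; apply: one; first by lra.
  by apply: mulr_ge0.
by move=> phi sphi; have [_] := rG _ sphi.
Qed.

(** The constant is chosen before the weight w, so that it serves both target norms. It is the root
    of c^2 C, where c = (2 pi)^-2 is the factor in [parseval_bound] and C comes from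
    [bilinear_bound]. *)
Lemma weighted_norm_dx_product (a b : R) : 1 / 4 <= a -> 5 / 12 < b -> exists C : R, 0 <= C /\
  forall (w : RR * RR -> R) g G h H, (forall z, 0 <= w z) ->
  (forall z, w z * z.1 ^+ 2 <= Yfac a z) ->
  fourier_pair g G -> fourier_pair h H ->
  (weighted_norm w (fun z : RR * RR => ((0 +i* z.1) * product_fourier g h z)%R) <=
     C%:E * weighted_norm (Xw b) G * weighted_norm (Xw b) H)%E.
Proof.
move=> a4 b5; have [C [C0 HC]] := bilinear_bound a4 b5.
have [c [c0 cE]] : exists c : R, 0 <= c /\ c = ((pi *+ 2)^-1 ^+ 2).
  by exists ((pi *+ 2)^-1 ^+ 2); split => //; exact: sqr_ge0.
exists ((c ^+ 2 * C) `^ (2^-1)); split; first exact: powR_ge0.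
move=> w g G h H w0 wY pg ph; have [_ LG _] := pg; have [_ LH _] := ph.
have [mG _] := LG; have [mH _] := LH.
have nG := mf_normc mG; have nH := mf_normc mH.
pose P z : \bar R := (\int[plane]_y (normc (G y) * normc (H (y.1 - z.1, y.2 - z.2)))%:E)%E.
have P0 z : (0 <= P z)%E.
  by apply: integral_ge0 => y _; rewrite lee_fin; apply: mulr_ge0; exact: normc_ge0.
have mP : measurable_fun [set: (RR * RR)%type] P.
  apply: (measurable_fun_fubini_tonelli_F (m2 := plane)
    (fun q : (RR * RR) * (RR * RR) => (normc (G q.2) * normc (H (q.2.1 - q.1.1, q.2.2 - q.1.2)))%:E)).
    by cmf.
  by move=> q; rewrite lee_fin; apply: mulr_ge0; exact: normc_ge0.
have key : (\int[plane]_z (w z * (normc ((0 +i* z.1) * product_fourier g h z)) ^+ 2)%:E <=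
   (c ^+ 2)%:E * (C%:E * (\int[plane]_y (Xw b y * normc (G y) ^+ 2)%:E *
      \int[plane]_y (Xw b y * normc (H y) ^+ 2)%:E)))%E.
  apply: (@le_trans _ _ ((c ^+ 2)%:E * \int[plane]_z ((Yfac a z)%:E * (P z * P z)))%E); last first.
    apply: lee_wpmul2l; first by rewrite lee_fin sqr_ge0.
    exact: (HC _ _ (fun y => normc_ge0 (G y)) (fun y => normc_ge0 (H y)) nG nH).
  have mY : measurable_fun [set: (RR * RR)%type] (Yfac a : RR * RR -> R) by rewrite /Yfac; mf.
  rewrite -ge0_integralZl//; last 3 first.
  - by apply: emeasurable_funM; [mf|exact: emeasurable_funM].
  - by move=> z _; apply: mule_ge0; [rewrite lee_fin Yfac_ge0|exact: mule_ge0].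
  - by rewrite lee_fin sqr_ge0.
  apply: le_integralT => z; first by rewrite lee_fin mulr_ge0 ?sqr_ge0.
  have Pfin : P z \is a fin_num.
    rewrite ge0_fin_numE//; exact: (L2_product LG (L2_shift (- z.1) (- z.2) LH)).
  have := parseval_bound z pg ph; rewrite -cE -/(product_fourier g h z) -/(P z).
  move: (P0 z) (normc_ge0 (product_fourier g h z)).
  rewrite normcM'; have -> : normc (0 +i* z.1 : R[i]) = `|z.1|.
    by rewrite /normc /= expr0n /= add0r sqrtr_sqr.
  rewrite exprMn mulrA real_normK ?num_real//.
  move: (wY z) (Yfac_ge0 a z) (mulr_ge0 (w0 z) (sqr_ge0 z.1)).
  move: (w z * z.1 ^+ 2) (Yfac a z) (normc _) => W Y B WY Y0 W0.
  have [p ->] : exists p, P z = p%:E by exists (fine (P z)); rewrite fineK.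
  rewrite !lee_fin => p0 B0 Bp.
  have -> : c ^+ 2 * (Y * (p * p)) = Y * (c * p) ^+ 2 by ring.
  apply: ler_pM => //; first exact: sqr_ge0.
  by apply: lerXn2r; rewrite ?nnegrE// mulr_ge0.
rewrite /weighted_norm.
have X0 K : (0 <= \int[plane]_y (Xw b y * normc (K y) ^+ 2)%:E)%E.
  by apply: integral_ge0 => y _; rewrite lee_fin; apply: mulr_ge0; [exact/ltW/Xw_gt0|exact: sqr_ge0].
have c20 : 0 <= c ^+ 2 * C by apply: mulr_ge0 => //; exact: sqr_ge0.
rewrite -poweR_EFin -poweRM ?lee_fin// -poweRM//; last by apply: mule_ge0; rewrite ?lee_fin.
rewrite [X in (_ <= X `^ _)%E](_ : _ = (c ^+ 2)%:E * (C%:E * (\int[plane]_y (Xw b y * normc (G y) ^+ 2)%:E *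
      \int[plane]_y (Xw b y * normc (H y) ^+ 2)%:E)))%E; last first.
  by rewrite EFinM !muleA.
apply: gt0_ler_poweR key; first by rewrite invr_ge0.
  rewrite in_itv /= leey andbT; apply: integral_ge0 => z _; rewrite lee_fin.
  by apply: mulr_ge0 => //; exact: sqr_ge0.
rewrite in_itv /= leey andbT; apply: mule_ge0; first by rewrite lee_fin sqr_ge0.
by apply: mule_ge0; rewrite ?lee_fin//; exact: mule_ge0.
Qed.

(** The factor m is 1 for the first norm and |xi|^(-3/4) for the second. *)
Lemma le_Yfac (a : R) (z : RR * RR) (m : R) : m * z.1 ^+ 2 <= 1 + z.1 ^+ 2 ->
  m * (1 + `|z.1|) `^ (2 * 1) * (1 + `|z.2 - z.1 ^+ 3|) `^ (2 * - a) * z.1 ^+ 2 <= Yfac a z.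
Proof.
move=> mz; rewrite /Yfac /jap mulr1 powR_mulrn; last exact/ltW/onenorm_gt0.
rewrite mulrN; set u := (1 + `|z.1|) ^+ 2; set v := (_ `^ - (2 * a)).
have -> : m * u * v * z.1 ^+ 2 = m * z.1 ^+ 2 * (u * v) by ring.
by apply: ler_wpM2r => //; apply: mulr_ge0; [exact: sqr_ge0|exact: powR_ge0].
Qed.

Lemma low_frequency_weight (x : R) : `|x| `^ (- (3 / 4)) * x ^+ 2 <= 1 + x ^+ 2.
Proof.
(* At 0 the factor x^2 vanishes, whatever value the negative power takes there. *)
have [->|x0] := eqVneq x 0; first by rewrite expr0n /= mulr0 addr0.
have xp : 0 < `|x| by rewrite normr_gt0.
rewrite -[x ^+ 2]real_normK ?num_real//.
have [x1|/ltW x1] := leP 1 `|x|.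
  apply: (@le_trans _ _ (`|x| ^+ 2)); last by rewrite lerDr.
  rewrite ler_piMl ?sqr_ge0// -[leRHS](powRr0 `|x|) ler_powR//; lra.
apply: (@le_trans _ _ 1); last by rewrite lerDl sqr_ge0.
rewrite -powR_mulrn// -powRD; last by rewrite (gt_eqF xp) implybT.
have e0 : 0 <= - (3 / 4) + 2 :> R by lra.
have : `|x| `^ (- (3 / 4) + 2) <= 1 `^ (- (3 / 4) + 2) by apply: ge0_ler_powR; rewrite ?nnegrE.
by rewrite powR1.
Qed.

End norm_bound.

Theorem lemma3p4 (R : realType) (a b : R)
    (ha : 1 / 4 < a < 1 / 2) (hb : 1 / 3 < b < 1 / 2)
    (hab : 4 / 3 < a + 2 * b) :
  exists C : R, forall g h : R * R -> R[i], in_X b 1 g -> in_X b 1 h ->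
    (Y_norm (- a) 1 (distr_dx (distr_of (fun p => (g p * (h p)^*%C)%R)))
       <= C%:E * X_norm b 1 (distr_of g) * X_norm b 1 (distr_of h))%E /\
    (Y_low_norm (- a) 1 (distr_dx (distr_of (fun p => (g p * (h p)^*%C)%R)))
       <= C%:E * X_norm b 1 (distr_of g) * X_norm b 1 (distr_of h))%E.
Proof.
move: ha hb => /andP[/ltW a4 a2] /andP[b3 _].
(* From 2 b > 4/3 - a > 4/3 - 1/2 = 5/6. *)
have b5 : 5 / 12 < b by lra.
have b0 : 0 <= b by lra.
have [C [C0 HC]] := weighted_norm_dx_product a4 b5.
exists C => g h [sg Xg] [sh Xh].
pose F (z : R * R) : R[i] := (0 +i* z.1) * product_fourier g h z.
have bound (w : R * R -> R) : (forall z, 0 <= w z) -> (forall z, w z * z.1 ^+ 2 <= Yfac a z) ->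
    (fourier_norm w (distr_dx (distr_of (fun p => (g p * (h p)^*%C)%R))) <=
     C%:E * X_norm b 1 (distr_of g) * X_norm b 1 (distr_of h))%E.
  move=> w0 wY; set Y := fourier_norm _ _.
  have YGH G H : represented_by (distr_fourier (distr_of g)) G ->
      represented_by (distr_fourier (distr_of h)) H ->
      (weighted_norm (Xw b) G < +oo)%E -> (weighted_norm (Xw b) H < +oo)%E ->
      (Y <= C%:E * weighted_norm (Xw b) G * weighted_norm (Xw b) H)%E.
    move=> rG rH XG XH.
    have pg := fourier_pair_weighted b0 sg rG XG.
    have ph := fourier_pair_weighted b0 sh rH XH.
    apply: le_trans (HC w g G h H w0 wY pg ph).
    apply: ereal_inf_lbound; exists F => //.
    exact: represented_dx_product.
  have N0 K : (0 <= weighted_norm (Xw b) K)%E by exact: poweR_ge0.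
  (* The infima are taken one at a time, over G with H fixed and then over H. Each time the other
     factor is finite and serves as the real constant of [lee_mul_ereal_inf]. *)
  have YH H : represented_by (distr_fourier (distr_of h)) H ->
      (weighted_norm (Xw b) H < +oo)%E ->
      (Y <= C%:E * X_norm b 1 (distr_of g) * weighted_norm (Xw b) H)%E.
    move=> rH XH; have /fineK nE : weighted_norm (Xw b) H \is a fin_num by rewrite ge0_fin_numE.
    rewrite -muleA [(X_norm _ _ _ * _)%E]muleC muleA -nE -EFinM.
    apply: lee_mul_ereal_inf => //; first by rewrite mulr_ge0// fine_ge0.
    move=> _ [G rG <-] XG; rewrite EFinM nE -muleA [(weighted_norm _ H * _)%E]muleC muleA.
    exact: YGH.
  have X0 : (0 <= X_norm b 1 (distr_of g))%E.
    by apply: le_ereal_inf_tmp => _ [G _ <-]; exact: poweR_ge0.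
  have /fineK gE : X_norm b 1 (distr_of g) \is a fin_num by rewrite ge0_fin_numE.
  rewrite -gE -EFinM; apply: lee_mul_ereal_inf => //; first by rewrite mulr_ge0// fine_ge0.
  by move=> _ [H rH <-] XH; rewrite EFinM gE; exact: YH.
split; apply: bound => z.
- by rewrite mulr_ge0// powR_ge0.
- by rewrite -[X in X * _ * _](mul1r ((1 + `|z.1|) `^ _)); apply: le_Yfac; rewrite mul1r lerDr.
- by rewrite mulr_ge0// ?mulr_ge0// powR_ge0.
- by apply: le_Yfac; exact: low_frequency_weight.
Qed.
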